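(* Let $1\leq p_0<p<q_0\leq\infty$, let $T\in S(p_0,q_0)$, and let $w\in A_1\cap \mathrm{RH}_{(q_0/p)'}$. Then there is a constant $c=c(T,\nu,n)>0$ such that $$\|T\|_{L^p(w)\to L^p(w)}\leq c\, c_p\,[w^{(q_0/p)'}]_{A_\infty}^{\frac{1}{p'}}\,[w^{(q_0/p)'}]_{A_1}^{\frac{1}{p(q_0/p)'}},$$ where $$c_p=\left[\left(\frac{p'}{q_0'}\right)'\right]^{\frac{1}{q_0'}}\left[\left(\frac{p_0'}{p'}\right)'\left(\frac{p}{p_0}\right)'\right]^{\frac{1}{p_0}}.$$ In particular, $$\|T\|_{L^p(w)\to L^p(w)}\lesssim c_p\,[w^{(q_0/p)'}]_{A_1}^{\frac{1}{q_0'}}\leq c_p\left([w]_{A_1}[w]_{\mathrm{RH}_{(q_0/p)'}}\right)^{\frac{q_0-1}{q_0-p}}.$$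
   Context: Setting: $\mathbf{R}^n$ carries a Borel measure $\mu$ with $0<\mu(B)<\infty$ for all balls $B$ and satisfying the doubling property $\mu(2B)\leq C\mu(B)$ for all balls $B$ ($2B$ is the ball with the same center and twice the radius). For the smallest such $C$, put $\nu:=\log_2 C$ (the doubling dimension). Write $|E|:=\mu(E)$, $L^p=L^p(\mu)$, $\langle f,g\rangle:=\int fg\,\mathrm{d}\mu$, and, for measurable $E$ with $0<|E|<\infty$, $\langle f\rangle_{p,E}:=\left(\frac{1}{|E|}\int_E|f|^p\,\mathrm{d}\mu\right)^{1/p}$ for $0<p<\infty$, $\langle f\rangle_{\infty,E}:=\operatorname{ess\,sup}_E|f|$. For $p\in[1,\infty]$, $p'=p/(p-1)$ (so $1'=\infty$, $\infty'=1$); this is also applied to ratios such as $(q_0/p)'$. Dyadic grids: for $\alpha\in\{0,\frac13,\frac23\}^n$, $\mathscr{D}^\alpha:=\bigcup_{k\in\mathbf{Z}}\{2^{-k}([0,1)^n+m+(-1)^k\alpha):m\in\mathbf{Z}^n\}$, and $\mathscr{D}:=\bigcup_\alpha\mathscr{D}^\alpha$. A collection $\mathscr{S}\subseteq\mathscr{D}$ is $\eta$-sparse ($0<\eta\leq1$) if for each $\alpha$ there is a pairwise disjoint collection $(E_Q)_{Q\in\mathscr{S}\cap\mathscr{D}^\alpha}$ of measurable sets with $E_Q\subseteq Q$ and $|Q|\leq\eta^{-1}|E_Q|$. Weights: a weight is a measurable $w:\mathbf{R}^n\to(0,\infty)$, identified with the measure $w(E)=\int_E w\,\mathrm{d}\mu$;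 $L^p(w)$ is the Lebesgue space for this measure. For $1\leq p<\infty$, $w\in A_p$ means $[w]_{A_p}:=\sup_{Q\in\mathscr{D}}\langle w\rangle_{1,Q}\langle w^{-1}\rangle_{p'-1,Q}<\infty$ (for $p=1$ the second factor is $(\operatorname{ess\,inf}_Q w)^{-1}$). $w\in A_\infty$ means $[w]_{A_\infty}:=\sup_B\frac{1}{w(B)}\int_B M^{\mathscr{B}}(w\chi_B)\,\mathrm{d}\mu<\infty$, the supremum over all balls $B$, where $M^{\mathscr{B}}f(x)=\sup_{B\ni x}\langle f\rangle_{1,B}$ is the uncentered maximal operator over balls. For $1<s\leq\infty$, $w\in\mathrm{RH}_s$ means $[w]_{\mathrm{RH}_s}:=\sup_{Q\in\mathscr{D}}\langle w\rangle_{s,Q}\langle w\rangle_{1,Q}^{-1}<\infty$; $\mathrm{RH}_1:=A_\infty$ with $[w]_{\mathrm{RH}_1}:=1$. Sparsely dominated operators: let $\mathcal{D}$ be a space of test functions on $\mathbf{R}^n$ dense in $L^p(w)$ for all $1\leq p<\infty$ and all $w\in A_\infty$ (e.g. $C_c^\infty(\mathbf{R}^n)$). For $1\leq p_0<q_0\leq\infty$, $T\in S(p_0,q_0)$ means that $T$ is a (sub)linear operator, initially defined on $\mathcal{D}$, for which there are constants $c>0$ and $0<\eta\leq1$ such that for each pair $f,g\in\mathcal{D}$ there is an $\eta$-sparse collection $\mathscr{S}\subseteq\mathscr{D}$ with $|\langle Tf,g\rangle|\leq c\sum_{Q\in\mathscr{S}}\langle f\rangle_{p_0,Q}\langle g\rangle_{q_0',Q}|Q|$.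 A constant depending on $T$ means it depends on the constants $c,\eta$ in this domination property. $A\lesssim B$ means $A\leq CB$ with a constant $C>0$ independent of the important parameters (here of the same type as $c(T,\nu,n)$). For $q_0=\infty$, $(q_0/p)'=1$ and $\frac{q_0-1}{q_0-p}$ is read as $1$; for $p_0=1$, $(p_0'/p')'=1$.
   Formalization: The space of test functions is also assumed to separate measurable functions: if u is measurable and ug is integrable with integral 0 for every test function g, then u = 0 a.e. This holds for C_c^∞; density alone does not suffice and the claim then fails. *)

(* Defs.v *)
From HB Require Import structures.
From mathcomp Require Import all_boot all_order all_algebra.
From mathcomp Require Import all_classical all_reals all_analysis.
From mathcomp Require Import ess_sup_inf.

Set Implicit Arguments.
Unset Strict Implicit.
Unset Printing Implicit Defensive.

Import Order.TTheory GRing.Theory Num.Theory.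
Import numFieldNormedType.Exports.

Local Open Scope classical_set_scope.
Local Open Scope ring_scope.

(* [R^n] with its Borel sigma-algebra. *)
Definition Rn (R : realType) (n : nat) :=
  g_sigma_algebraType (@open ('rV[R]_n)).

Notation conjugate := hoelder_conjugate.

(* The convention [y / +oo = 0] of the library would turn the indeterminate
   ratio [+oo / +oo] into [0] and let weights that are not locally integrable
   into the weight classes below; such a ratio counts as [+oo] here. *)
Definition eratio {R : realType} (x y : \bar R) : \bar R :=
  (if y == +oo then +oo else x / y)%E.

Section Geometry.
Context {R : realType} {n : nat}.
Local Notation Rn := (Rn R n).
Implicit Types (mu : {measure set Rn -> \bar R}).

(* Open Euclidean ball (the metric that ['rV[R]_n] carries in the library is
   the sup metric). *)
Definition eball (x : Rn) (r : R) : set Rn :=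
  [set y : Rn | Num.sqrt (\sum_(i < n) (y ord0 i - x ord0 i) ^+ 2) < r].

Definition doubling_bound mu (C : R) : Prop :=
  forall (x : Rn) (r : R), 0 < r ->
    (mu (eball x (2 * r)) <= C%:E * mu (eball x r))%E.

Definition doubling mu : Prop :=
  (forall (x : Rn) (r : R), 0 < r -> (0 < mu (eball x r) < +oo)%E) /\
  exists C : R, doubling_bound mu C.

Definition doubling_dim mu : R :=
  ln (inf [set C : R | doubling_bound mu C]) / ln 2.

(* The vector [alpha] of [{0, 1/3, 2/3}^n] is encoded by its numerators. *)
Definition dyadic_cube (a : 'I_3 ^ n) (k : int) (m : int ^ n) : set Rn :=
  [set x : Rn | forall i : 'I_n,
     let corner := (m i)%:~R + (-1) ^ k * ((a i)%:R / 3%:R) in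
     2%:R ^ (- k) * corner <= x ord0 i < 2%:R ^ (- k) * (corner + 1)].

Definition dyadic_grid (a : 'I_3 ^ n) : set (set Rn) :=
  [set Q | exists (k : int) (m : int ^ n), Q = dyadic_cube a k m].

Definition dyadic : set (set Rn) := \bigcup_(a : 'I_3 ^ n) dyadic_grid a.

Definition sparse mu (eta : R) (S : set (set Rn)) : Prop :=
  S `<=` dyadic /\
  forall a : 'I_3 ^ n, exists E : set Rn -> set Rn,
    trivIset (S `&` dyadic_grid a) E /\
    forall Q, (S `&` dyadic_grid a) Q ->
      [/\ measurable (E Q), E Q `<=` Q & (mu Q <= (eta^-1)%:E * mu (E Q))%E].

End Geometry.

Section Weights.
Context {R : realType} {n : nat}.
Local Notation Rn := (Rn R n).
Variable mu : {measure set Rn -> \bar R}.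
Implicit Types (E Q : set Rn) (f g u w : Rn -> R).

(* For [p = +oo] this is the essential supremum of [|f|] over [E]: extending
   [|f|] by [0] outside [E] does not change it when [mu E > 0]. *)
Definition avg (p : \bar R) E f : \bar R :=
  match p with
  | r%:E => ((mu E)^-1 * \int[mu]_(x in E) (`|f x| `^ r)%:E) `^ r^-1
  | +oo => ess_sup mu ((fun x => `|f x|%:E) \_ E)
  | -oo => 0
  end%E.

Definition ess_inf_on E w : \bar R :=
  ess_inf mu (patch (cst +oo%E) E (EFin \o w)).

Definition weight w : Prop :=
  measurable_fun [set: Rn] w /\ forall x, 0 < w x.

Definition wmeas w E : \bar R := (\int[mu]_(x in E) (w x)%:E)%E.

Definition maximal f (x : Rn) : \bar R :=
  ereal_sup [set a : \bar R | exists (y : Rn) (r : R),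
    [/\ 0 < r, eball y r x & a = avg 1%E (eball y r) f]].

Definition A1_const w : \bar R :=
  ereal_sup [set (avg 1%E Q w * (ess_inf_on Q w)^-1)%E | Q in dyadic].

Definition A1 w : Prop := weight w /\ (A1_const w < +oo)%E.

Definition Ainf_const w : \bar R :=
  ereal_sup [set a : \bar R | exists (y : Rn) (r : R), 0 < r /\
    a = eratio (\int[mu]_(x in eball y r) maximal (w \_ (eball y r)) x)%E
               (wmeas w (eball y r))].

Definition Ainf w : Prop := weight w /\ (Ainf_const w < +oo)%E.

Definition RH_const (s : \bar R) w : \bar R :=
  (if s == 1 then 1
   else ereal_sup [set eratio (avg s Q w) (avg 1 Q w) | Q in dyadic])%E.

Definition RH (s : \bar R) w : Prop :=
  if s == 1%E then Ainf w else weight w /\ (RH_const s w < +oo)%E.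

Definition LpN (p : R) w f : \bar R :=
  ((\int[mu]_x (`|f x| `^ p * w x)%:E) `^ p^-1)%E.

(* [D] is a space of test functions: a dense linear subspace of every [L^p(w)].
   The last field says that testing against [D] determines a measurable function
   up to null sets, as is the case for [C_c^oo]. It does not follow from density
   in the spaces [L^p(w)]: for mu the Lebesgue measure and [u x = exp |x|], the
   space of all [g] in [C_c^oo] such that [\int u g = 0] is dense in all of them,
   and every linear map with values in the multiples of [u] pairs to [0] with
   it. *)
Record test_space (D : set (Rn -> R)) : Prop := TestSpace {
  test_measurable : forall f, D f -> measurable_fun [set: Rn] f ;
  test_zero : D (cst 0) ;
  test_linear : forall (a : R) f g, D f -> D g -> D (fun x => a * f x + g x) ;
  test_Lp : forall (p : R) w f, 1 <= p -> Ainf w -> D f -> (LpN p w f < +oo)%E ;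
  test_dense : forall (p : R) w f (e : R), 1 <= p -> Ainf w ->
    measurable_fun [set: Rn] f -> (LpN p w f < +oo)%E -> 0 < e ->
    exists2 g, D g & (LpN p w (fun x => (f x - g x)%R) < e%:E)%E ;
  test_separating : forall u, measurable_fun [set: Rn] u ->
    (forall g, D g ->
       mu.-integrable [set: Rn] (fun x => (u x * g x)%:E) /\
       (\int[mu]_x (u x * g x)%:E = 0)%E) ->
    \forall x \ae mu, u x = 0 }.

(* Only the values of [T] on [D] matter. Linear operators are sublinear in this
   sense. *)
Definition sublinear_on (D : set (Rn -> R)) (T : (Rn -> R) -> (Rn -> R)) : Prop :=
  [/\ forall f, D f -> measurable_fun [set: Rn] (T f),
      forall f g, D f -> D g ->
        \forall x \ae mu, `|T (fun y => f y + g y) x| <= `|T f x| + `|T g x| &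
      forall (a : R) f, D f ->
        \forall x \ae mu, `|T (fun y => a * f y) x| = `|a| * `|T f x|].

(* [T] is in [S(p0, q0)], with the constants [c] and [eta]. *)
Definition sparse_dominated (D : set (Rn -> R)) (T : (Rn -> R) -> (Rn -> R))
    (p0 q0 : \bar R) (c eta : R) : Prop :=
  sublinear_on D T /\
  forall f g, D f -> D g -> exists2 S : set (set Rn), sparse mu eta S &
    (`| \int[mu]_x (T f x * g x)%:E | <=
       c%:E * \esum_(Q in S) (avg p0 Q f * avg (conjugate q0) Q g * mu Q))%E.

(* The norm on [L^p(w)] of the operator initially defined on the dense subspace
   [D]. *)
Definition op_norm (D : set (Rn -> R)) (p : R) w (T : (Rn -> R) -> (Rn -> R))
    : \bar R :=
  ereal_inf [set K%:E | K in [set K : R | 0 <= K /\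
    forall f, D f -> (LpN p w (T f) <= K%:E * LpN p w f)%E]].

End Weights.

Section Constants.
Context {R : realType}.
Local Open Scope ereal_scope.

Definition c_const (p0 p q0 : \bar R) : \bar R :=
  conjugate (conjugate p / conjugate q0) `^ (fine (conjugate q0))^-1 *
  (conjugate (conjugate p0 / conjugate p) * conjugate (p / p0)) `^ (fine p0)^-1.

(* [(q0 - 1) / (q0 - p)], read as [1] when [q0 = +oo]. *)
Definition final_exponent (p : R) (q0 : \bar R) : R :=
  if q0 is q%:E then ((q - 1) / (q - p))%R else 1%R.

End Constants.

(* Main.v *)
From HB Require Import structures.
Require Import Defs.
From mathcomp Require Import all_boot all_order all_algebra.
From mathcomp Require Import all_classical all_reals all_analysis.
From mathcomp Require Import measurable_realfun ess_sup_inf lra ring zify.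

(** Put [s = (q0 / p)'], [v = w ^ s], [K] for the Ainf constant and [A] for the A1
    constant of [v]. The weights are moved into the functions: with
    [F = |f| w^(1/p)] and [G = |g| w^(-1/p)] the weighted norms of [f] and [g]
    become unweighted norms, and it has to be shown that the sparse form of [f]
    and [g] is bounded by one of [F] and [G].

    The means is the reverse Hoelder inequality ([reverse_hoelder_cube]): for
    [e] of the order of [1 / K], the average of [v ^ (1 + e)] on a cube is at most
    [8 tau ^ (1 + e)], where [tau] is an average of [v] over a slightly larger
    ball. Hoelder's inequality on a cube [Q] splits off this average from the
    average of exponent [q0'] of [g] and leaves an average of [G] with an exponent
    [a] strictly between [q0'] and [p'] ([weighted_term]). By the A1 property
    [tau] is at most a multiple of [A v] on [Q], so that the power
    [tau ^ (1 / (p s))] can be absorbed into the average of [f], which turns [f]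
    into [F] and costs [A ^ (1 / (p s))]. The resulting sparse form of [F] and [G]
    is bounded by the integral of a product of two dyadic maximal functions
    ([sparse_form_le]), and Doob's inequality with its sharp constant
    ([doob_maximal]) yields a constant bounded by [c_p], except that [q0'] is replaced by [a]. This
    replacement costs [K ^ (1 / p')] ([maximal_constant]).

    The reverse Hoelder inequality is proved by the method of Doob's inequality.
    One sums the increments of the power [e] of a running maximum of averages. At
    a record the later part of the running maximum is a maximal function inside
    one cube, which the Ainf constant controls, and each increment costs a factor
    [e], so that for small [e] the whole can be absorbed
    ([reverse_hoelder_cells]). Differentiation of integrals along the cubes then
    replaces the running maximum by [v] ([le_cexp_ae]).

    Since the constants of the weight are defined partly by balls and partly by
    cubes, one also needs that every ball lies in a cube of comparable measure of
    one of the grids ([eball_cube], [eball_dyadic]).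

    The bound for the pairing of [T f] with all test functions gives the bound for
    the norm of [T f] by duality ([lq_duality], [weighted_duality]). This is not
    immediate, as [T f] is not known to lie in the weighted space: the functional
    defined by the pairing is extended by density, represented by a function of
    that space ([riesz_lq]), and this function is equal to [T f] because test
    functions separate measurable functions. The dual weight, which governs the
    density, is in Ainf ([A1_dual_Ainf]).

    The second estimate follows from the first, as an A1 constant dominates the
    Ainf constant up to a factor that depends on the doubling dimension
    ([Ainf_le_A1]); the third is the comparison of the A1 constants of [w ^ s] and
    [w] ([A1_const_powR]). *)

Set Implicit Arguments.
Unset Strict Implicit.
Unset Printing Implicit Defensive.

Import Order.TTheory GRing.Theory Num.Theory.
Import numFieldNormedType.Exports.

Local Open Scope classical_set_scope.
Local Open Scope ring_scope.

(** * Inequalities for real powers and integrals *)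

Section RealPowers.
Context {R : realType}.
Implicit Types a b e p : R.

Lemma ler_powR2 e a b : 0 <= e -> 0 <= a -> a <= b -> a `^ e <= b `^ e.
Proof.
move=> e0 a0 ab; apply: ge0_ler_powR => //; rewrite nnegrE//.
exact: le_trans ab.
Qed.

Lemma powR_split p a : 0 <= a -> 1 < p -> a `^ p = a * a `^ (p - 1).
Proof. by move=> a0 p1; rewrite mulr_powRB1// (lt_trans ltr01). Qed.

(** The contribution of one generation to Doob's inequality: a running maximum
    jumps from [a] to [b]. This is Young's inequality for [a `^ (p - 1) * b]. *)
Lemma doob_increment p a b : 1 < p -> 0 <= a <= b ->
  b `^ p - a `^ p <= p / (p - 1) * (b `^ (p - 1) - a `^ (p - 1)) * b.
Proof.
move=> p1 /andP[a0 ab].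
have b0 : 0 <= b := le_trans a0 ab.
have p0 : 0 < p by rewrite (lt_trans ltr01).
have pB : 0 < p - 1 by rewrite subr_gt0.
set q := p / (p - 1).
have q0 : 0 < q by rewrite divr_gt0.
have := @conjugate_powR R (a `^ (p - 1)) b q p (powR_ge0 _ _) b0 q0 p0.
rewrite -powRrM (_ : (p - 1) * q = p); last by rewrite /q mulrC divfK ?gt_eqF.
have -> : q^-1 + p^-1 = 1.
  by rewrite /q; field; rewrite !gt_eqF.
move=> /(_ erefl) young.
rewrite -mulrA mulrBl (mulrC _ b) -powR_split//.
have young' : a `^ (p - 1) * b * q <= a `^ p + (q - 1) * b `^ p.
  have -> : a `^ p + (q - 1) * b `^ p = (a `^ p / q + b `^ p / p) * q.
    by rewrite /q; field; rewrite !gt_eqF.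
  by rewrite ler_wpM2r// ltW.
rewrite mulrBr lerBrDr; lra.
Qed.

(** The analogue of [doob_increment] for exponents near [1]. The factor [e] on
    the right is what makes absorption possible; it comes from
    [x `^ e - 1 <= e * ln x * x `^ e], where [x = b / a] lies between [1] and
    [D]. *)
Lemma reverse_hoelder_increment e D a b : 0 < e <= 1 -> 0 <= a -> a <= b ->
  b <= D * a -> 1 <= D ->
  (b `^ e - a `^ e) * b <= e * D ^+ 2 * (b `^ (1 + e) - a `^ (1 + e)).
Proof.
move=> /andP[e0 e1] a0 ab bDa D1.
have [a00|aN0] := eqVneq a 0.
  have -> : b = 0 by apply/eqP; rewrite eq_le (le_trans a0 ab) andbT; rewrite a00 mulr0 in bDa.
  by rewrite a00 !powR0 ?subrr ?mul0r ?mulr0// gt_eqF// ltr_wpDl.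
have agt0 : 0 < a by rewrite lt_neqAle eq_sym aN0.
have bgt0 : 0 < b := lt_le_trans agt0 ab.
set x := b / a.
have x1 : 1 <= x by rewrite /x ler_pdivlMr// mul1r.
have x0 : 0 < x by rewrite (lt_le_trans ltr01).
have xD : x <= D by rewrite /x ler_pdivrMr.
have bE : b = x * a by rewrite /x divfK ?gt_eqF.
have pD y : 0 <= y -> y `^ (1 + e) = y * y `^ e.
  by move=> y0; rewrite powRD ?powRr1// gt_eqF// ltr_wpDl.
have xa0 : 0 <= x * a by rewrite mulr_ge0 ?ltW.
rewrite bE (pD _ xa0) (pD _ a0) (@powRM _ x a e (ltW x0) a0).
have xe1 : 1 <= x `^ e by rewrite -(powRr0 x) ler_powR// ltW.
have lnx : x `^ e - 1 <= e * (x - 1) * x `^ e.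
  have /(_ (- (e * ln x))) := @expR_ge1Dx R; rewrite expRN => h.
  have -> : x `^ e = expR (e * ln x) by rewrite /powR gt_eqF.
  have hln : ln x <= x - 1.
    have := @le_ln1Dx R (x - 1); rewrite (_ : 1 + (x - 1) = x); last by ring.
    apply.
    by rewrite (lt_le_trans _ (_ : 0 <= _)) ?ltrN10 ?subr_ge0.
  have E0 := expR_gt0 (e * ln x).
  have := ler_wpM2r (ltW E0) h; rewrite mulVf ?gt_eqF// => h2.
  apply: (@le_trans _ _ (e * ln x * expR (e * ln x))); first lra.
  by rewrite ler_wpM2r ?(ltW E0)// ler_wpM2l ?(ltW e0).
have xeD : x `^ e <= D.
  rewrite (le_trans _ xD)// -[leRHS]powRr1 ?(ltW x0)//.
  exact: ler_powR.
set X := x `^ e in xe1 lnx xeD *; set E := a `^ e.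
have E0 : 0 <= E by exact: powR_ge0.
have -> : (X * E - E) * (x * a) = (a * E) * ((X - 1) * x) by ring.
have -> : e * D ^+ 2 * (x * a * (X * E) - a * E) =
  (a * E) * (e * D ^+ 2 * (x * X - 1)) by ring.
rewrite ler_wpM2l ?mulr_ge0//.
apply: (@le_trans _ _ (e * (x - 1) * X * x)).
  by rewrite ler_wpM2r ?(ltW x0).
have -> : e * (x - 1) * X * x = e * (x - 1) * (X * x) by ring.
apply: (@le_trans _ _ (e * (x - 1) * (D ^+ 2))).
  rewrite ler_wpM2l ?mulr_ge0 ?subr_ge0 ?(ltW e0)// expr2.
  by rewrite ler_pM ?powR_ge0// ltW.
have -> : e * (x - 1) * D ^+ 2 = e * D ^+ 2 * (x - 1) by ring.
have D0 : 0 <= D := le_trans ler01 D1.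
rewrite ler_wpM2l ?mulr_ge0 ?(ltW e0)//.
by rewrite lerD2r ler_peMr ?(ltW x0).
Qed.

End RealPowers.

Section HoelderOn.
Context d {T : measurableType d} {R : realType}.
Variable mu : {measure set T -> \bar R}.
Local Open Scope ereal_scope.

Lemma measurable_powRr (f : T -> R) (p : R) (D : set T) :
  measurable_fun D f -> measurable_fun D (fun x => (f x `^ p)%R).
Proof. exact: (@measurableT_comp _ _ _ _ _ _ (@powR R ^~ p)). Qed.

Lemma hoelder_ge0 (D : set T) (f g : T -> R) (p q : R) : measurable D ->
  measurable_fun [set: T] f -> measurable_fun [set: T] g ->
  (forall x, 0 <= f x)%R -> (forall x, 0 <= g x)%R ->
  (0 < p)%R -> (0 < q)%R -> (p^-1 + q^-1 = 1)%R ->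
  \int[mu]_(x in D) (f x * g x)%:E <=
  (\int[mu]_(x in D) (f x `^ p)%:E) `^ p^-1 *
  (\int[mu]_(x in D) (g x `^ q)%:E) `^ q^-1.
Proof.
move=> mD mf mg f0 g0 p0 q0 pq.
have mr (h : T -> R) : measurable_fun setT h -> measurable_fun setT (h \_ D).
  move=> mh; apply/(measurable_restrictT _ _).1 => //.
  exact: measurable_funTS.
have nr (h : T -> R) : (forall x, 0 <= h x)%R -> forall x, (0 <= (h \_ D) x)%R.
  by move=> h0 x; rewrite patchE; case: ifPn.
have := @hoelder _ T R mu (f \_ D) (g \_ D) p q (mr _ mf) (mr _ mg) p0 q0 pq.
rewrite Lnorm1 unlock.
have E1 (h : T -> R) r : (0 < r)%R -> (forall x, 0 <= h x)%R ->
  \int[mu]_x (`|(EFin \o (h \_ D)) x| `^ r) = \int[mu]_(x in D) (h x `^ r)%:E.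
  move=> r0 h0; rewrite [RHS]integral_mkcond; apply: eq_integral => x _ /=.
  rewrite !patchE; case: ifPn => xD; first by rewrite ger0_norm.
  by rewrite normr0 powR0// gt_eqF.
rewrite !E1//; apply: le_trans.
rewrite integral_mkcond le_eqVlt; apply/orP; left; apply/eqP.
apply: eq_integral => x _ /=.
rewrite !patchE; case: ifPn => xD; last by rewrite mul0r normr0.
by rewrite ger0_norm// mulr_ge0.
Qed.

Lemma hoelder_one (D : set T) (f : T -> R) (p : R) : measurable D ->
  measurable_fun [set: T] f -> (forall x, 0 <= f x)%R -> (1 < p)%R ->
  (\int[mu]_(x in D) (f x)%:E) `^ p <=
  \int[mu]_(x in D) (f x `^ p)%:E * mu D `^ (p - 1).
Proof.
move=> mD mf f0 p1.
have p0 : (0 < p)%R := lt_trans ltr01 p1.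
have pB : (0 < p - 1)%R by rewrite subr_gt0.
pose q := (p / (p - 1))%R.
have q0 : (0 < q)%R by rewrite divr_gt0.
have pq : (p^-1 + q^-1 = 1)%R by rewrite /q; field; rewrite !gt_eqF.
have := @hoelder_ge0 D f (cst 1%R) p q mD mf (measurable_cst _) f0
  (fun=> ler01) p0 q0 pq.
under eq_integral do rewrite /= mulr1.
have -> : \int[mu]_(x in D) (cst 1%R x `^ q)%:E = mu D.
  by under eq_integral do rewrite /= powR1; rewrite integral_cst// mul1e.
move=> H.
have i0 : 0 <= \int[mu]_(x in D) (f x)%:E by apply: integral_ge0 => x _; rewrite lee_fin.
have j0 : 0 <= \int[mu]_(x in D) (f x `^ p)%:E.
  by apply: integral_ge0 => x _; rewrite lee_fin powR_ge0.
have := gt0_ler_poweR (ltW p0) _ _ H; rewrite !in_itv/= !leey !andbT => /(_ i0).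
rewrite mule_ge0 ?poweR_ge0// => /(_ isT)/le_trans; apply.
rewrite poweRM ?poweR_ge0// -!poweRrM mulVf ?gt_eqF// poweRe1//.
by rewrite (_ : q^-1 * p = p - 1)%R// /q; field; rewrite !gt_eqF.
Qed.

End HoelderOn.

(** * Filtrations by countably many cells *)

(** A filtration is described by [idx k x], the index of the cell of generation
    [k] that contains [x]. As there are countably many indices, functions and
    sets that are constant on the cells of a generation are measurable. *)
Section Cells.
Context d {T : measurableType d} {R : realType} {I : countType}.
Variables (mu : {measure set T -> \bar R}) (idx : nat -> T -> I).
Implicit Types (k : nat) (x y : T).

Definition cell k x : set T := [set y | idx k y = idx k x].

Definition cellwise (V : Type) k (g : T -> V) :=
  forall x y, idx k x = idx k y -> g x = g y.

Record filtration : Prop := Filtration {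
  measurable_cell : forall k x, measurable (cell k x) ;
  idx_refine : forall k x y, idx k.+1 x = idx k.+1 y -> idx k x = idx k y ;
  mu_cell : forall k x, (0 < mu (cell k x) < +oo)%E }.

Hypothesis filt : filtration.
Let mcell := measurable_cell filt.

Lemma cell_eq k x y : idx k x = idx k y -> cell k x = cell k y.
Proof. by move=> xy; rewrite /cell xy. Qed.

Lemma idx_le j k x y : (j <= k)%N -> idx k x = idx k y -> idx j x = idx j y.
Proof.
move=> /subnK <-; elim: (k - j)%N => // m IH.
by rewrite addSn => /(idx_refine filt)/IH.
Qed.

Lemma cellwise_le (V : Type) j k (g : T -> V) : (j <= k)%N ->
  cellwise j g -> cellwise k g.
Proof. by move=> jk gj x y /(idx_le jk)/gj. Qed.

Lemma measurable_cellwise_set k (D : set T) : cellwise k D -> measurable D.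
Proof.
move=> Dk.
pose P := [set n : nat | exists2 x, D x & pickle (idx k x) = n].
have -> : D = \bigcup_(n in P) [set x | pickle (idx k x) = n].
  apply/seteqP; split => [x Dx|x [n [y Dy yn]] /= xn].
    by exists (pickle (idx k x)) => //; exists x.
  have xy : idx k x = idx k y by apply: (pcan_inj pickleK); rewrite xn.
  by rewrite (Dk _ _ xy).
apply: bigcup_measurable => n [x Dx xn].
have -> : [set y | pickle (idx k y) = n] = cell k x; last exact: mcell.
apply/seteqP; split => y /=; rewrite -xn; last by rewrite /cell /= => ->.
by move/(pcan_inj pickleK).
Qed.

Lemma measurable_cellwise dV (V : measurableType dV) k (g : T -> V) :
  cellwise k g -> measurable_fun [set: T] g.
Proof.
move=> gk _ B mB; rewrite setTI; apply: (@measurable_cellwise_set k).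
by move=> x y /gk xy; rewrite /preimage /= xy.
Qed.

(** Factors constant on cells can be pulled out of the integrals over cells. The comparison of
    [h] and [h'] is required only on the cells where [c] does not vanish, which
    in applications are the cells where a running maximum increases. *)
Lemma le_integral_cellwise k (D : set T) (c : T -> R) (h h' : T -> \bar R) :
  cellwise k D -> cellwise k c -> (forall x, 0 <= c x) ->
  measurable_fun [set: T] h -> measurable_fun [set: T] h' ->
  (forall x, 0 <= h x)%E -> (forall x, 0 <= h' x)%E ->
  (forall x, D x -> (0 < c x)%R ->
    \int[mu]_(y in cell k x) h y <= \int[mu]_(y in cell k x) h' y)%E ->
  (\int[mu]_(x in D) ((c x)%:E * h x) <= \int[mu]_(x in D) ((c x)%:E * h' x))%E.
Proof.
move=> Dk ck c0 mh mh' h0 h'0 hh'.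
pose F n := [set x | D x /\ pickle (idx k x) = n].
have DF : D = \bigcup_n F n.
  by apply/seteqP; split => [x Dx|x [n _ []]//]; exists (pickle (idx k x)).
have mF n : measurable (F n).
  apply: (@measurable_cellwise_set k) => x y xy; rewrite /F /=.
  by rewrite (Dk _ _ xy) xy.
have tF : trivIset setT F.
  apply/trivIsetP => i j _ _ /eqP ij; apply/seteqP; split => // x [[_ xi] [_ xj]].
  by apply: ij; rewrite -xi.
have mc : measurable_fun setT (EFin \o c).
  by apply/measurable_EFinP; apply: (@measurable_cellwise _ _ k).
have mch (g : T -> \bar R) : measurable_fun setT g ->
    measurable_fun setT (fun x => (c x)%:E * g x)%E.
  by move=> mg; exact: emeasurable_funM.
rewrite DF !ge0_integral_bigcup//; last 4 first.
- by apply: measurable_funTS; exact: mch.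
- by move=> x _; rewrite mule_ge0// lee_fin.
- by apply: measurable_funTS; exact: mch.
- by move=> x _; rewrite mule_ge0// lee_fin.
apply: lee_nneseries => [n _ _|n _].
  by apply: integral_ge0 => x _; rewrite mule_ge0// lee_fin.
have [->|/set0P[x [Dx xn]]] := eqVneq (F n) set0; first by rewrite !integral_set0.
have FE : F n = cell k x.
  apply/seteqP; split => [y [_]|y yx]; first by rewrite -xn => /(pcan_inj pickleK).
  by rewrite /F /= (Dk _ _ yx) [in pickle _]yx.
have cE (g : T -> \bar R) : measurable_fun setT g -> (forall y, 0 <= g y)%E ->
    (\int[mu]_(y in F n) ((c y)%:E * g y) = (c x)%:E * \int[mu]_(y in F n) g y)%E.
  move=> mg g0; rewrite -ge0_integralZl//; first last.
  - by rewrite lee_fin.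
  - exact: measurable_funTS.
  by apply: eq_integral => y; rewrite FE inE => /ck ->.
rewrite !cE//; have [cx|cx] := ltP 0 (c x).
  by rewrite FE lee_wpmul2l ?lee_fin ?c0//; exact: hh'.
have -> : c x = 0 by apply/eqP; rewrite eq_le cx c0.
by rewrite !mul0e.
Qed.

(** The maximum is over the generations below [k]; it is [rmax t k.+1] that is
    determined by the cells of generation [k]. *)
Fixpoint rmax (t : nat -> T -> R) k x : R :=
  if k is j.+1 then Num.max (rmax t j x) (t j x) else 0.

Lemma rmax_ge0 t k x : 0 <= rmax t k x.
Proof. by elim: k => //= k IH; rewrite le_max IH. Qed.

Lemma rmax_leS t k x : rmax t k x <= rmax t k.+1 x.
Proof. by rewrite /= le_max lexx. Qed.

Lemma rmax_le t j k x : (j <= k)%N -> rmax t j x <= rmax t k x.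
Proof.
move=> /subnK <-; elim: (k - j)%N => // m IH.
exact: le_trans IH (rmax_leS _ _ _).
Qed.

Lemma le_rmax t j k x : (j < k)%N -> t j x <= rmax t k x.
Proof. by move=> jk; apply: le_trans (rmax_le _ _ jk); rewrite /= le_max lexx orbT. Qed.

Lemma rmax_lub t k x (b : R) : 0 <= b -> (forall j, (j < k)%N -> t j x <= b) ->
  rmax t k x <= b.
Proof.
move=> b0; elim: k => //= k IH tb; rewrite ge_max tb// andbT.
by apply: IH => j jk; apply: tb; rewrite ltnS ltnW.
Qed.

Lemma cellwise_rmax t k : (forall j, cellwise j (t j)) -> cellwise k (rmax t k.+1).
Proof.
move=> tj x y xy.
have : forall m, (m <= k.+1)%N -> rmax t m x = rmax t m y.
  elim=> //= m IH mk; rewrite IH 1?ltnW//; congr Num.max.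
  exact: (cellwise_le _ (tj m)) xy.
exact.
Qed.

Lemma measurable_rmax t k : (forall j, cellwise j (t j)) ->
  measurable_fun [set: T] (rmax t k).
Proof.
case: k => [|k] tj; first exact: measurable_cst.
exact/measurable_cellwise/cellwise_rmax.
Qed.

Definition rinc (t : nat -> T -> R) (e : R) k x : R :=
  rmax t k.+1 x `^ e - rmax t k x `^ e.

Lemma rinc_ge0 t e k x : 0 <= e -> 0 <= rinc t e k x.
Proof. by move=> e0; rewrite subr_ge0 ler_powR2 ?rmax_ge0 ?rmax_leS. Qed.

Lemma sum_rinc t e k x : 0 < e -> \sum_(j < k) rinc t e j x = rmax t k x `^ e.
Proof.
move=> e0; rewrite -(big_mkord xpredT (fun j => rinc t e j x)) telescope_sumr//.
by rewrite /= powR0 ?subr0// gt_eqF.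
Qed.

Lemma cellwise_rinc t e k : (forall j, cellwise j (t j)) -> cellwise k (rinc t e k).
Proof.
move=> tj x y xy; rewrite /rinc (cellwise_rmax tj xy).
congr (_ - _ `^ _); case: k xy => // k xy.
exact: (cellwise_le (leqnSn k) (cellwise_rmax tj)) xy.
Qed.

(** The conditional expectation of [f] given the cells of generation [k]. *)
Definition cexp (f : T -> R) k x : R :=
  fine (\int[mu]_(y in cell k x) (f y)%:E) / fine (mu (cell k x)).

Lemma cellwise_cexp f k : cellwise k (cexp f k).
Proof. by move=> x y /cell_eq xy; rewrite /cexp xy. Qed.

Lemma fin_mu_cell k x : mu (cell k x) \is a fin_num.
Proof. by have /andP[m0 moo] := mu_cell filt k x; rewrite ge0_fin_numE. Qed.

Lemma fine_mu_cell_gt0 k x : 0 < fine (mu (cell k x)).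
Proof. by apply: fine_gt0; exact: mu_cell. Qed.

Lemma cexp_ge0 f k x : (forall x, 0 <= f x) -> 0 <= cexp f k x.
Proof.
move=> f0; rewrite divr_ge0 ?fine_ge0//.
by apply: integral_ge0 => y _; rewrite lee_fin.
Qed.

Definition cell_integrable (f : T -> R) :=
  forall k x, (\int[mu]_(y in cell k x) (f y)%:E < +oo)%E.

Lemma integral_cexp f k x : (forall x, 0 <= f x) -> cell_integrable f ->
  (\int[mu]_(y in cell k x) (cexp f k y)%:E = \int[mu]_(y in cell k x) (f y)%:E)%E.
Proof.
move=> f0 fi; have i0 : (0 <= \int[mu]_(y in cell k x) (f y)%:E)%E.
  by apply: integral_ge0 => y _; rewrite lee_fin.
transitivity (\int[mu]_(y in cell k x) (cst (cexp f k x)%:E) y)%E.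
  by apply: eq_integral => y; rewrite inE => /cellwise_cexp ->.
rewrite integral_cst// -[mu _]fineK ?fin_mu_cell// -EFinM divfK ?fineK//.
  by rewrite ge0_fin_numE.
by rewrite gt_eqF// fine_mu_cell_gt0.
Qed.

End Cells.

(** * Doob's maximal inequality *)

Section Doob.
Context d {T : measurableType d} {R : realType} {I : countType}.
Variables (mu : {measure set T -> \bar R}) (idx : nat -> T -> I).
Hypothesis filt : filtration mu idx.
Implicit Types (f : T -> R) (p : R) (k N : nat).

Local Notation cexp := (cexp mu idx).
Local Notation cell := (cell idx).

Lemma cell_integrable_powR f p : measurable_fun [set: T] f ->
  (forall x, 0 <= f x) -> 1 < p ->
  (\int[mu]_x (f x `^ p)%:E < +oo)%E -> cell_integrable mu idx f.
Proof.
move=> mf f0 p1 fp k x.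
have mc := measurable_cell filt k x.
have p0 : 0 < p := lt_trans ltr01 p1.
apply: (@lty_poweRy _ _ p); first by rewrite gt_eqF.
apply: le_lt_trans (hoelder_one mu mc mf f0 p1) _.
have fpc : (\int[mu]_(x in cell k x) (f x `^ p)%:E < +oo)%E.
  apply: le_lt_trans fp; apply: ge0_subset_integral => //.
    by apply/measurable_EFinP; exact: measurable_powRr.
  by move=> y _; rewrite lee_fin powR_ge0.
rewrite -ge0_fin_numE; last by rewrite mule_ge0 ?poweR_ge0// integral_ge0// => y _; rewrite lee_fin powR_ge0.
apply: fin_numM.
  by rewrite ge0_fin_numE// integral_ge0// => y _; rewrite lee_fin powR_ge0.
exact/fin_num_poweR/(fin_mu_cell filt).
Qed.

Lemma integral_cexp_powR f p k : measurable_fun [set: T] f ->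
  (forall x, 0 <= f x) -> 1 < p -> cell_integrable mu idx f ->
  (\int[mu]_x (cexp f k x `^ p)%:E <= \int[mu]_x (f x `^ p)%:E)%E.
Proof.
move=> mf f0 p1 fi.
have mp (g : T -> R) : measurable_fun setT g ->
    measurable_fun setT (fun x => (g x `^ p)%:E).
  by move=> mg; apply/measurable_EFinP; exact: measurable_powRr.
have me : measurable_fun setT (cexp f k).
  exact: (measurable_cellwise filt (@cellwise_cexp _ _ _ _ mu idx f k)).
have h : (\int[mu]_x ((cst 1%R x)%:E * (cexp f k x `^ p)%:E) <=
    \int[mu]_x ((cst 1%R x)%:E * (f x `^ p)%:E))%E.
  apply: (@le_integral_cellwise _ _ _ _ _ _ filt k) => //=.
  - exact: mp.
  - exact: mp.
  - by move=> x; rewrite lee_fin powR_ge0.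
  - by move=> x; rewrite lee_fin powR_ge0.
  move=> x _ _; have mc := measurable_cell filt k x.
  have -> : (\int[mu]_(y in cell k x) (cexp f k y `^ p)%:E =
      (cexp f k x `^ p)%:E * mu (cell k x))%E.
    rewrite -(integral_cst mu mc); apply: eq_integral => y; rewrite inE => yx.
    by rewrite (@cellwise_cexp _ _ _ _ mu idx f k y x yx).
  have i0 : (0 <= \int[mu]_(y in cell k x) (f y)%:E)%E.
    by apply: integral_ge0 => y _; rewrite lee_fin.
  have := hoelder_one mu mc mf f0 p1.
  have mfin := fin_mu_cell filt k x.
  have mgt0 := fine_mu_cell_gt0 filt k x.
  rewrite -(fineK mfin); set m := fine (mu _) in mgt0 *.
  rewrite /cexp -/m -[X in (X `^ p)%E]fineK ?ge0_fin_numE ?fi//.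
  set a := fine _; rewrite -!EFinM.
  have a0 : 0 <= a by exact: fine_ge0.
  have mp0 : m `^ (p - 1) != 0 by rewrite gt_eqF// powR_gt0.
  have -> : (a / m) `^ p * m = (m `^ (p - 1))^-1 * a `^ p.
    rewrite powRM ?invr_ge0 ?(ltW mgt0)// -(powR_inv1 (ltW mgt0)) -powRrM mulN1r.
    rewrite powRN (powR_split (ltW mgt0) p1).
    by field; rewrite mp0 gt_eqF.
  by rewrite !poweR_EFin muleC EFinM lee_pdivrMl ?powR_gt0.
by move: h; under eq_integral do rewrite mul1e; under [leRHS]eq_integral do rewrite mul1e.
Qed.

(** A finite quantity may be absorbed: this is the last step of Doob's argument,
    where the same integral occurs on both sides. *)
Lemma absorb_powR (X Y C p : R) : 0 <= X -> 0 <= Y -> 0 <= C -> 1 < p ->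
  X <= C * (Y `^ p^-1 * X `^ (p / (p - 1))^-1) -> X <= C `^ p * Y.
Proof.
move=> X0 Y0 C0 p1 H.
have p0 : 0 < p := lt_trans ltr01 p1.
have [->|XN0] := eqVneq X 0; first by rewrite mulr_ge0// powR_ge0.
have Xgt0 : 0 < X by rewrite lt_neqAle eq_sym XN0.
have XE : X = X `^ p^-1 * X `^ (p / (p - 1))^-1.
  rewrite -powRD ?XN0 ?implybT// (_ : p^-1 + _ = 1) ?powRr1//.
  by field; rewrite !gt_eqF ?subr_gt0.
have : X `^ p^-1 <= C * Y `^ p^-1.
  by rewrite {1}XE mulrA ler_pM2r ?powR_gt0 in H.
move=> /(ler_powR2 (ltW p0) (powR_ge0 _ _)).
by rewrite powRM ?powR_ge0// -!powRrM mulVf ?gt_eqF// !powRr1.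
Qed.

Lemma fin_integral_rmax f p N : measurable_fun [set: T] f ->
  (forall x, 0 <= f x) -> 1 < p -> (\int[mu]_x (f x `^ p)%:E < +oo)%E ->
  (\int[mu]_x (rmax (cexp f) N x `^ p)%:E < +oo)%E.
Proof.
move=> mf f0 p1 fp.
have fi := cell_integrable_powR mf f0 p1 fp.
have p0 : 0 < p := lt_trans ltr01 p1.
have me k : measurable_fun setT (fun x => (cexp f k x `^ p)%:E).
  apply/measurable_EFinP/measurable_powRr.
  exact: (measurable_cellwise filt (@cellwise_cexp _ _ _ _ mu idx f k)).
have mr k : measurable_fun setT (fun x => (rmax (cexp f) k x `^ p)%:E).
  apply/measurable_EFinP/measurable_powRr/(measurable_rmax filt) => j.
  exact: cellwise_cexp.
elim: N => [|N IH].
  under eq_integral do rewrite /= powR0 ?gt_eqF//.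
  by rewrite integral0.
apply: le_lt_trans (_ : _ <= \int[mu]_x ((rmax (cexp f) N x `^ p)%:E + (cexp f N x `^ p)%:E))%E _.
  apply: ge0_le_integral => //.
  - by move=> x _; rewrite lee_fin powR_ge0.
  - exact: emeasurable_funD.
  move=> x _; rewrite -EFinD lee_fin /=.
  by have [_|_] := leP (rmax (cexp f) N x) (cexp f N x);
    rewrite (lerDl, lerDr) powR_ge0.
rewrite ge0_integralD//; last 2 first.
- by move=> x _; rewrite lee_fin powR_ge0.
- by move=> x _; rewrite lee_fin powR_ge0.
apply: (lte_add_pinfty IH).
exact: le_lt_trans (integral_cexp_powR N mf f0 p1 fi) fp.
Qed.

(** Doob's maximal inequality with its sharp constant. The increments of the
    [p]-th power of the running maximum are controlled by those of its
    [(p - 1)]-st power times the current average; as the latter increments are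
    constant on cells, the average may be replaced by [f] under the integral. *)
Theorem doob_maximal f p N : measurable_fun [set: T] f ->
  (forall x, 0 <= f x) -> 1 < p ->
  (\int[mu]_x (rmax (cexp f) N x `^ p)%:E <=
   ((p / (p - 1)) `^ p)%:E * \int[mu]_x (f x `^ p)%:E)%E.
Proof.
move=> mf f0 p1.
have p0 : 0 < p := lt_trans ltr01 p1.
have pB : 0 < p - 1 by rewrite subr_gt0.
set C := p / (p - 1).
have C0 : 0 < C by rewrite divr_gt0.
have Y0 : (0 <= \int[mu]_x (f x `^ p)%:E)%E.
  by apply: integral_ge0 => x _; rewrite lee_fin powR_ge0.
have [fp|fp] := ltP (\int[mu]_x (f x `^ p)%:E)%E +oo%E; last first.
  move: fp; rewrite leye_eq => /eqP ->.
  by rewrite gt0_muley ?leey// lte_fin powR_gt0.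
have fi := cell_integrable_powR mf f0 p1 fp.
have Xoo := fin_integral_rmax N mf f0 p1 fp.
set M := rmax (cexp f) N.
have X0 : (0 <= \int[mu]_x (M x `^ p)%:E)%E.
  by apply: integral_ge0 => x _; rewrite lee_fin powR_ge0.
have cw k : cellwise idx k (cexp f k) by exact: cellwise_cexp.
have mM : measurable_fun setT M by exact: (measurable_rmax filt).
have minc e k : measurable_fun setT (fun x => (rinc (cexp f) e k x)%:E).
  apply/measurable_EFinP; apply: (measurable_cellwise filt (k := k)).
  exact: (cellwise_rinc filt).
have mce k : measurable_fun setT (fun x => (cexp f k x)%:E).
  apply/measurable_EFinP; apply: (measurable_cellwise filt (k := k)).
  exact: cw.
have mfE : measurable_fun setT (EFin \o f) by exact/measurable_EFinP.
have inc0 k x : 0 <= rinc (cexp f) (p - 1) k x by rewrite rinc_ge0// ltW.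
have key : (\int[mu]_x (M x `^ p)%:E <=
    C%:E * \int[mu]_x (f x * M x `^ (p - 1))%:E)%E.
  apply: (@le_trans _ _ (C%:E * \sum_(j < N)
      \int[mu]_x ((rinc (cexp f) (p - 1) j x)%:E * (cexp f j x)%:E))%E).
    rewrite -ge0_integral_sum//; last 2 first.
    - by move=> j; exact: emeasurable_funM.
    - by move=> j x _; rewrite -EFinM lee_fin mulr_ge0// cexp_ge0.
    rewrite -ge0_integralZl//; last 3 first.
    - by apply: emeasurable_sum => j; exact: emeasurable_funM.
    - by move=> x _; rewrite sume_ge0// => j _; rewrite -EFinM lee_fin mulr_ge0// cexp_ge0.
    - by rewrite lee_fin ltW.
    apply: ge0_le_integral => //.
    - by move=> x _; rewrite lee_fin powR_ge0.
    - by apply/measurable_EFinP; exact: measurable_powRr.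
    - apply: measurable_funeM.
      by apply: emeasurable_sum => j; exact: emeasurable_funM.
    move=> x _; under eq_bigr do rewrite -EFinM.
    rewrite sumEFin -EFinM lee_fin -(sum_rinc (cexp f) N x p0) mulr_sumr.
    apply: ler_sum => j _. have [tj|tj] := leP (cexp f j x) (rmax (cexp f) j x).
      rewrite {1}/rinc /= max_l// subrr.
      apply: mulr_ge0 (ltW C0) (mulr_ge0 (inc0 _ _) _).
      exact: cexp_ge0.
    have rj : rmax (cexp f) j.+1 x = cexp f j x by rewrite /= max_r// ltW.
    have := @doob_increment R p (rmax (cexp f) j x) (cexp f j x) p1.
    rewrite rmax_ge0 (ltW tj) => /(_ isT).
    by rewrite /rinc rj -/C -mulrA.
  rewrite lee_wpmul2l ?lee_fin ?(ltW C0)//.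
  apply: (@le_trans _ _ (\sum_(j < N)
      \int[mu]_x ((rinc (cexp f) (p - 1) j x)%:E * (EFin \o f) x))%E).
    apply: lee_sum => j _; apply: (@le_integral_cellwise _ _ _ _ _ _ filt j) => //.
    - exact: (cellwise_rinc filt).
    - by move=> x; rewrite lee_fin cexp_ge0.
    by move=> x _ _; rewrite (integral_cexp filt).
  rewrite -ge0_integral_sum//; last 2 first.
  - by move=> j; exact: emeasurable_funM.
  - by move=> j x _; rewrite -EFinM lee_fin mulr_ge0.
  rewrite le_eqVlt; apply/orP; left; apply/eqP.
  apply: eq_integral => x _; rewrite /=; under eq_bigr do rewrite -EFinM.
  by rewrite sumEFin -mulr_suml sum_rinc// mulrC.
pose q := p / (p - 1).
have q0 : 0 < q by rewrite divr_gt0.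
have pq : p^-1 + q^-1 = 1 by rewrite /q; field; rewrite !gt_eqF.
have mMp : measurable_fun setT (fun x => M x `^ (p - 1)) by exact: measurable_powRr.
have := hoelder_ge0 mu measurableT mf mMp f0 (fun=> powR_ge0 _ _) p0 q0 pq.
under [X in (_ <= _ * X `^ _)%E -> _]eq_integral do
  rewrite -powRrM (_ : (p - 1) * q = p) 1?/q 1?mulrC ?divfK ?gt_eqF//.
move=> /(lee_wpmul2l (_ : 0 <= C%:E)%E)/(le_trans key).
rewrite lee_fin (ltW C0) => /(_ isT).
rewrite -[X in (X <= _ -> _)%E]fineK ?ge0_fin_numE//.
move: X0 Y0 Xoo fp; rewrite -/M.
set X := (\int[mu]_x (M x `^ p)%:E)%E; set Y := (\int[mu]_x (f x `^ p)%:E)%E.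
move=> X0 Y0 Xoo Yoo.
case: X X0 Xoo => [X||]//; case: Y Y0 Yoo => [Y||]//.
rewrite !lee_fin => Y0 _ X0 _; rewrite /= => H.
exact: (absorb_powR X0 Y0 (ltW C0) p1 H).
Qed.

End Doob.

(** * Differentiation along the cells *)

Section Differentiation.
Context d {T : measurableType d} {R : realType} {I : countType}.
Variables (mu : {measure set T -> \bar R}) (idx : nat -> T -> I).
Hypothesis filt : filtration mu idx.
Local Notation cexp := (cexp mu idx).
Local Notation cell := (cell idx).

Definition generating : Prop := forall A : set T, measurable A ->
  <<s [set B | exists k x, B = cell k x] >> A.

(** Approximability of [A], inside a fixed cell, by unions of cells of one
    generation. Such sets form a sigma-algebra, whence
    [cell_approx_measurable]. *)
Definition cell_approx x0 (A : set T) : Prop :=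
  forall e : R, 0 < e -> exists k (B : set T), cellwise idx k B /\
    (mu (cell 0 x0 `&` ((A `\` B) `|` (B `\` A))) <= e%:E)%E.

Let Q0fin x0 (A : set T) : measurable A -> (mu (cell 0 x0 `&` A) < +oo)%E.
Proof.
move=> mA; have /andP[_] := mu_cell filt 0 x0; apply: le_lt_trans.
apply: measureIl => //; exact: (measurable_cell filt).
Qed.

Let mcw k (B : set T) : cellwise idx k B -> measurable B.
Proof. exact: (measurable_cellwise_set filt). Qed.

Lemma cell_approxU x0 (A1 A2 : set T) : measurable A1 -> measurable A2 ->
  cell_approx x0 A1 -> cell_approx x0 A2 -> cell_approx x0 (A1 `|` A2).
Proof.
move=> mA1 mA2 a1 a2 e e0.
have e2 : 0 < e / 2 by rewrite divr_gt0.
have [k1 [B1 [cB1 mB1]]] := a1 _ e2; have [k2 [B2 [cB2 mB2]]] := a2 _ e2.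
have cB1' := cellwise_le filt (leq_maxl k1 k2) cB1.
have cB2' := cellwise_le filt (leq_maxr k1 k2) cB2.
exists (maxn k1 k2), (B1 `|` B2); split.
  by move=> x y xy; rewrite /setU /= (cB1' _ _ xy) (cB2' _ _ xy).
have mB1' := mcw cB1; have mB2' := mcw cB2.
have mQ := measurable_cell filt 0 x0.
have mD (X Y : set T) : measurable X -> measurable Y ->
    measurable (cell 0 x0 `&` ((X `\` Y) `|` (Y `\` X))).
  by move=> mX mY; apply: measurableI => //; apply: measurableU; exact: measurableD.
apply: (@le_trans _ _ (mu ((cell 0 x0 `&` ((A1 `\` B1) `|` (B1 `\` A1))) `|`
    (cell 0 x0 `&` ((A2 `\` B2) `|` (B2 `\` A2)))))).
  apply: le_measure; rewrite ?inE.
  - by apply: mD; exact: measurableU.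
  - by apply: measurableU; exact: mD.
  - move=> x [xQ [[[xA1|xA2] /not_orP[xB1 xB2]]|[[xB1|xB2] /not_orP[xA1 xA2]]]].
    + by left; split => //; left.
    + by right; split => //; left.
    + by left; split => //; right.
    + by right; split => //; right.
apply: le_trans (measureU2 mu (mD _ _ mA1 mB1') (mD _ _ mA2 mB2')) _.
by rewrite [e]splitr EFinD leeD.
Qed.

Lemma cell_approx_measurable x0 (A : set T) : generating -> measurable A ->
  cell_approx x0 A.
Proof.
move=> gen mA; have mQ := measurable_cell filt 0 x0.
suff : [set B | measurable B /\ cell_approx x0 B] A by case.
move: A {mA} (gen _ mA); apply: smallest_sub; last first.
  move=> _ [k [x ->]]; split; first exact: (measurable_cell filt).
  move=> e e0; exists k, (cell k x); split.
    by move=> y z yz; rewrite /cell /= yz.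
  by rewrite !setDv setUid setI0 measure0 lee_fin ltW.
split.
- split; first exact: measurable0.
  move=> e e0; exists 0%N, set0; split => //.
  by rewrite !set0D setUid setI0 measure0 lee_fin ltW.
- move=> A PA; split; first by apply: measurableD => //; exact: PA.1.
  move=> e /(proj2 PA)[k [B [cB mB]]]; exists k, (~` B); split.
    by move=> x y /cB xy; rewrite /setC /= xy.
  suff -> : ((setT `\` A) `\` ~` B) `|` (~` B `\` (setT `\` A)) =
      (A `\` B) `|` (B `\` A) by [].
  rewrite setTD !setDE !setCK setUC; congr (_ `|` _); last by rewrite setIC.
  by rewrite setIC.
- move=> F PF; have mF i : measurable (F i) by have [] := PF i.
  have mUF : measurable (\bigcup_i F i) by exact: bigcup_measurable.
  split; [exact: mUF|move=> e e0]; have e2 : 0 < e / 2 by rewrite divr_gt0.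
  pose U n := \big[setU/set0]_(i < n) F i.
  have mU n : measurable (U n) by exact: bigsetU_measurable.
  have aU n : cell_approx x0 (U n).
    rewrite /U; elim: n => [|n IH].
      rewrite big_ord0 => e' e'0; exists 0%N, set0; split => //.
      by rewrite !set0D setUid setI0 measure0 lee_fin ltW.
    by rewrite big_ord_recr /=; apply: cell_approxU => //; [exact: mU|exact: (PF n).2].
  pose G n := cell 0 x0 `&` (\bigcup_i F i `\` U n).
  have mG n : measurable (G n) by apply: measurableI => //; exact: measurableD.
  have G0 : \bigcap_n G n = set0.
    apply/seteqP; split => // x Gx; have [_ [[i _ Fix] _]] := Gx 0%N Logic.I.
    have [_ [_]] := Gx i.+1 Logic.I; apply.
    by rewrite /U big_ord_recr /=; right.
  have Gcvg : mu \o G @ \oo --> 0%E.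
    rewrite -(measure0 mu) -G0; apply: nonincreasing_cvg_mu => //.
    - by apply: Q0fin; exact: measurableD.
    - by rewrite G0.
    - apply/nonincreasing_seqP => n; apply/subsetPset => x [Qx [Fx Ux]].
      split => //; split => // Unx; apply: Ux.
      by rewrite /U big_ord_recr /=; left.
  have /fine_cvgP[_] : mu \o G @ \oo --> (0%R)%:E by [].
  move=> /cvgrPdist_lt/(_ _ e2)[n _ /(_ n (leqnn n)) /=].
  rewrite sub0r normrN ger0_norm ?fine_ge0// => Gn.
  have Gfin : mu (G n) \is a fin_num.
    by rewrite ge0_fin_numE//; apply: Q0fin; exact: measurableD.
  have [k [B [cB mB]]] := aU n _ e2.
  exists k, B; split => //.
  have mBB := mcw cB.
  have mW : measurable (cell 0 x0 `&` ((U n `\` B) `|` (B `\` U n))).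
    by apply: measurableI => //; apply: measurableU; exact: measurableD.
  apply: (@le_trans _ _ (mu (G n `|` (cell 0 x0 `&` ((U n `\` B) `|` (B `\` U n)))))).
    apply: le_measure; rewrite ?inE.
    + apply: measurableI => //; apply: measurableU; exact: measurableD.
    + exact: measurableU.
    + move=> x [Qx [[Fx nBx]|[Bx nFx]]].
        have [Ux|nUx] := pselect (U n x); first by right; split => //; left.
        by left; split.
      right; split => //; right; split => // Ux; apply: nFx.
      by move: Ux; rewrite /U -bigcup_mkord => -[i _ Fi]; exists i.
  apply: le_trans (measureU2 mu (mG n) mW) _.
  rewrite [e]splitr EFinD leeD//.
  apply: (@le_trans _ _ (fine (mu (G n)))%:E); first by rewrite fineK.
  by rewrite lee_fin ltW.
Qed.

Lemma ex_dyadic_scale (x : R) : 0 < x ->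
  exists m : int, 2 ^ m < x <= 2 ^ (m + 1).
Proof.
move=> x0; pose m := Num.ceil (ln x / ln 2) - 1.
have ln2 : 0 < ln (2 : R) by rewrite ln_gt0// ltr1n.
have E (z : int) : (2 : R) ^ z = expR (z%:~R * ln 2).
  by rewrite -powR_intmul// /powR pnatr_eq0.
have /andP[mlo mhi] : (m%:~R < ln x / ln 2 <= (m + 1)%:~R)%R.
  rewrite /m subrK ceil_ge andbT.
  by rewrite -[_ < _]/(_ < _)%R ltNge -ceil_le_int -ltNge ltrBlDr ltrDl.
have xE : expR (ln x) = x by rewrite lnK.
exists m; rewrite !E -xE.
by rewrite ltr_expR ler_expR -ltr_pdivlMr// -ler_pdivrMr// mlo.
Qed.

(** A weak form of the differentiation theorem, sufficient for the comparison of
    a function with its maximal function. If [v] exceeds [l] on a set of positive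
    measure where all averages of [v] are below [l / 2], this set resembles a
    union of cells, and the cells that meet it carry too little mass. *)
Theorem le_cexp_ae (v : T -> R) x0 : generating ->
  measurable_fun [set: T] v -> (forall x, 0 <= v x) -> cell_integrable mu idx v ->
  {ae mu, forall x, cell 0 x0 x -> exists k, v x <= 4 * cexp v k x}.
Proof.
move=> gen mv v0 vi; have mQ := measurable_cell filt 0 x0.
have mce k : measurable_fun setT (cexp v k).
  exact: (measurable_cellwise filt (@cellwise_cexp _ _ _ _ mu idx v k)).
pose P m := [set x | [/\ cell 0 x0 x, (2 : R) ^ m < v x, v x <= 2 ^ (m + 1) &
  forall k, 4 * cexp v k x < v x]].
have mP m : measurable (P m).
  have -> : P m = cell 0 x0 `&` (v @^-1` `]2 ^ m, 2 ^ (m + 1)]) `&`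
      \bigcap_k [set x | 4 * cexp v k x < v x].
    apply/seteqP; split => x.
      by move=> [Q a b c]; split; [split => //=; rewrite in_itv/= a|move=> k _; exact: c].
    by move=> [[Q /=]]; rewrite in_itv/= => /andP[a b] c; split => // k; exact: c.
  apply: measurableI; first apply: measurableI => //.
    by rewrite -[X in measurable X]setTI; apply: mv.
  apply: bigcap_measurable; first by exists 0%N.
  move=> k _; rewrite -[X in measurable X]setTI.
  have mlt : measurable_fun setT (fun x => 4 * cexp v k x < v x).
    by apply: measurable_fun_ltr => //; exact: measurable_funM.
  exact: (mlt measurableT [set true]).
suff P0 m : mu (P m) = 0%E.
  apply: (@negligibleS _ _ _ _ (\bigcup_n P (odflt 0 (unpickle n)))).
    move=> x /= /not_implyP[Qx /forallNP vx].
    have vx' k : 4 * cexp v k x < v x by have /negP := vx k; rewrite -ltNge.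
    have vgt0 : 0 < v x.
      by apply: le_lt_trans (vx' 0%N); rewrite mulr_ge0// cexp_ge0.
    have [m /andP[m1 m2]] := ex_dyadic_scale vgt0.
    by exists (pickle m) => //; rewrite pickleK /=; split.
  apply: negligible_bigcup => n; apply/negligibleP; [exact: mP|exact: P0].
apply/eqP; rewrite -measure_le0 leNgt; apply/negP => Pgt0.
have Pfin (A : set T) : measurable A -> A `<=` cell 0 x0 -> mu A \is a fin_num.
  move=> mA AQ; rewrite ge0_fin_numE//; have /andP[_] := mu_cell filt 0 x0.
  by apply: le_lt_trans; rewrite le_measure ?inE.
have PQ : P m `<=` cell 0 x0 by move=> x [].
have PF := Pfin _ (mP m) PQ.
set a := fine (mu (P m)).
have a0 : 0 < a by rewrite fine_gt0// Pgt0 -ge0_fin_numE.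
have e0 : 0 < a / 8 by rewrite divr_gt0.
have [k [B [cB mB]]] := cell_approx_measurable x0 gen (mP m) e0.
have mBB := mcw cB.
pose G := [set x | exists2 y, (P m `&` B) y & idx k x = idx k y].
have cG : cellwise idx k G.
  move=> x y xy; apply/propext; split => -[z Pz zx]; exists z => //.
    by rewrite -xy.
  by rewrite xy.
have mG := mcw cG.
have cQ : cellwise idx k (cell 0 x0).
  apply: (cellwise_le filt (leq0n k)) => x y xy.
  by rewrite /cell /= xy.
have GB : G `<=` cell 0 x0 `&` B.
  move=> x [y [[Qy _ _ _] By] xy].
  by split; [rewrite (cQ _ _ xy)|rewrite (cB _ _ xy)].
have PG : P m `&` B `<=` G by move=> x Px; exists x.
have mPB : measurable (P m `&` B) by exact: measurableI.
have mQB : measurable (cell 0 x0 `&` B) by exact: measurableI.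
have mW : measurable (cell 0 x0 `&` ((P m `\` B) `|` (B `\` P m))).
  by apply: measurableI => //; apply: measurableU; exact: measurableD.
set l := (2 : R) ^ m.
have l0 : 0 < l by rewrite exprz_gt0.
have mvE : measurable_fun setT (EFin \o v) by exact/measurable_EFinP.
have H1 : (l%:E * mu (P m `&` B) <= (l / 2)%:E * mu G)%E.
  apply: (@le_trans _ _ (\int[mu]_(x in P m `&` B) (v x)%:E)%E).
    rewrite -integral_cst//; apply: ge0_le_integral => //.
    - by move=> x _ /=; rewrite lee_fin ltW.
    - exact: measurable_funTS.
    - by move=> x [[_ lx _ _] _]; rewrite lee_fin ltW.
  apply: (@le_trans _ _ (\int[mu]_(x in G) (v x)%:E)%E).
    apply: ge0_subset_integral => //; first exact: measurable_funTS.
    by move=> x _; rewrite lee_fin.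
  apply: (@le_trans _ _ (\int[mu]_(x in G) (cexp v k x)%:E)%E).
    have h : (\int[mu]_(x in G) ((cst 1%R x)%:E * (EFin \o v) x) <=
        \int[mu]_(x in G) ((cst 1%R x)%:E * (cexp v k x)%:E))%E.
      apply: (@le_integral_cellwise _ _ _ _ _ _ filt k) => //=.
      - exact/measurable_EFinP.
      - by move=> x; rewrite lee_fin cexp_ge0.
      by move=> x _ _; rewrite (integral_cexp filt).
    by move: h; under eq_integral do rewrite mul1e;
      under [X in (_ <= X)%E -> _]eq_integral do rewrite mul1e.
  rewrite -integral_cst//; apply: ge0_le_integral => //.
  - by move=> x _; rewrite lee_fin cexp_ge0.
  - by apply: measurable_funTS; exact/measurable_EFinP.
  - move=> x [y [[_ _ yl yk] _] xy]; rewrite /= lee_fin.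
    rewrite (@cellwise_cexp _ _ _ _ mu idx v k x y xy).
    have := lt_le_trans (yk k) yl; rewrite expfzDr ?pnatr_eq0// expr1z -/l.
    move=> ?; lra.
have H2 : (mu (cell 0 x0 `&` B) <= mu (P m `&` B) + (a / 8)%:E)%E.
  apply: le_trans (leeD2l _ mB); apply: le_trans (measureU2 mu mPB mW).
  apply: le_measure; rewrite ?inE//; first exact: measurableU.
  move=> x [Qx Bx]; have [Px|Px] := pselect (P m x); first by left.
  by right; split => //; right.
have H3 : (mu (P m) <= mu (P m `&` B) + (a / 8)%:E)%E.
  apply: le_trans (leeD2l _ mB); apply: le_trans (measureU2 mu mPB mW).
  apply: le_measure; rewrite ?inE//; first exact: measurableU.
  move=> x Px; have [Bx|Bx] := pselect (B x); first by left.
  by right; split; [exact: PQ|left].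
have H4 : (mu G <= mu (cell 0 x0 `&` B))%E by rewrite le_measure ?inE.
have F1 := Pfin _ mPB (subset_trans (@subIsetl _ _ _) PQ).
have F2 := Pfin _ mQB (@subIsetl _ _ _).
have F3 := Pfin _ mG (subset_trans GB (@subIsetl _ _ _)).
move: H1 H2 H3 H4; rewrite -(fineK F1) -(fineK F2) -(fineK F3) -(fineK PF) -/a.
rewrite -!EFinD -!EFinM !lee_fin => H1 H2 H3 H4.
have H1' : fine (mu (P m `&` B)) <= 2^-1 * fine (mu G).
  by rewrite -(ler_pM2l l0) mulrA.
(* The average bound gives half of [mu G] at most, while the approximation
   makes [P m `&` B] almost all of [G]. *)
have contra (r1 r2 r3 b : R) : 0 < b -> r1 <= 2^-1 * r3 -> r2 <= r1 + b / 8 ->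
    b <= r1 + b / 8 -> r3 <= r2 -> False.
  by clear => b0 h1 h2 h3 h4; lra.
exact: contra a0 H1' H2 H3 H4.
Qed.

End Differentiation.

(** * The reverse Hoelder inequality on cells *)

Lemma absorb_half (R : realFieldType) (s u w : R) :
  s <= u + w -> w <= 2^-1 * s -> s <= 2 * u.
Proof. by move=> ? ?; lra. Qed.

(** Here [t k] is a substitute for the averages of [v] on the cells of
    generation [k], in general larger, for which the maximal function of every
    subtree satisfies an estimate of Ainf type ([subtree]). The freedom to take
    [t] larger than the averages allows [t] to be defined by balls, over which
    the Ainf constant is defined, although the cells are cubes. *)
Section ReverseHoelder.
Context d {T : measurableType d} {R : realType} {I : countType}.
Variables (mu : {measure set T -> \bar R}) (idx : nat -> T -> I).
Hypothesis filt : filtration mu idx.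
Local Notation cexp := (cexp mu idx).
Local Notation cell := (cell idx).
Variables (x0 : T) (v : T -> R) (t : nat -> T -> R) (D L : R).
Hypothesis mv : measurable_fun [set: T] v.
Hypothesis v0 : forall x, 0 <= v x.
Hypothesis vi : cell_integrable mu idx v.
Hypothesis tcell : forall k, cellwise idx k (t k).
Hypothesis t0 : forall k x, 0 <= t k x.
Hypothesis D1 : 1 <= D.
Hypothesis L1 : 1 <= L.
Hypothesis tD : forall k x, cell 0 x0 x -> t k.+1 x <= D * t k x.
Hypothesis vt : forall k x, cell 0 x0 x -> cexp v k x <= t k x.
Hypothesis subtree : forall k x, cell 0 x0 x -> exists h : T -> \bar R,
  [/\ measurable_fun [set: T] h, forall y, (0 <= h y)%E,
      forall y i, cell k x y -> (k <= i)%N -> ((t i y)%:E <= h y)%E &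
      (\int[mu]_(y in cell k x) h y <= (L * t k x)%:E * mu (cell k x))%E].

Let e : R := (2 * L * D ^+ 2)^-1.
Let Q0 := cell 0 x0.
Let M N := rmax t N.
Let tau := t 0%N x0.

Let tau0 : 0 <= tau. Proof. exact: t0. Qed.
Let L0 : 0 < L. Proof. exact: lt_le_trans L1. Qed.
Let D0 : 0 < D. Proof. exact: lt_le_trans D1. Qed.
Let LD0 : 0 < 2 * L * D ^+ 2. Proof. by rewrite !mulr_gt0// exprn_gt0. Qed.
Let e0 : 0 < e. Proof. by rewrite invr_gt0. Qed.
Let e1 : e <= 1.
Proof.
rewrite invf_le1//; have D2 : 1 <= D ^+ 2 by rewrite expr_ge1// ltW.
have L2 : 1 <= 2 * L by move: L1 => ?; lra.
by rewrite (le_trans L2)// ler_peMr// (le_trans ler01 L2).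
Qed.
Let eDL : e * D ^+ 2 * L = 2^-1.
Proof. by rewrite /e; field; rewrite !gt_eqF. Qed.

Let mQ : measurable Q0. Proof. exact: (measurable_cell filt). Qed.

Let cQ k : cellwise idx k Q0.
Proof.
apply: (cellwise_le filt (leq0n k)) => x y xy.
by rewrite /Q0 /cell /= xy.
Qed.

Let mrinc (a : R) k : measurable_fun setT (fun x => (rinc t a k x)%:E).
Proof.
apply/measurable_EFinP; apply: (measurable_cellwise filt (k := k)).
exact: (cellwise_rinc filt).
Qed.

Let mt k : measurable_fun setT (fun x => (t k x)%:E).
Proof.
apply/measurable_EFinP; apply: (measurable_cellwise filt (k := k)).
exact: tcell.
Qed.

Let mM N : measurable_fun setT (M N).
Proof. exact: (measurable_rmax filt). Qed.

Let M0 N x : 0 <= M N x. Proof. exact: rmax_ge0. Qed.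

Let finQ : mu Q0 \is a fin_num. Proof. exact: (fin_mu_cell filt). Qed.

Let t_bound k x : Q0 x -> t k x <= D ^+ k * tau.
Proof.
move=> Qx; elim: k => [|k IH].
  by rewrite expr0 mul1r (tcell (k := 0) (y := x0)).
by rewrite exprS -mulrA (le_trans (tD k Qx))// ler_pM2l.
Qed.

Let powR1D (x : R) : 0 <= x -> x `^ (1 + e) = x `^ e * x.
Proof. by move=> ?; rewrite powRD ?powRr1 1?mulrC// gt_eqF// addr_gt0. Qed.

Let fin_int N : (\int[mu]_(x in Q0) (M N x `^ (1 + e))%:E < +oo)%E.
Proof.
pose b := D ^+ N * tau.
have b0 : 0 <= b by rewrite mulr_ge0 ?exprn_ge0// ltW.
apply: (@le_lt_trans _ _ (\int[mu]_(x in Q0) (cst (b `^ (1 + e))%:E x))%E); last first.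
  by rewrite integral_cst// -(fineK finQ) -EFinM ltry.
apply: ge0_le_integral => //.
- by move=> x _; rewrite lee_fin powR_ge0.
- by apply: measurable_funTS; apply/measurable_EFinP; exact: measurable_powRr.
move=> x Qx; rewrite lee_fin ler_powR2//; first by rewrite addr_ge0// ltW.
apply: rmax_lub => // j jN; apply: le_trans (t_bound j Qx) _.
by apply: (ler_wpM2r tau0); apply: ler_weXn2l => //; exact: ltnW.
Qed.

Let inc_le N x : (0 < N)%N -> Q0 x ->
  \sum_(j < N) rinc t e j x * t j x <=
  tau `^ (1 + e) + e * D ^+ 2 * M N x `^ (1 + e).
Proof.
case: N => // N _ Qx; have e10 : 0 < 1 + e by rewrite addr_gt0.
rewrite big_ord_recl /= lerD//.
  rewrite /rinc /= powR0 ?gt_eqF// subr0 max_r//.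
  by rewrite -powR1D// (tcell (k := 0) (y := x0)).
rewrite -(sum_rinc t N.+1 x e10) mulr_sumr big_ord_recl /=.
rewrite -[leLHS]add0r lerD//.
  by rewrite !mulr_ge0 ?sqr_ge0 ?rinc_ge0// ltW.
apply: ler_sum => j _; rewrite /bump /= add1n.
have [tj|tj] := leP (t j.+1 x) (rmax t j.+1 x).
  rewrite {1}/rinc /= -/(rmax t j.+1 x) max_l// subrr mul0r.
  by rewrite !mulr_ge0 ?sqr_ge0 ?rinc_ge0// ltW.
have rj : rmax t j.+2 x = t j.+1 x by rewrite /= -/(rmax t j.+1 x) max_r// ltW.
rewrite /rinc rj; apply: reverse_hoelder_increment => //.
- by rewrite e0 e1.
- exact: ltW.
- apply: le_trans (tD j Qx) _; rewrite ler_pM2l//.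
  exact: le_rmax.
Qed.

(* On a cell where generation [j] increases the running maximum, the value of
   [t j] exceeds all earlier values, so that the whole running maximum is the
   one of the subtree below the cell. *)
Let record j N x : Q0 x -> 0 < rinc t e j x ->
  (\int[mu]_(y in cell j x) (M N y)%:E <= \int[mu]_(y in cell j x) (L * t j y)%:E)%E.
Proof.
move=> Qx rj; have mc := measurable_cell filt j x.
have [h [mh h0 th hL]] := subtree j Qx.
have -> : (\int[mu]_(y in cell j x) (L * t j y)%:E = (L * t j x)%:E * mu (cell j x))%E.
  rewrite -integral_cst//; apply: eq_integral => y; rewrite inE => yx.
  by rewrite (tcell yx).
apply: le_trans hL; apply: ge0_le_integral => //.
- by move=> y _; rewrite lee_fin.
- by apply: measurable_funTS; exact/measurable_EFinP.
- exact: measurable_funTS.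
move=> y yx; have tjy : rmax t j y < t j y.
  rewrite ltNge; apply/negP => tj.
  move: rj; rewrite -(cellwise_rinc filt e tcell yx) /rinc /= max_l//.
  by rewrite subrr ltxx.
have hj := th y j yx (leqnn j).
rewrite /M; elim: N => [|N IH]; first exact: h0.
rewrite /= EFin_max ge_max IH /=.
have [jN|Nj] := leqP j N; first exact: th.
apply: le_trans hj; rewrite lee_fin ltW//.
exact: le_lt_trans (le_rmax _ _ Nj) tjy.
Qed.

Let Z N : \bar R := (\int[mu]_(x in Q0) (\sum_(j < N) rinc t e j x * t j x)%:E)%E.

Let sum_int N (g : nat -> T -> R) : (forall j, measurable_fun setT (fun x => (g j x)%:E)) ->
  (forall j x, 0 <= g j x) ->
  (\int[mu]_(x in Q0) (\sum_(j < N) rinc t e j x * g j x)%:E =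
   \sum_(j < N) \int[mu]_(x in Q0) ((rinc t e j x)%:E * (g j x)%:E))%E.
Proof.
move=> mg g0; rewrite -ge0_integral_sum//; last 2 first.
- by move=> j; apply: measurable_funTS; exact: emeasurable_funM.
- by move=> j x _; rewrite -EFinM lee_fin mulr_ge0// rinc_ge0// ltW.
by apply: eq_integral => x _; rewrite -sumEFin; apply: eq_bigr.
Qed.

Let MLZ N : (\int[mu]_(x in Q0) (M N x `^ (1 + e))%:E <= L%:E * Z N)%E.
Proof.
have -> : (\int[mu]_(x in Q0) (M N x `^ (1 + e))%:E =
    \int[mu]_(x in Q0) (\sum_(j < N) rinc t e j x * M N x)%:E)%E.
  apply: eq_integral => x _; rewrite -mulr_suml sum_rinc//.
  by rewrite powR1D.
rewrite (@sum_int N (fun=> M N))//; last by move=> j; exact/measurable_EFinP.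
rewrite /Z sum_int// ge0_sume_distrr; last first.
  move=> j _; apply: integral_ge0 => x _.
  by rewrite -EFinM lee_fin mulr_ge0// rinc_ge0// ltW.
apply: lee_sum => j _; rewrite -ge0_integralZl//; last 3 first.
- by apply: measurable_funTS; exact: emeasurable_funM.
- by move=> x _; rewrite -EFinM lee_fin mulr_ge0// rinc_ge0// ltW.
- by rewrite lee_fin ltW.
under [leRHS]eq_integral do rewrite muleCA -(EFinM L).
apply: (@le_integral_cellwise _ _ _ _ _ _ filt j) => //.
- exact: (cellwise_rinc filt).
- by move=> x; rewrite rinc_ge0// ltW.
- exact/measurable_EFinP.
- by under eq_fun do rewrite EFinM; exact: measurable_funeM.
- by move=> x; rewrite lee_fin.
- by move=> x; rewrite lee_fin mulr_ge0// ltW.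
- by move=> x Qx rj; exact: record.
Qed.

Let Zle N : (0 < N)%N -> (Z N <= (2 * tau `^ (1 + e))%:E * mu Q0)%E.
Proof.
move=> N0; have X0 : (0 <= \int[mu]_(x in Q0) (M N x `^ (1 + e))%:E)%E.
  by apply: integral_ge0 => x _; rewrite lee_fin powR_ge0.
have H1 : (Z N <= (tau `^ (1 + e))%:E * mu Q0 +
    (e * D ^+ 2)%:E * \int[mu]_(x in Q0) (M N x `^ (1 + e))%:E)%E.
  have mMe : measurable_fun Q0 (fun x => (M N x `^ (1 + e))%:E).
    by apply: measurable_funTS; apply/measurable_EFinP; exact: measurable_powRr.
  have eD0 : 0 <= e * D ^+ 2 by apply: mulr_ge0; [exact: ltW|exact: sqr_ge0].
  rewrite -integral_cst// -ge0_integralZl//; last first.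
    by move=> x _; rewrite lee_fin powR_ge0.
  rewrite -ge0_integralD//; last 3 first.
  - by move=> x _ /=; rewrite lee_fin powR_ge0.
  - by move=> x _ /=; rewrite mule_ge0// lee_fin powR_ge0.
  - exact: measurable_funeM.
  apply: ge0_le_integral => //.
  - move=> x _; rewrite lee_fin sumr_ge0// => j _.
    by rewrite mulr_ge0// rinc_ge0// ltW.
  - apply: measurable_funTS; apply/measurable_EFinP; apply: measurable_sum => j.
    by apply: measurable_funM; apply/measurable_EFinP; [exact: mrinc|exact: mt].
  - by apply: emeasurable_funD => //; exact: measurable_funeM.
  by move=> x Qx; rewrite -EFinM -EFinD lee_fin inc_le.
have Xf := fin_int N; have H2 := MLZ N.
have Xfin : (\int[mu]_(x in Q0) (M N x `^ (1 + e))%:E)%E \is a fin_num.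
  by rewrite ge0_fin_numE.
have Z0 : (0 <= Z N)%E.
  apply: integral_ge0 => x _; rewrite lee_fin sumr_ge0// => j _.
  by rewrite mulr_ge0// rinc_ge0// ltW.
have Zfin : Z N \is a fin_num.
  rewrite ge0_fin_numE//; apply: le_lt_trans H1 _.
  by rewrite -(fineK finQ) -(fineK Xfin) -!EFinM -EFinD ltry.
move: H1 H2; rewrite -(fineK finQ) -(fineK Xfin) -(fineK Zfin) -!EFinM -EFinD !lee_fin.
set X := fine _; set m := fine (mu _); set z := fine (Z N) => H1 H2.
have H3 := ler_wpM2l (mulr_ge0 (ltW e0) (sqr_ge0 D)) H2.
rewrite mulrA eDL in H3.
by rewrite -mulrA; exact: (absorb_half H1 H3).
Qed.

Let vM N : (0 < N)%N ->
  (\int[mu]_(x in Q0) (v x * M N x `^ e)%:E <= (2 * tau `^ (1 + e))%:E * mu Q0)%E.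
Proof.
move=> N0; apply: le_trans (Zle N0).
have -> : (\int[mu]_(x in Q0) (v x * M N x `^ e)%:E =
    \int[mu]_(x in Q0) (\sum_(j < N) rinc t e j x * v x)%:E)%E.
  by apply: eq_integral => x _; rewrite -mulr_suml sum_rinc// mulrC.
have mvE : measurable_fun setT (fun x => (v x)%:E) by exact/measurable_EFinP.
rewrite (@sum_int N (fun=> v))// /Z sum_int//.
apply: lee_sum => j _; apply: (@le_integral_cellwise _ _ _ _ _ _ filt j) => //.
- exact: (cellwise_rinc filt).
- by move=> x; rewrite rinc_ge0// ltW.
- by move=> x; rewrite lee_fin.
move=> x Qx _; rewrite -(integral_cexp filt j x v0 vi).
apply: ge0_le_integral => //.
- exact: (measurable_cell filt).
- by move=> y _; rewrite lee_fin cexp_ge0.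
- apply: measurable_funTS; apply/measurable_EFinP.
  apply: (measurable_cellwise filt (k := j)); exact: cellwise_cexp.
- exact: measurable_funTS.
move=> y yx; rewrite lee_fin; apply: vt.
have Qy : Q0 y by rewrite (cQ yx).
exact: Qy.
Qed.

(** The self-improvement of integrability. The power [e] of the running maximum
    of [t] grows at a generation only where [t] sets a record, and there the
    later values of [t] are governed by [subtree]; since [t] grows at most by the
    factor [D] from one generation to the next, each increment costs a factor [e],
    so for small [e] the integral of the maximum can be absorbed. *)
Theorem reverse_hoelder_cells : generating idx ->
  (\int[mu]_(x in Q0) (v x `^ (1 + e))%:E <= (8 * tau `^ (1 + e))%:E * mu Q0)%E.
Proof.
move=> gen.
pose A N := Q0 `&` [set x | v x <= 4 * M N x].
have mA N : measurable (A N).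
  apply: measurableI => //; rewrite -[X in measurable X]setTI.
  have mle : measurable_fun setT (fun x => v x <= 4 * M N x).
    by apply: measurable_fun_ler => //; exact: measurable_funM.
  exact: (mle measurableT [set true]).
have ndA : nondecreasing_seq A.
  apply/nondecreasing_seqP => N; apply/subsetPset => x [Qx vx]; split => //=.
  by apply: le_trans vx _; rewrite ler_pM2l// rmax_leS.
have mve : measurable_fun setT (fun x => (v x `^ (1 + e))%:E).
  by apply/measurable_EFinP; exact: measurable_powRr.
have ve0 x : (0 <= (v x `^ (1 + e))%:E)%E by rewrite lee_fin powR_ge0.
have mUA : measurable (\bigcup_N A N) by exact: bigcup_measurable.
have neg : mu (Q0 `\` \bigcup_N A N) = 0%E.
  apply/eqP; rewrite -measure_le0.
  have [B [mB B0 QB]] := le_cexp_ae filt x0 gen mv v0 vi.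
  rewrite -B0 le_measure ?inE//; first exact: measurableD.
  move=> x [Qx nAx]; apply: QB => /= /(_ Qx)[k vk]; apply: nAx.
  exists k.+1 => //; split => //=; apply: le_trans vk _.
  by rewrite ler_pM2l// le_max vt// orbT.
have -> : (\int[mu]_(x in Q0) (v x `^ (1 + e))%:E =
    \int[mu]_(x in \bigcup_N A N) (v x `^ (1 + e))%:E)%E.
  have -> : \bigcup_N A N = Q0 `\` (Q0 `\` \bigcup_N A N).
    rewrite setDD; apply/seteqP; split => [x Ax|x []//]; split => //.
    by case: Ax => N _ [].
  apply: ge0_negligible_integral => //; first exact: measurableD.
  exact: measurable_funTS.
have cv := @ge0_nondecreasing_set_cvg_integral _ _ _ A _ mu ndA mA
  (fun i => measurable_funTS mve) (fun _ x _ => ve0 x).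
rewrite -(cvg_lim (@ereal_hausdorff R) cv).
apply: lime_le; first exact: cvgP cv.
exists 1%N => // N /= N0.
apply: (@le_trans _ _ (\int[mu]_(x in Q0) (4%:E * (v x * M N x `^ e)%:E))%E).
  have mvM : measurable_fun setT (fun x => (4%:E * (v x * M N x `^ e)%:E)%E).
    apply: measurable_funeM; apply/measurable_EFinP.
    by apply: measurable_funM => //; exact: measurable_powRr.
  apply: (@le_trans _ _ (\int[mu]_(x in A N) (4%:E * (v x * M N x `^ e)%:E))%E).
    apply: ge0_le_integral => //.
    - exact: measurable_funTS.
    - exact: measurable_funTS.
    move=> x [Qx vx]; rewrite -EFinM lee_fin powR1D// mulrC mulrCA.
    rewrite ler_wpM2l//; apply: (@le_trans _ _ ((4 * M N x) `^ e)).
      by rewrite ler_powR2// ltW.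
    rewrite powRM// ler_wpM2r ?powR_ge0//.
    by rewrite -[leRHS]powRr1// ler_powR// ler1n.
  apply: ge0_subset_integral => //.
  - exact: measurable_funTS.
  - by move=> x _; rewrite mule_ge0// lee_fin mulr_ge0// powR_ge0.
  - by move=> x [].
rewrite ge0_integralZl//; last 2 first.
- apply: measurable_funTS; apply/measurable_EFinP.
  by apply: measurable_funM => //; exact: measurable_powRr.
- by move=> x _; rewrite lee_fin mulr_ge0// powR_ge0.
apply: (@le_trans _ _ (4%:E * ((2 * tau `^ (1 + e))%:E * mu Q0))%E).
  by rewrite lee_wpmul2l// vM.
rewrite muleA -EFinM mulrA (_ : 4 * 2 = 8 :> R)//.
by rewrite -natrM.
Qed.

End ReverseHoelder.

(** * Dyadic grids in Euclidean space *)

Section Grids.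
Context {R : realType} {n : nat}.
Local Notation Rn := (Rn R n).
Implicit Types (a : 'I_3 ^ n) (k : int) (m : int ^ n) (x y z : Rn).

Lemma measurable_coord (i : 'I_n) :
  measurable_fun [set: Rn] (fun x : Rn => x ord0 i : R).
Proof.
apply: (measurability _ (RGenOpens.measurableE R)).
move=> _ [_ [b [c ->]] <-]; rewrite setTI; apply: sub_sigma_algebra.
have /continuousP := @coord_continuous R 1 n ord0 i.
by apply; exact: interval_open.
Qed.

Definition sqdist (x y : Rn) : R := \sum_(i < n) (y ord0 i - x ord0 i) ^+ 2.

Lemma eballE x (r : R) y : 0 < r -> eball x r y = (sqdist x y < r ^+ 2) :> Prop.
Proof.
move=> r0; rewrite /eball /= -/(sqdist x y).
by rewrite -{1}(gtr0_norm r0) -sqrtr_sqr ltr_sqrt// exprn_gt0.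
Qed.

Lemma measurable_eball x (r : R) : 0 < r -> measurable (eball x r).
Proof.
move=> r0; have ms : measurable_fun [set: Rn] (fun y => sqdist x y).
  apply: measurable_sum => i; apply: measurable_funX.
  by apply: measurable_funB => //; exact: measurable_coord.
have -> : eball x r = [set y | sqdist x y < r ^+ 2].
  by apply/seteqP; split => y; rewrite eballE.
rewrite -[X in measurable X]setTI.
have mlt := measurable_fun_ltr ms (measurable_cst (r ^+ 2)).
exact: (mlt measurableT [set true]).
Qed.

Lemma eball_sub x (r s : R) : r <= s -> eball x r `<=` eball x s.
Proof. by move=> rs y; rewrite /eball /= => /lt_le_trans; apply. Qed.

Lemma sqdist_le x y (b : R) : (forall i, `|y ord0 i - x ord0 i| <= b) ->
  sqdist x y <= n%:R * b ^+ 2.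
Proof.
move=> yx; have -> : n%:R * b ^+ 2 = \sum_(i < n) b ^+ 2.
  by rewrite sumr_const card_ord mulr_natl.
apply: ler_sum => i _; rewrite -real_normK ?num_real//.
by rewrite lerXn2r ?nnegrE// (le_trans _ (yx i)).
Qed.

Lemma sqdist_coord x y (b : R) (i : 'I_n) : 0 < b -> sqdist x y < b ^+ 2 ->
  `|y ord0 i - x ord0 i| < b.
Proof.
move=> b0 xy; rewrite -(ltr_pXn2r (n := 2)) ?nnegrE ?(ltW b0)//.
rewrite real_normK ?num_real//; apply: le_lt_trans xy.
by rewrite /sqdist (bigD1 i)//= lerDl sumr_ge0// => j _; exact: sqr_ge0.
Qed.

Lemma sqdist_triangle x y z : sqdist x z <= 2 * sqdist x y + 2 * sqdist y z.
Proof.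
rewrite !mulr_sumr -big_split /=; apply: ler_sum => i _.
set p := y ord0 i; set q := z ord0 i; set s := x ord0 i.
rewrite -subr_ge0.
have -> : 2 * (p - s) ^+ 2 + 2 * (q - p) ^+ 2 - (q - s) ^+ 2 =
  ((p - s) - (q - p)) ^+ 2 by ring.
exact: sqr_ge0.
Qed.

(** Offsets are measured in units of the side, as in [dyadic_cube]. *)
Definition goff a k (i : 'I_n) : R := (-1) ^ k * ((a i)%:R / 3%:R).

Definition side k : R := 2 ^ (- k).

(** The multi-index of the cube of generation [k] of the grid [a] containing
    a point. *)
Definition gidx a k x : int ^ n :=
  [ffun i : 'I_n => Num.floor (2 ^ k * x ord0 i - goff a k i)].

Lemma side_gt0 k : 0 < side k.
Proof. by rewrite exprz_gt0. Qed.

Lemma sideN k : (2 : R) ^ k = (side k)^-1.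
Proof. by rewrite /side invr_expz opprK. Qed.

Lemma sideS k : side (k + 1) = side k / 2.
Proof. by rewrite /side opprD expfzDr ?pnatr_eq0// expN1r. Qed.

Lemma dyadic_cubeE a k m : dyadic_cube a k m = [set x : Rn | gidx a k x = m].
Proof.
have s0 := side_gt0 k.
have E (x : Rn) (i : 'I_n) : (2%:R ^ (- k) * ((m i)%:~R + goff a k i) <= x ord0 i <
    2%:R ^ (- k) * ((m i)%:~R + goff a k i + 1)) =
    (Num.floor (2 ^ k * x ord0 i - goff a k i) == m i).
  have xE : x ord0 i = side k * (2 ^ k * x ord0 i).
    by rewrite mulrA sideN divff ?mul1r// gt_eqF.
  rewrite floor_eq lerBrDr ltrBlDr intrD [in RHS]addrAC {1 2}xE -!/(side k).
  by rewrite ler_pM2l// ltr_pM2l.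
apply/seteqP; split => x /=.
  move=> xm; apply/ffunP => i; rewrite ffunE; apply/eqP; rewrite -E.
  exact: xm.
move=> xm i; have := congr1 (fun g : int ^ n => g i) xm; rewrite ffunE => /eqP.
by rewrite -E.
Qed.

Lemma sign_expz k : (-1 : R) ^ k = 1 \/ (-1 : R) ^ k = -1.
Proof.
case: k => j; rewrite /exprz; [|rewrite -[(_ ^+ j.+1)^-1]/((_ ^+ j.+1)^-1)];
  rewrite -signr_odd; case: (odd _); rewrite ?expr1 ?expr0 ?invrN1 ?invr1; by auto.
Qed.

Lemma floor_double (t t' : R) :
  Num.floor (2 * t) = Num.floor (2 * t') -> Num.floor t = Num.floor t'.
Proof.
wlog suff H : t t' / Num.floor (2 * t) = Num.floor (2 * t') ->
    Num.floor t <= Num.floor t'.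
  by move=> tt'; apply/eqP; rewrite eq_le !H.
move=> E; rewrite floor_ge_int.
have : Num.floor t *+ 2 <= Num.floor (2 * t).
  by rewrite floor_ge_int rmorphMn /= mulr_natl lerMn2r floor_le orbT.
rewrite E floor_ge_int rmorphMn /= mulr_natl lerMn2r.
by case/orP.
Qed.

(** Passing to the next generation doubles the coordinates and changes the sign
    of the offset [o]. The grids are nested because this differs from doubling
    both by [3 * o], which is an integer. *)
Lemma gidx_refine a k x y : gidx a (k + 1) x = gidx a (k + 1) y ->
  gidx a k x = gidx a k y.
Proof.
move=> xy; apply/ffunP => i; rewrite !ffunE; apply: floor_double.
have := congr1 (fun g : int ^ n => g i) xy; rewrite !ffunE.
have [z zE] : exists z : int, z%:~R = 3 * goff a k i.
  rewrite /goff; have [->|->] := sign_expz k.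
    by exists (a i)%:Z; rewrite mul1r mulrC divfK ?pnatr_eq0.
  by exists (- (a i)%:Z); rewrite mulN1r mulrN mulrC divfK ?pnatr_eq0// rmorphN.
have E (u : Rn) : 2 ^ (k + 1) * u ord0 i - goff a (k + 1) i =
    2 * (2 ^ k * u ord0 i - goff a k i) + z%:~R.
  have -> : goff a (k + 1) i = - goff a k i.
    by rewrite /goff expfzDr ?oppr_eq0 ?oner_eq0// expr1z mulrN1 mulNr.
  by rewrite zE expfzDr ?pnatr_eq0// expr1z; ring.
by rewrite !E !floorDrz ?intr_int// => /addIr.
Qed.

Definition ctr a k x : Rn :=
  \row_i (side k * ((gidx a k x i)%:~R + goff a k i + 2^-1)).

Lemma ctr_coord a k x (i : 'I_n) : `|x ord0 i - ctr a k x ord0 i| <= side k / 2.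
Proof.
have s0 := side_gt0 k; rewrite mxE.
have /andP[] := floor_itv (2 ^ k * x ord0 i - goff a k i).
rewrite ffunE; set f := (Num.floor _) => fl fh.
have xE : x ord0 i = side k * (2 ^ k * x ord0 i).
  by rewrite mulrA sideN divff ?mul1r// gt_eqF.
rewrite xE -mulrBr normrM gtr0_norm// ler_pM2l// ler_norml.
move: fl fh; rewrite intrD /=; set u := 2 ^ k * _; set o := goff _ _ _.
by move=> fl fh; apply/andP; split; lra.
Qed.

Lemma ctr_cube a k x y : (forall i, `|y ord0 i - ctr a k x ord0 i| < side k / 2) ->
  gidx a k y = gidx a k x.
Proof.
move=> H; apply/ffunP => i; rewrite [LHS]ffunE; apply/eqP.
have s0 := side_gt0 k; rewrite floor_eq.
have yE : y ord0 i = side k * (2 ^ k * y ord0 i).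
  by rewrite mulrA sideN divff ?mul1r// gt_eqF.
have := H i; rewrite mxE yE -mulrBr normrM gtr0_norm// ltr_pM2l// ltr_norml.
rewrite -yE intrD /=; set u := 2 ^ k * _; set o := goff _ _ _.
by move=> /andP[? ?]; apply/andP; split; lra.
Qed.

(** A ball around the cube of generation [k] that contains [x], so large that
    it also contains the parent cube, and the ball of each child. *)
Definition qball a k x : set Rn := eball (ctr a k x) (2 ^+ n.+2 * (side k / 2)).

Lemma qball_radius_gt0 k : 0 < 2 ^+ n.+2 * (side k / 2).
Proof. by rewrite mulr_gt0 ?exprn_gt0// divr_gt0// side_gt0. Qed.

Lemma ltn_4exp : (n%:R : R) < 4 ^+ n.
Proof. by rewrite -natrX ltr_nat ltn_expl. Qed.

Lemma qball_sqr k : (2 ^+ n.+2 * (side k / 2)) ^+ 2 = 4 ^+ n * (4 * side k ^+ 2) :> R.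
Proof.
rewrite exprMn -exprM mulnC exprM (_ : 2 ^+ 2 = 4 :> R); last by rewrite -natrX.
by rewrite !exprS expr0; field.
Qed.

Lemma near_qball a k x y : (forall i, `|y ord0 i - ctr a k x ord0 i| <= 2 * side k) ->
  qball a k x y.
Proof.
move=> yx; rewrite /qball eballE ?qball_radius_gt0// qball_sqr.
apply: le_lt_trans (sqdist_le yx) _.
rewrite exprMn (_ : 2 ^+ 2 = 4 :> R); last by rewrite -natrX.
by rewrite ltr_pM2r ?ltn_4exp// mulr_gt0// exprn_gt0// side_gt0.
Qed.

Definition cube a k x : set Rn := dyadic_cube a k (gidx a k x).

Lemma cubeE a k x y : cube a k x y = (gidx a k y = gidx a k x).
Proof. by rewrite /cube dyadic_cubeE. Qed.

Lemma cube_self a k x : cube a k x x. Proof. by rewrite cubeE. Qed.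

Lemma dyadic_cube_cube a k m x : dyadic_cube a k m x -> dyadic_cube a k m = cube a k x.
Proof. by rewrite /cube !dyadic_cubeE /= => ->. Qed.

Lemma ctr_in_cube a k x : gidx a k (ctr a k x) = gidx a k x.
Proof. by apply: ctr_cube => i; rewrite subrr normr0 divr_gt0// side_gt0. Qed.

Lemma dyadic_cube_nonempty a k m : exists x, dyadic_cube a k m x.
Proof.
exists (\row_i (side k * ((m i)%:~R + goff a k i + 2^-1))); rewrite dyadic_cubeE /=.
have s0 := side_gt0 k.
apply/ffunP => i; rewrite ffunE mxE; apply/eqP.
rewrite sideN mulKf; last by rewrite gt_eqF.
rewrite floor_eq intrD /=.
by apply/andP; split; lra.
Qed.

Lemma ex_dyadic (Q : set Rn) : dyadic Q -> exists a k x, Q = cube a k x.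
Proof.
move=> [a _ [k [m ->]]]; have [x xm] := dyadic_cube_nonempty a k m.
by exists a, k, x; exact: dyadic_cube_cube.
Qed.

Lemma dyadic_cube_dyadic a k x : dyadic (cube a k x).
Proof. by exists a => //; exists k, (gidx a k x). Qed.

Lemma cube_qball a k x : cube a k x `<=` qball a k x.
Proof.
move=> y; rewrite cubeE => yx; apply: near_qball => i.
have cE : ctr a k x = ctr a k y by rewrite /ctr yx.
rewrite cE; apply: le_trans (ctr_coord a k y i) _.
by have := side_gt0 k => ?; lra.
Qed.

Lemma same_cube_coord a k y z (i : 'I_n) : gidx a k z = gidx a k y ->
  `|z ord0 i - y ord0 i| <= side k.
Proof.
move=> zy; have cE : ctr a k z = ctr a k y by rewrite /ctr zy.
have h1 := ctr_coord a k z i; have h2 := ctr_coord a k y i.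
rewrite cE in h1; rewrite distrC in h2.
rewrite (_ : z ord0 i - _ = (z ord0 i - ctr a k y ord0 i) +
  (ctr a k y ord0 i - y ord0 i)); last by ring.
by apply: le_trans (ler_normD _ _) _; rewrite [leRHS](splitr (side k)) lerD.
Qed.

Lemma ctr_child a k x (i : 'I_n) :
  `|ctr a (k + 1) x ord0 i - ctr a k x ord0 i| <= side k / 2.
Proof.
have E : gidx a k (ctr a (k + 1) x) = gidx a k x.
  by apply: gidx_refine; exact: ctr_in_cube.
have cE : ctr a k x = ctr a k (ctr a (k + 1) x) by rewrite /ctr E.
by rewrite [in X in _ - X]cE ctr_coord.
Qed.

Lemma parent_qball a k x : cube a k x `<=` qball a (k + 1) x.
Proof.
move=> y; rewrite cubeE => yx; apply: near_qball => i.
have cE : ctr a k y = ctr a k x by rewrite /ctr yx.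
have h1 := ctr_coord a k y i; rewrite cE in h1.
have h2 := ctr_child a k x i; rewrite distrC in h2.
rewrite (_ : y ord0 i - _ = (y ord0 i - ctr a k x ord0 i) +
  (ctr a k x ord0 i - ctr a (k + 1) x ord0 i)); last by ring.
apply: le_trans (ler_normD _ _) _; rewrite sideS mulrC divfK//.
by rewrite [leRHS](splitr (side k)) lerD.
Qed.

Lemma qball_parent a k x : qball a (k + 1) x `<=` qball a k x.
Proof.
move=> y; rewrite /qball !eballE ?qball_radius_gt0// !qball_sqr sideS => yx.
apply: le_lt_trans (sqdist_triangle _ (ctr a (k + 1) x) _) _.
have h := sqdist_le (ctr_child a k x).
have s0 : 0 < side k ^+ 2 by rewrite exprn_gt0// side_gt0.
have n4 := ltn_4exp.
have hs : n%:R * side k ^+ 2 < 4 ^+ n * side k ^+ 2 by rewrite ltr_pM2r.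
move: h yx hs; rewrite exprMn (_ : 2^-1 ^+ 2 = 4^-1 :> R); last first.
  by rewrite exprVn -natrX.
set u := sqdist _ _; set w := sqdist _ _; set S := side k ^+ 2.
move=> h yx hs.
have e1 : 4 ^+ n * (4 * (S / 4)) = 4 ^+ n * S by field.
have e2 : 4 ^+ n * (4 * S) = 4 * (4 ^+ n * S) by ring.
have e3 : n%:R * (S / 4) = n%:R * S / 4 by ring.
rewrite e1 in yx; rewrite e2; rewrite e3 in h.
have P0 : 0 < 4 ^+ n * S by rewrite mulr_gt0// exprn_gt0.
move: (4 ^+ n * S) (n%:R * S) yx h hs P0 => p q ? ? ? ?; lra.
Qed.

(** Every multiple of a third of the side is an endpoint of one of the three
    grids; so a ball of radius at most a sixth of the side lies in a cube of one
    of them, chosen separately in each direction. *)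
Lemma eball_cube y (r : R) : 0 < r -> exists a k,
  eball y r `<=` cube a k y /\ cube a k y `<=` eball y (2 ^+ n.+4 * r).
Proof.
move=> r0; have r6 : 0 < 6 * r by rewrite mulr_gt0.
have [m /andP[m1 m2]] := ex_dyadic_scale r6.
pose k : int := - (m + 1).
have sE : side k = 2 ^ (m + 1) by rewrite /side opprK.
have s6 : 6 * r <= side k by rewrite sE.
have s12 : side k < 12 * r.
  rewrite sE expfzDr ?pnatr_eq0// expr1z; move: m1; move: (2 ^ m) => p ?; lra.
have s0 := side_gt0 k.
pose j (i : 'I_n) : int := Num.floor (3 * (2 ^ k * (y ord0 i - r))).
have exa (z : int) : exists (b : 'I_3) (c : int),
    c%:~R + (-1) ^ k * ((b : nat)%:R / 3%:R) = z%:~R / 3%:R :> R.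
  have modlt (w : int) : (`|(w %% 3)%Z| < 3)%N.
    by have := ltz_mod w (isT : (3 : int) != 0); have := modz_ge0 w (isT : (3 : int) != 0); case: (w %% 3)%Z.
  have modE (w : int) : w%:~R = (w %/ 3)%Z%:~R * 3%:R + (`|(w %% 3)%Z|%N)%:R :> R.
    rewrite {1}(divz_eq w 3) intrD intrM; congr (_ + _).
    by rewrite -{1}(gez0_abs (modz_ge0 w (isT : (3 : int) != 0))).
  have [->|->] := sign_expz k.
    exists (Ordinal (modlt z)), (z %/ 3)%Z => /=.
    by rewrite mul1r [in RHS](modE z); field.
  exists (Ordinal (modlt (- z))), (- (- z %/ 3)%Z) => /=.
  have := modE (- z); rewrite !rmorphN /= => h.
  by rewrite mulN1r -[z%:~R]opprK h; field.
have exac (i : 'I_n) : exists bc : 'I_3 * int,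
    bc.2%:~R + (-1) ^ k * ((bc.1 : nat)%:R / 3%:R) = (j i)%:~R / 3%:R :> R.
  by have [b [c bc]] := exa (j i); exists (b, c).
have [f fE] := choice exac.
pose a : 'I_3 ^ n := [ffun i => (f i).1].
have cubeP z : (forall i, `|z ord0 i - y ord0 i| < r) ->
    forall i, gidx a k z i = (f i).2.
  move=> zy i; rewrite ffunE; apply/eqP; rewrite floor_eq intrD /=.
  have oE : goff a k i = (j i)%:~R / 3%:R - ((f i).2)%:~R.
    by rewrite -fE /goff ffunE addrAC subrr add0r.
  rewrite oE; have /andP[] := floor_itv (3 * (2 ^ k * (y ord0 i - r))).
  rewrite -/(j i) intrD /=.
  have := zy i; rewrite ltr_norml => /andP[z1 z2].
  have k0 : 0 < (2 : R) ^ k by rewrite exprz_gt0.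
  have kr : 2 ^ k * r <= 6^-1.
    by rewrite sideN mulrC ler_pdivrMr// mulrC; lra.
  have z1' : 2 ^ k * (y ord0 i - r) < 2 ^ k * z ord0 i by rewrite ltr_pM2l//; lra.
  have z2' : 2 ^ k * z ord0 i < 2 ^ k * (y ord0 i - r) + 2 * (2 ^ k * r).
    have -> : 2 ^ k * (y ord0 i - r) + 2 * (2 ^ k * r) = 2 ^ k * (y ord0 i + r) by ring.
    by rewrite ltr_pM2l//; lra.
  move: z1' z2' kr; set p := 2 ^ k * (_ - _); set q := 2 ^ k * z _ _; set s := 2 ^ k * r.
  set J := (j i)%:~R; move=> ? ? ? ? ?.
  by apply/andP; split; lra.
have yy i : `|y ord0 i - y ord0 i| < r by rewrite subrr normr0.
exists a, k; split.
  move=> z; rewrite eballE// => zy; rewrite cubeE; apply/ffunP => i.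
  rewrite (cubeP y yy) cubeP// => l; exact: sqdist_coord.
have R0 : 0 < 2 ^+ n.+4 * r by apply: mulr_gt0 => //; exact: exprn_gt0.
move=> z; rewrite cubeE => zy; rewrite (eballE _ _ R0).
have zyb (i : 'I_n) := same_cube_coord i zy.
apply: le_lt_trans (sqdist_le zyb) _.
apply: (@le_lt_trans _ _ (n%:R * (16 * r) ^+ 2)).
  rewrite ler_wpM2l// lerXn2r ?nnegrE ?(ltW s0)//; first by rewrite mulr_ge0// ltW.
  lra.
have -> : (2 ^+ n.+4 * r) ^+ 2 = 4 ^+ n * (16 * r) ^+ 2.
  rewrite [LHS]exprMn -exprM mulnC exprM (_ : 2 ^+ 2 = 4 :> R); last by rewrite -natrX.
  rewrite !exprS expr0; ring.
by rewrite ltr_pM2r ?ltn_4exp// exprn_gt0// mulr_gt0.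
Qed.

(** Generations of a filtration are numbered from [0]; a grid has no coarsest
    generation, so that it is cut at generation [k]. *)
Definition gfilt a k (j : nat) x : int ^ n := gidx a (k + j%:Z) x.

Lemma cell_gfilt a k j x : cell (gfilt a k) j x = cube a (k + j%:Z) x.
Proof. by apply/seteqP; split => y; rewrite cubeE. Qed.

(** An open set is the union of the cells that it contains, and there are only
    countably many cells. *)
Lemma generating_gfilt a k : generating (gfilt a k).
Proof.
pose G := [set B | exists j x, B = cell (gfilt a k) j x].
move=> A; apply: smallest_sub; first exact: smallest_sigma_algebra.
move=> U oU.
have small (x : Rn) : U x -> exists j, cell (gfilt a k) j x `<=` U.
  move=> Ux; have /nbhs_ballP[e e0 eU] : nbhs (x : 'rV[R]_n) U.
    exact: (open_nbhs_nbhs (conj oU Ux)).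
  have [m /andP[me _]] := ex_dyadic_scale e0.
  exists (absz (k + m)) => y; rewrite cell_gfilt cubeE => yx; apply: eU.
  have se : side (k + (absz (k + m))%:Z) < e.
    apply: le_lt_trans me; rewrite /side ler_eXz2l ?ltr1n//.
    by lia.
  split => // i' i; rewrite ord1 /ball /= distrC.
  exact: le_lt_trans (same_cube_coord i yx) se.
pose F (l : nat) : set Rn := [set y | exists j x,
  [/\ pickle (j, gfilt a k j x) = l, cell (gfilt a k) j x `<=` U &
      cell (gfilt a k) j x y]].
have UF : U = \bigcup_l F l.
  apply/seteqP; split => [x Ux|x [l _ [j [y [_ +]]]]]; last exact.
  have [j jU] := small x Ux.
  by exists (pickle (j, gfilt a k j x)) => //; exists j, x.
have [s0 _ sU] := @smallest_sigma_algebra Rn setT G.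
rewrite UF; apply: sU => l.
have [[j [x [jl jU]]]|nF] :=
    pselect (exists j x, pickle (j, gfilt a k j x) = l /\ cell (gfilt a k) j x `<=` U).
  have -> : F l = cell (gfilt a k) j x.
    apply/seteqP; split => [y [j' [x' [jl' _ +]]]|y yx]; last by exists j, x.
    have [jj' xx'] : (j', gfilt a k j' x') = (j, gfilt a k j x).
      by apply: (pcan_inj pickleK); rewrite jl jl'.
    by rewrite /cell /= -xx' jj'.
  by apply: sub_sigma_algebra; exists j, x.
suff -> : F l = set0 by [].
apply/seteqP; split => // y [j [x [jl jU _]]]; apply: nF.
by exists j, x.
Qed.

End Grids.

(** * Doubling measures *)

Section DoublingGeometry.
Context {R : realType} {n : nat}.
Local Notation Rn := (Rn R n).
Variable mu : {measure set Rn -> \bar R}.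
Implicit Types (a : 'I_3 ^ n) (k : int) (x y z : Rn).

Lemma doubling_bound_ge1 (C : R) : doubling mu -> doubling_bound mu C -> 1 <= C.
Proof.
move=> [ball0 _] dC; have x : Rn := 0.
have /andP[m0 moo] := ball0 x 1 ltr01.
have := dC x 1 ltr01; rewrite mulr1 => h.
have sub : (mu (eball x 1) <= mu (eball x 2))%E.
  by apply: le_measure; rewrite ?inE; [exact: measurable_eball..|apply: eball_sub; rewrite ler1n].
have := le_trans sub h; have mf : mu (eball x 1) \is a fin_num by rewrite ge0_fin_numE.
rewrite -(fineK mf) -EFinM lee_fin -{1}[fine _]mul1r ler_pM2r//.
by rewrite fine_gt0// m0.
Qed.

(** The [1] spares the question whether the infimum of the doubling constants is
    one of them; the bound depends on the doubling dimension only. *)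
Lemma doubling_bound_dim : doubling mu ->
  doubling_bound mu (2 `^ doubling_dim mu + 1).
Proof.
move=> dmu; have [ball0 [C0 dC0]] := dmu.
set S := [set C : R | doubling_bound mu C].
have hS : has_inf S.
  split; first by exists C0.
  by exists 1 => C /= /(doubling_bound_ge1 dmu).
have i1 : 1 <= inf S.
  by apply: lb_le_inf; [case: hS|move=> C /= /(doubling_bound_ge1 dmu)].
have -> : 2 `^ doubling_dim mu = inf S.
  rewrite /doubling_dim -/S /powR pnatr_eq0 /= divfK ?gt_eqF ?ln_gt0 ?ltr1n//.
  by rewrite lnK// posrE (lt_le_trans ltr01).
have [C /= dC CS] := inf_adherent ltr01 hS.
move=> x r r0; apply: le_trans (dC x r r0) _.
by rewrite lee_wpmul2r// lee_fin ltW.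
Qed.

Variable C : R.
Hypothesis dmu : doubling mu.
Hypothesis dC : doubling_bound mu C.

Let C1 : 1 <= C. Proof. exact: doubling_bound_ge1. Qed.
Let C0 : 0 < C. Proof. exact: lt_le_trans C1. Qed.

Lemma mu_eball x (r : R) : 0 < r -> (0 < mu (eball x r) < +oo)%E.
Proof. by move: x r; case: dmu. Qed.

Lemma mu_eball_pow x (r : R) j : 0 < r ->
  (mu (eball x (2 ^+ j * r)) <= (C ^+ j)%:E * mu (eball x r))%E.
Proof.
move=> r0; elim: j => [|j IH]; first by rewrite !expr0 mul1r mul1e.
rewrite !exprS -mulrA EFinM -muleA.
apply: le_trans (dC x (r := 2 ^+ j * r) _) _; first by rewrite mulr_gt0// exprn_gt0.
by rewrite lee_wpmul2l// lee_fin ltW.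
Qed.

Lemma measurable_cube a k x : measurable (cube a k x).
Proof.
have -> : cube a k x = \bigcap_(i in [set: 'I_n])
    ((fun y : Rn => y ord0 i : R) @^-1`
      [set` `[2%:R ^ (- k) * ((gidx a k x i)%:~R + goff a k i),
              2%:R ^ (- k) * ((gidx a k x i)%:~R + goff a k i + 1)[ ]).
  apply/seteqP; split => y H.
    by move=> i _; rewrite /= in_itv /=; exact: (H i).
  by move=> i; have := H i Logic.I; rewrite /= in_itv.
apply: fin_bigcap_measurable.
  exact: finite_finset.
by move=> i _; rewrite -[X in measurable X]setTI; apply: measurable_coord.
Qed.

Lemma eball_sub_cube a k x : eball (ctr a k x) (side k / 2) `<=` cube a k x.
Proof.
have s2 : 0 < side k / 2 :> R by rewrite divr_gt0// side_gt0.
move=> y; rewrite eballE// => yx; rewrite cubeE; apply: ctr_cube => i.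
exact: sqdist_coord.
Qed.

Let mball := @measurable_eball R n.

Lemma mu_qball a k x :
  (mu (qball a k x) <= (C ^+ n.+2)%:E * mu (cube a k x))%E.
Proof.
have s2 : 0 < side k / 2 :> R by rewrite divr_gt0// side_gt0.
apply: le_trans (mu_eball_pow _ _ s2) _.
rewrite lee_wpmul2l// ?lee_fin ?exprn_ge0 ?(ltW C0)//.
apply: le_measure; rewrite ?inE; [exact: mball|exact: measurable_cube|].
exact: eball_sub_cube.
Qed.

Lemma measurable_qball a k x : measurable (qball a k x).
Proof. by apply: mball; exact: qball_radius_gt0. Qed.

Lemma mu_cube a k x : (0 < mu (cube a k x) < +oo)%E.
Proof.
have s2 : 0 < side k / 2 :> R by rewrite divr_gt0// side_gt0.
apply/andP; split.
  have /andP[m0 _] := mu_eball (ctr a k x) s2.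
  apply: lt_le_trans m0 _; apply: le_measure; rewrite ?inE.
  - exact: mball.
  - exact: measurable_cube.
  - exact: eball_sub_cube.
have /andP[_] := mu_eball (ctr a k x) (@qball_radius_gt0 R n k).
apply: le_lt_trans; apply: le_measure; rewrite ?inE.
- exact: measurable_cube.
- exact: measurable_qball.
- exact: cube_qball.
Qed.

Lemma mu_parent a k x :
  (mu (cube a k x) <= (C ^+ n.+2)%:E * mu (cube a (k + 1) x))%E.
Proof.
apply: le_trans (mu_qball a (k + 1) x); apply: le_measure; rewrite ?inE.
- exact: measurable_cube.
- exact: measurable_qball.
- exact: parent_qball.
Qed.

Lemma eball_dyadic y (r : R) : 0 < r -> exists Q : set Rn,
  [/\ dyadic Q, eball y r `<=` Q & (mu Q <= (C ^+ n.+4)%:E * mu (eball y r))%E].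
Proof.
move=> r0; have [a [k [sub1 sub2]]] := eball_cube y r0.
exists (cube a k y); split => //; first exact: dyadic_cube_dyadic.
apply: le_trans (mu_eball_pow _ _ r0); apply: le_measure; rewrite ?inE//.
- exact: measurable_cube.
- by apply: mball; apply: mulr_gt0 => //; exact: exprn_gt0.
Qed.

Lemma measurable_dyadic (Q : set Rn) : dyadic Q -> measurable Q.
Proof. by move=> /ex_dyadic[a [k [x ->]]]; exact: measurable_cube. Qed.

Lemma mu_dyadic (Q : set Rn) : dyadic Q -> (0 < mu Q < +oo)%E.
Proof. by move=> /ex_dyadic[a [k [x ->]]]; exact: mu_cube. Qed.

Lemma filtration_gfilt a k : filtration mu (gfilt a k).
Proof.
split => [j x|j x y|j x]; rewrite ?cell_gfilt.
- exact: measurable_cube.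
- by rewrite /gfilt -addn1 PoszD addrA => /gidx_refine.
- exact: mu_cube.
Qed.

End DoublingGeometry.

(** * Weights of class A1 *)

Section AlmostEverywhere.
Context d {T : measurableType d} {R : realType}.
Variable mu : {measure set T -> \bar R}.

Lemma ae_exists (D : set T) (P : T -> Prop) : measurable D -> (0 < mu D)%E ->
  {ae mu, forall x, D x -> P x} -> exists2 x, D x & P x.
Proof.
move=> mD D0 [N [mN N0 DN]]; apply: contrapT => nP.
have DN' : D `<=` N.
  move=> x Dx; apply: DN => /= DP; apply: nP; exists x => //; exact: DP.
by move: D0; apply/negP; rewrite -leNgt -N0 le_measure ?inE.
Qed.

Lemma ge0_integral_gt0 (D : set T) (f : T -> R) : measurable D -> (0 < mu D)%E ->
  measurable_fun [set: T] f -> (forall x, 0 < f x) ->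
  (0 < \int[mu]_(x in D) (f x)%:E)%E.
Proof.
move=> mD D0 mf f0; rewrite lt_neqAle eq_sym integral_ge0 ?andbT; last first.
  by move=> x _; rewrite lee_fin ltW.
apply/eqP => If0.
have : ae_eq mu D (EFin \o f) (cst 0%E).
  apply/ae_eq_integral_abs => //.
    by apply: measurable_funTS; exact/measurable_EFinP.
  rewrite -If0; apply: eq_integral => x _ /=.
  by rewrite ger0_norm// ltW.
move=> /(ae_exists mD D0)[x Dx] /= [fx0].
by have := f0 x; rewrite fx0 ltxx.
Qed.

End AlmostEverywhere.

Section MuckenhouptWeights.
Context {R : realType} {n : nat}.
Local Notation Rn := (Rn R n).
Variables (mu : {measure set Rn -> \bar R}) (C : R).
Hypothesis dmu : doubling mu.
Hypothesis dC : doubling_bound mu C.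
Implicit Types (w v f : Rn -> R) (Q : set Rn) (x y z : Rn).

Lemma open_eball x (r : R) : 0 < r -> open (eball x r : set 'rV[R]_n).
Proof.
move=> r0.
have -> : eball x r = (fun y : 'rV[R]_n => sqdist x y) @^-1` `]-oo, r ^+ 2[.
  by apply/seteqP; split => y; rewrite eballE// /= in_itv.
have /continuousP : continuous (fun y : 'rV[R]_n => sqdist x y).
  apply: continuous_big; first exact: add_continuous.
  move=> i _ y.
  have h : {for y, continuous (fun y : 'rV[R]_n => y ord0 i - x ord0 i)}.
    apply: continuousB; last exact: cst_continuous.
    exact: coord_continuous.
  exact: (continuous_comp h (@exprn_continuous R 2 _)).
by apply; exact: interval_open.
Qed.

(** The maximal function over open balls is lower semicontinuous: its superlevel
    sets are unions of balls. *)
Lemma measurable_maximal f : measurable_fun [set: Rn] (maximal mu f).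
Proof.
apply: (measurability _ (ErealGenOInfty.measurableE R)).
move=> _ [_ [c ->] <-]; rewrite setTI; apply: sub_sigma_algebra.
have -> : maximal mu f @^-1` `]c%:E, +oo[ =
    \bigcup_(yr in [set yr : Rn * R | 0 < yr.2 /\
      (c%:E < avg mu 1 (eball yr.1 yr.2) f)%E]) eball yr.1 yr.2.
  apply/seteqP; split => x.
    rewrite /= in_itv /= andbT => /ereal_sup_gt[_ [y [r [r0 yx ->]]] cr].
    by exists (y, r).
  move=> [[y r] /= [r0 cr] yx]; rewrite in_itv /= andbT.
  apply: lt_le_trans cr _; apply: ereal_sup_ubound.
  by exists y, r.
by apply: bigcup_open => -[y r] [r0 _]; exact: open_eball.
Qed.

Lemma maximal_ge0 f x : (0 <= maximal mu f x)%E.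
Proof.
apply: le_ereal_sup_tmp; exists (avg mu 1 (eball x 1) f); last exact: poweR_ge0.
exists x, 1; split => //; rewrite eballE// /sqdist big1 ?expr1n// => i _.
by rewrite subrr expr0n.
Qed.

Lemma avg1E Q f : measurable Q ->
  avg mu 1 Q f = ((mu Q)^-1 * \int[mu]_(x in Q) `|f x|%:E)%E.
Proof.
move=> mQ; rewrite /avg invr1 poweRe1.
  by congr (_ * _)%E; apply: eq_integral => x _; rewrite powRr1.
by rewrite mule_ge0 ?inve_ge0// integral_ge0// => x _; rewrite lee_fin powR_ge0.
Qed.

Lemma le_avg1 Q f (b : R) : measurable Q -> (0 < mu Q < +oo)%E ->
  (\int[mu]_(x in Q) `|f x|%:E <= b%:E * mu Q)%E -> (avg mu 1 Q f <= b%:E)%E.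
Proof.
move=> mQ /andP[Q0 Qoo] H; rewrite avg1E//.
have Qf : mu Q \is a fin_num by rewrite ge0_fin_numE.
move: H; rewrite -(fineK Qf); set m := fine _.
have m0 : 0 < m by rewrite fine_gt0// Q0.
by rewrite inver gt_eqF// lee_pdivrMl// muleC.
Qed.

Section Dyadic.
Let mdy := measurable_dyadic (R := R) (n := n).
Let mudy := mu_dyadic dmu.

Lemma weight_ge0 w : weight w -> forall x, 0 <= w x.
Proof. by move=> [_ w0] x; exact: ltW. Qed.

Lemma weight_integral_gt0 w Q : weight w -> dyadic Q ->
  (0 < \int[mu]_(x in Q) (w x)%:E)%E.
Proof.
move=> [mw w0] dQ; apply: ge0_integral_gt0 => //; first exact: mdy.
by have /andP[] := mudy dQ.
Qed.

Lemma avg1_weightE w Q : weight w -> dyadic Q ->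
  avg mu 1 Q w = ((mu Q)^-1 * \int[mu]_(x in Q) (w x)%:E)%E.
Proof.
move=> ww dQ; rewrite avg1E; last exact: mdy.
by congr (_ * _)%E; apply: eq_integral => x _; rewrite ger0_norm// weight_ge0.
Qed.

Lemma ess_inf_onP w Q (c : \bar R) :
  (c <= ess_inf_on mu Q w)%E <-> {ae mu, forall x, Q x -> (c <= (w x)%:E)%E}.
Proof.
rewrite /ess_inf_on; split.
  move=> /ess_infP; apply: filterS => x + Qx.
  by rewrite /patch mem_set.
move=> H; apply/ess_infP; apply: filterS H => x H.
rewrite /patch; case: ifPn; last by move=> _; exact: leey.
by rewrite inE => /H.
Qed.

(** Finiteness of [A1_const] excludes the degenerate values of the quotient in
    its definition, so that on every cube the essential infimum [c] is positive
    and finite. *)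
Lemma A1_cube w Q : A1 mu w -> dyadic Q -> exists c : R,
  [/\ 0 < c, {ae mu, forall x, Q x -> c <= w x} &
      (\int[mu]_(x in Q) (w x)%:E <= (fine (A1_const mu w) * c)%:E * mu Q)%E].
Proof.
move=> [ww Aoo] dQ; have mQ := mdy dQ; have /andP[Q0 Qoo] := mudy dQ.
have [mw w0] := ww; have w00 := weight_ge0 ww.
have AQ : (avg mu 1 Q w * (ess_inf_on mu Q w)^-1 <= A1_const mu w)%E.
  by apply: ereal_sup_ubound; exists Q.
have c0 : (0 <= ess_inf_on mu Q w)%E.
  by apply/ess_inf_onP; apply: aeW => x _; rewrite lee_fin.
have /ess_inf_onP cw := lexx (ess_inf_on mu Q w).
have coo : (ess_inf_on mu Q w < +oo)%E.
  have [x Qx cx] := ae_exists mQ Q0 cw.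
  by apply: le_lt_trans cx _; rewrite ltry.
have Qf : mu Q \is a fin_num by rewrite ge0_fin_numE.
have m0 : 0 < fine (mu Q) by rewrite fine_gt0// Q0.
have I0 := weight_integral_gt0 ww dQ.
have a0 : (0 < avg mu 1 Q w)%E.
  rewrite avg1_weightE// -(fineK Qf) inver gt_eqF// mule_gt0// lte_fin.
  by rewrite invr_gt0.
set a := avg mu 1 Q w in AQ a0 *.
move: c0 coo cw AQ; case: (ess_inf_on mu Q w) => [c| |]//.
rewrite lee_fin => c0 _ cw AQ.
have cN0 : c != 0.
  apply: contraTneq Aoo => cE; rewrite -leNgt; apply: le_trans AQ.
  by rewrite cE inve0 gt0_muley.
have cgt0 : 0 < c by rewrite lt_neqAle eq_sym cN0.
have A0 : (0 <= A1_const mu w)%E.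
  by apply: le_trans AQ; rewrite mule_ge0 ?(ltW a0)// inve_ge0 lee_fin.
have Af : A1_const mu w \is a fin_num by rewrite ge0_fin_numE.
exists c; split => //.
move: AQ; rewrite inver (negbTE cN0) -(fineK Af) muleC lee_pdivrMl//.
rewrite /a avg1_weightE// -(fineK Qf) inver gt_eqF// lee_pdivrMl//.
by rewrite muleC mulrC EFinM.
Qed.

Lemma A1_const_ge1 w : A1 mu w -> 1 <= fine (A1_const mu w).
Proof.
move=> aw; pose K := cube (R := R) [ffun=> ord0] 0 (0 : Rn).
have dK : dyadic K by exact: dyadic_cube_dyadic.
have mQ := mdy dK; have /andP[Q0 Qoo] := mudy dK.
have [c [c0 cw H]] := A1_cube aw dK; have [[mw w0] _] := aw.
have Qf : mu K \is a fin_num by rewrite ge0_fin_numE.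
have : (c%:E * mu K <=
    \int[mu]_(x in K) (w x)%:E)%E.
  rewrite -integral_cst//; apply: ae_ge0_le_integral => //.
  - by move=> x _ /=; rewrite lee_fin ltW.
  - by move=> x _; rewrite lee_fin ltW.
  - by apply: measurable_funTS; exact/measurable_EFinP.
move=> /le_trans/(_ H); rewrite -(fineK Qf) -!EFinM lee_fin.
by rewrite ler_pM2r ?fine_gt0 ?Q0// ler_pMl.
Qed.

Lemma le_A1_const w (B : R) : weight w -> (forall Q, dyadic Q -> exists c : R,
  [/\ 0 < c, {ae mu, forall x, Q x -> c <= w x} &
      (\int[mu]_(x in Q) (w x)%:E <= (B * c)%:E * mu Q)%E]) ->
  (A1_const mu w <= B%:E)%E.
Proof.
move=> ww H; apply: ge_ereal_sup => _ [Q dQ <-].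
have [c [c0 cw Qc]] := H Q dQ; have mQ := mdy dQ; have Qmu := mudy dQ.
have h1 : (avg mu 1 Q w <= (B * c)%:E)%E.
  apply: le_avg1 => //; apply: le_trans Qc; rewrite le_eqVlt; apply/orP; left.
  by apply/eqP/eq_integral => x _; rewrite ger0_norm// weight_ge0.
have h2 : (c%:E <= ess_inf_on mu Q w)%E by apply/ess_inf_onP.
have h3 : ((ess_inf_on mu Q w)^-1 <= (c^-1)%:E)%E.
  have -> : (c^-1)%:E = (c%:E)^-1%E by rewrite inver gt_eqF.
  rewrite lee_pV2// inE ?lee_fin ?ltW//.
  by apply: lt_le_trans h2; rewrite lte_fin.
apply: (@le_trans _ _ ((B * c)%:E * (c^-1)%:E)%E).
  apply: lee_pmul => //; first exact: poweR_ge0.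
  by rewrite inve_ge0; apply: le_trans h2; rewrite lee_fin ltW.
by rewrite -EFinM mulfK// gt_eqF.
Qed.

(** There are countably many dyadic cubes. *)
Lemma ae_dyadic (P : set Rn -> Rn -> Prop) :
  (forall Q, dyadic Q -> {ae mu, forall x, Q x -> P Q x}) ->
  {ae mu, forall x Q, dyadic Q -> Q x -> P Q x}.
Proof.
move=> H.
pose Qc (t : 'I_3 ^ n * int * int ^ n) : set Rn := dyadic_cube t.1.1 t.1.2 t.2.
have dQ t : dyadic (Qc t) by exists t.1.1 => //; exists t.1.2, t.2.
pose N (i : nat) : set Rn := if unpickle i is Some t then
  ~` [set x | Qc t x -> P (Qc t) x] else set0.
apply: (@negligibleS _ _ _ _ (\bigcup_i N i)).
  move=> x /= /existsNP[Q /not_implyP[[a _ [k [m QE]]] /not_implyP[Qx nP]]].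
  exists (pickle (a, k, m)) => //; rewrite /N pickleK /Qc /= => /(_ _) h.
  by apply: nP; rewrite QE; apply: h; rewrite -QE.
apply: negligible_bigcup => i; rewrite /N.
case: unpickle => [t|]; last exact: negligible_set0.
exact: H (dQ t).
Qed.

End Dyadic.

End MuckenhouptWeights.

(** * A1 weights and their duals are in Ainf *)

Section AinfWeights.
Context {R : realType} {n : nat}.
Local Notation Rn := (Rn R n).
Variables (mu : {measure set Rn -> \bar R}) (C : R).
Hypothesis dmu : doubling mu.
Hypothesis dC : doubling_bound mu C.
Implicit Types (w v f : Rn -> R) (Q : set Rn) (x y z : Rn).

Let mdy := measurable_dyadic (R := R) (n := n).
Let mudy := mu_dyadic dmu.
Let mball := @measurable_eball R n.
Let E : R := C ^+ n.+4.
Let C1 : 1 <= C. Proof. exact: (doubling_bound_ge1 dmu dC). Qed.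
Let E1 : 1 <= E. Proof. exact: exprn_ege1. Qed.
Let E0 : 0 < E. Proof. exact: lt_le_trans E1. Qed.

Lemma measurable_restr f (B : set Rn) : measurable B -> measurable_fun [set: Rn] f ->
  measurable_fun [set: Rn] (f \_ B).
Proof.
move=> mB mf; apply/(measurable_restrictT _ _).1 => //.
exact: measurable_funTS.
Qed.

Lemma weight_ball_integral v y (r : R) : A1 mu v -> 0 < r ->
  (0 < wmeas mu v (eball y r) < +oo)%E.
Proof.
move=> av r0; have [[mv v0] _] := av; apply/andP; split.
  apply: ge0_integral_gt0 => //; first exact: mball.
  by have /andP[] := mu_eball dmu y r0.
have [Q [dQ BQ _]] := eball_dyadic dmu dC y r0.
have [c [c0 _ H]] := A1_cube dmu av dQ.
apply: (@le_lt_trans _ _ (\int[mu]_(x in Q) (v x)%:E)%E).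
  apply: ge0_subset_integral => //; [exact: mball|exact: mdy|..].
    by apply: measurable_funTS; exact/measurable_EFinP.
  by move=> x _; rewrite lee_fin ltW.
apply: le_lt_trans H _; have /andP[m0 moo] := mudy dQ.
by rewrite -(@fineK _ (mu Q)) ?ge0_fin_numE// -?EFinM ?ltry// ltW.
Qed.

Lemma maximal_le f x (b : R) : (forall y r, 0 < r -> eball y r x ->
    (\int[mu]_(z in eball y r) `|f z|%:E <= b%:E * mu (eball y r))%E) ->
  (maximal mu f x <= b%:E)%E.
Proof.
move=> H; apply: ge_ereal_sup => _ [y [r [r0 yx ->]]].
by apply: le_avg1; [exact: mball|exact: mu_eball|exact: H].
Qed.

Lemma eratio_le (x y : \bar R) (b : R) : (0 < y < +oo)%E ->
  (x <= b%:E * y)%E = (eratio x y <= b%:E)%E.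
Proof.
move=> /andP[y0 yoo]; rewrite /eratio lt_eqF//.
have yf : y \is a fin_num by rewrite ge0_fin_numE// ltW.
have y0' : 0 < fine y by rewrite fine_gt0// y0.
rewrite -(fineK yf) inver gt_eqF// muleC [in RHS]muleC.
by rewrite lee_pdivrMl.
Qed.

Lemma le_Ainf_const v (b : R) :
  (forall y r, 0 < r -> (0 < wmeas mu v (eball y r) < +oo)%E /\
    (\int[mu]_(x in eball y r) maximal mu (v \_ (eball y r)) x <=
      b%:E * wmeas mu v (eball y r))%E) ->
  (Ainf_const mu v <= b%:E)%E.
Proof.
move=> H; apply: ge_ereal_sup => _ [y [r [r0 ->]]].
by have [v0 h] := H y r r0; rewrite -eratio_le.
Qed.

Lemma le_integral_restr v (A B : set Rn) : weight v -> measurable A -> measurable B ->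
  (\int[mu]_(z in A) `|(v \_ B) z|%:E <= \int[mu]_(z in A) (v z)%:E)%E.
Proof.
move=> [mv v0] mA mB; apply: ge0_le_integral => //.
- apply: measurable_funTS; apply/measurable_EFinP; apply: measurableT_comp => //.
  exact: measurable_restr.
- by apply: measurable_funTS; exact/measurable_EFinP.
- move=> z _; rewrite lee_fin patchE; case: ifPn => _; last by rewrite normr0 ltW.
  by rewrite ger0_norm// ltW.
Qed.

(** Almost every point satisfies the A1 inequality for all of the countably many
    dyadic cubes that contain it, and every ball lies in a dyadic cube of
    comparable measure. *)
Lemma maximal_A1 v (B : set Rn) : A1 mu v -> measurable B ->
  {ae mu, forall x, (maximal mu (v \_ B) x <= (E * fine (A1_const mu v) * v x)%:E)%E}.
Proof.
move=> av mB; have [wv _] := av; have [mv v0] := wv.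
have Ac1 := A1_const_ge1 dmu av.
pose P (Q : set Rn) x := (\int[mu]_(z in Q) (v z)%:E <=
  (fine (A1_const mu v) * v x)%:E * mu Q)%E.
have /ae_dyadic : forall Q, dyadic Q -> {ae mu, forall x, Q x -> P Q x}.
  move=> Q dQ; have [c [c0 cv H]] := A1_cube dmu av dQ.
  apply: filterS cv => x + Qx => /(_ Qx) cx; apply: le_trans H _.
  by rewrite lee_wpmul2r// lee_fin ler_wpM2l// (le_trans ler01).
apply: filterS => x H; apply: maximal_le => y r r0 yx.
have [Q [dQ BQ QB]] := eball_dyadic dmu dC y r0.
have HB := le_integral_restr wv (mball y r0) mB.
apply: le_trans HB _.
apply: (@le_trans _ _ (\int[mu]_(z in Q) (v z)%:E)%E).
  apply: ge0_subset_integral => //; [exact: mball|exact: mdy|..].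
    by apply: measurable_funTS; exact/measurable_EFinP.
  by move=> z _; rewrite lee_fin ltW.
have := H Q dQ (BQ _ yx); rewrite /P => HQ; apply: le_trans HQ _.
rewrite -[E * _ * _]mulrA [in leRHS]mulrC [in leRHS]EFinM -muleA lee_wpmul2l//.
by rewrite lee_fin mulr_ge0 ?(ltW (v0 _))// (le_trans ler01).
Qed.

Lemma Ainf_le_A1 v : A1 mu v -> (Ainf_const mu v <= (E * fine (A1_const mu v))%:E)%E.
Proof.
move=> av; have [wv _] := av; have [mv v0] := wv.
apply: le_Ainf_const => y r r0; split; first exact: weight_ball_integral.
have mB := mball y r0.
have Ac1 := A1_const_ge1 dmu av.
have EA : 0 <= E * fine (A1_const mu v) by rewrite mulr_ge0 ?ltW// (lt_le_trans ltr01).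
rewrite /wmeas -ge0_integralZl//; last 2 first.
- by apply: measurable_funTS; exact/measurable_EFinP.
- by move=> x _; rewrite lee_fin ltW.
apply: ae_ge0_le_integral => //.
- by move=> x _; exact: maximal_ge0.
- by apply: measurable_funTS; exact: measurable_maximal.
- by move=> x _; rewrite -EFinM lee_fin mulr_ge0// ltW.
- apply: measurable_funTS; apply: measurable_funeM; exact/measurable_EFinP.
by apply: filterS (maximal_A1 av mB) => x H _; rewrite -EFinM.
Qed.

Lemma A1_Ainf v : A1 mu v -> Ainf mu v.
Proof.
move=> av; split; first by case: av.
by apply: le_lt_trans (Ainf_le_A1 av) _; rewrite ltry.
Qed.

Lemma Ainf_ball v y (r : R) : A1 mu v -> 0 < r ->
  (\int[mu]_(x in eball y r) maximal mu (v \_ (eball y r)) x <=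
   (fine (Ainf_const mu v))%:E * wmeas mu v (eball y r))%E.
Proof.
move=> av r0; rewrite eratio_le; last exact: weight_ball_integral.
have Aoo := (A1_Ainf av).2.
have H : (eratio (\int[mu]_(x in eball y r) maximal mu (v \_ (eball y r)) x)
   (wmeas mu v (eball y r)) <= Ainf_const mu v)%E.
  by apply: ereal_sup_ubound; exists y, r.
rewrite fineK//; rewrite ge0_fin_numE//; apply: le_trans H.
have /andP[v0 voo] := weight_ball_integral y av r0.
rewrite /eratio lt_eqF// mule_ge0 ?inve_ge0 ?(ltW v0)//.
by apply: integral_ge0 => x _; exact: maximal_ge0.
Qed.

Lemma Ainf_const_ge1 v : A1 mu v -> 1 <= fine (Ainf_const mu v).
Proof.
move=> av; have [[mv v0] _] := av.
have H := Ainf_ball (0 : Rn) av ltr01.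
have vB := weight_ball_integral (0 : Rn) av ltr01.
set B := eball _ _ in H vB; have mB : measurable B by exact: mball.
have Bmu := mu_eball dmu (0 : Rn) ltr01; rewrite -/B in Bmu.
have /andP[vB0 vBoo] := vB; have /andP[B0 Boo] := Bmu.
have vf : wmeas mu v B \is a fin_num by rewrite ge0_fin_numE// ltW.
have Bf : mu B \is a fin_num by rewrite ge0_fin_numE// ltW.
have : (wmeas mu v B <= \int[mu]_(x in B) maximal mu (v \_ B) x)%E.
  have avgE : avg mu 1 B (v \_ B) = ((mu B)^-1 * wmeas mu v B)%E.
    rewrite avg1E//; congr (_ * _)%E; apply: eq_integral => x xB.
    by rewrite patchE xB ger0_norm// ltW.
  have -> : wmeas mu v B = (\int[mu]_(x in B) (cst (avg mu 1 B (v \_ B)) x))%E.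
    rewrite integral_cst// avgE -(fineK Bf) inver gt_eqF ?fine_gt0 ?B0//.
    by rewrite muleAC -EFinM mulVf ?mul1e// gt_eqF// fine_gt0// B0.
  apply: ge0_le_integral => //.
  - by move=> x _; exact: poweR_ge0.
  - by apply: measurable_funTS; exact: measurable_maximal.
  - move=> x Bx; apply: ereal_sup_ubound.
    by exists 0, 1.
move=> /le_trans/(_ H); rewrite -(fineK vf) -EFinM lee_fin.
by rewrite ler_pMl// fine_gt0// vB0.
Qed.

(** The dual weight is in [Ainf]: on a cube, an [A1] weight is bounded below by a
    multiple of its average, so its negative powers are bounded above by a
    multiple of theirs. *)
Lemma A1_dual_Ainf w (p : R) : 1 < p -> A1 mu w ->
  Ainf mu (fun x => w x `^ (- (p - 1)^-1)).
Proof.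
move=> p1 aw; have [[mw w0] _] := aw.
have p0 : 0 < p := lt_trans ltr01 p1.
have pB : 0 < p - 1 by rewrite subr_gt0.
set t := (p - 1)^-1; have t0 : 0 < t by rewrite invr_gt0.
set s := fun x => w x `^ (- t).
have s0 x : 0 < s x by exact: powR_gt0.
have ms : measurable_fun setT s by exact: measurable_powRr.
have ws : weight s by [].
set A := fine (A1_const mu w).
have Ac1 : 1 <= A := A1_const_ge1 dmu aw.
split=> //; apply: (@le_lt_trans _ _ ((A * E) `^ t)%:E); last by rewrite ltry.
apply: le_Ainf_const => y r r0; have mB := mball y r0.
set B := eball y r in mB *.
have [Q [dQ BQ QB]] := eball_dyadic dmu dC y r0; have mQ := mdy dQ.
rewrite -/B in BQ QB.
have [c [c0 cw Hc]] := A1_cube dmu aw dQ.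
have /andP[B0 Boo] : (0 < mu B < +oo)%E by exact: mu_eball.
have Bf : mu B \is a fin_num by rewrite ge0_fin_numE// ltW.
have sc : {ae mu, forall x, B x -> s x <= c `^ (- t)}.
  apply: filterS cw => x + Bx => /(_ (BQ _ Bx)) cx.
  rewrite /s !powRN lef_pV2 ?posrE ?powR_gt0// ler_powR2// ltW//.
have sI0 : (0 < wmeas mu s B)%E by apply: ge0_integral_gt0.
have mEs : measurable_fun setT (fun x => (s x)%:E) by exact/measurable_EFinP.
have mEw : measurable_fun setT (fun x => (w x)%:E) by exact/measurable_EFinP.
have sIle : (wmeas mu s B <= (c `^ (- t))%:E * mu B)%E.
  rewrite -integral_cst//; apply: ae_ge0_le_integral => //.
  - by move=> x _; rewrite lee_fin ltW.
  - exact: measurable_funTS.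
  - by move=> x _; rewrite /= lee_fin powR_ge0.
have sIoo : (wmeas mu s B < +oo)%E.
  by apply: le_lt_trans sIle _; rewrite -(fineK Bf) -EFinM ltry.
split; first by rewrite sI0.
have maxle x : (maximal mu (s \_ B) x <= (c `^ (- t))%:E)%E.
  apply: maximal_le => y' r' r'0 _; rewrite -integral_cst; last exact: mball.
  apply: ae_ge0_le_integral => //.
  - exact: mball.
  - apply: measurable_funTS; apply/measurable_EFinP; apply: measurableT_comp => //.
    exact: measurable_restr.
  - by move=> z _; rewrite /= lee_fin powR_ge0.
  apply: filterS sc => z H _; rewrite /= lee_fin patchE; case: ifPn => zB.
    by rewrite ger0_norm ?(ltW (s0 _))// H//; rewrite inE in zB.
  by rewrite normr0 powR_ge0.
apply: (@le_trans _ _ ((c `^ (- t))%:E * mu B)%E).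
  rewrite -integral_cst//; apply: ge0_le_integral => //.
  - by move=> x _; exact: maximal_ge0.
  - by apply: measurable_funTS; exact: measurable_maximal.
(* Hoelder's inequality for 1 = w^(1/p) w^(-1/p) bounds the average of the dual
   weight from below by a negative power of the average of [w]. *)
pose q := p / (p - 1).
have q0 : 0 < q by rewrite divr_gt0.
have pq : p^-1 + q^-1 = 1 by rewrite /q; field; rewrite !gt_eqF.
have := hoelder_ge0 mu mB (measurable_powRr p^-1 mw) (measurable_powRr (- p^-1) mw)
  (fun=> powR_ge0 _ _) (fun=> powR_ge0 _ _) p0 q0 pq.
have -> : (\int[mu]_(x in B) (w x `^ p^-1 * w x `^ (- p^-1))%:E = mu B)%E.
  rewrite -[RHS]mul1e -integral_cst//; apply: eq_integral => x _.
  by rewrite powRN divff// gt_eqF// powR_gt0.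
have -> : (\int[mu]_(x in B) ((w x `^ p^-1) `^ p)%:E = \int[mu]_(x in B) (w x)%:E)%E.
  by apply: eq_integral => x _; rewrite -powRrM mulVf ?powRr1 ?gt_eqF// ltW.
have -> : (\int[mu]_(x in B) ((w x `^ (- p^-1)) `^ q)%:E = wmeas mu s B)%E.
  apply: eq_integral => x _; rewrite -powRrM /s; congr (_ `^ _)%:E.
  by rewrite /q /t; field; rewrite !gt_eqF.
have wI : (\int[mu]_(x in B) (w x)%:E <= (A * c * E)%:E * mu B)%E.
  apply: (@le_trans _ _ (\int[mu]_(x in Q) (w x)%:E)%E).
    apply: ge0_subset_integral => //; first exact: measurable_funTS.
    by move=> x _; rewrite lee_fin ltW.
  apply: le_trans Hc _; rewrite [in leRHS]EFinM -muleA lee_wpmul2l//.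
  by rewrite lee_fin mulr_ge0 ?(ltW c0)// (le_trans ler01).
have sf : wmeas mu s B \is a fin_num by rewrite ge0_fin_numE// ltW.
have wI0 : (0 <= \int[mu]_(x in B) (w x)%:E)%E.
  by apply: integral_ge0 => x _; rewrite lee_fin ltW.
have wf : (\int[mu]_(x in B) (w x)%:E)%E \is a fin_num.
  rewrite ge0_fin_numE//; apply: le_lt_trans wI _.
  by rewrite -(fineK Bf) -EFinM ltry.
move: wI wI0 sI0; rewrite -(fineK Bf) -(fineK sf) -(fineK wf) !poweR_EFin.
rewrite -!EFinM !lee_fin lte_fin.
have m0 : 0 < fine (mu B) by rewrite fine_gt0// B0.
set m := fine (mu B) in m0 *; set S := fine (wmeas mu s B).
set W := fine (\int[mu]_(x in B) _)%E => wI W0 S0 H.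
have A0 : 0 <= A := le_trans ler01 Ac1.
have Ac0 : 0 <= A * c * E * m :=
  mulr_ge0 (mulr_ge0 (mulr_ge0 A0 (ltW c0)) (ltW E0)) (ltW m0).
have H2 : m <= (A * c * E * m) `^ p^-1 * S `^ q^-1.
  by apply: le_trans H _; rewrite ler_wpM2r ?powR_ge0// ler_powR2// invr_ge0 ltW.
have := ler_powR2 (ltW q0) (ltW m0) H2.
have qE : q = 1 + t by rewrite /q /t; field; rewrite gt_eqF.
have ptE : p^-1 * q = t by rewrite /q /t; field; rewrite !gt_eqF.
rewrite powRM ?powR_ge0// -!powRrM ptE mulVf ?gt_eqF// (powRr1 (ltW S0)).
have -> : A * c * E * m = (A * E) * (c * m) by ring.
have AE0 : 0 <= A * E := mulr_ge0 A0 (ltW E0).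
rewrite (powRM _ AE0 (mulr_ge0 (ltW c0) (ltW m0))) (powRM _ (ltW c0) (ltW m0)).
have -> : m `^ q = m * m `^ t.
  by rewrite qE powRD ?powRr1 ?(ltW m0)// (gt_eqF m0) implybT.
rewrite powRN.
have mt := powR_gt0 t m0; have ct := powR_gt0 t c0.
move=> H3; rewrite mulrC ler_pdivrMr// -(ler_pM2r mt).
by apply: le_trans H3 _; rewrite le_eqVlt; apply/orP; left; apply/eqP; ring.
Qed.

End AinfWeights.

(** * The reverse Hoelder inequality on cubes *)

Section ReverseHoelderCube.
Context {R : realType} {n : nat}.
Local Notation Rn := (Rn R n).
Variables (mu : {measure set Rn -> \bar R}) (C : R).
Hypothesis dmu : doubling mu.
Hypothesis dC : doubling_bound mu C.
Implicit Types (w v f : Rn -> R) (Q : set Rn) (x y z : Rn).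

Let E : R := C ^+ n.+4.
Let C1 : 1 <= C. Proof. exact: (doubling_bound_ge1 dmu dC). Qed.
Let E1 : 1 <= E. Proof. exact: exprn_ege1. Qed.
Let E0 : 0 < E. Proof. exact: lt_le_trans E1. Qed.
Let C2E (x : \bar R) : (0 <= x)%E -> ((C ^+ n.+2)%:E * x <= E%:E * x)%E.
Proof.
move=> x0; apply: lee_wpmul2r => //; rewrite lee_fin.
by apply: ler_weXn2l => //; rewrite !ltnS; exact: leqW.
Qed.

Section Weight.
Variable v : Rn -> R.
Hypothesis av : A1 mu v.
Let wv : weight v. Proof. by case: av. Qed.
Let mv : measurable_fun [set: Rn] v. Proof. by case: wv. Qed.
Let v0 x : 0 <= v x. Proof. exact: weight_ge0. Qed.
Let mEv : measurable_fun [set: Rn] (EFin \o v). Proof. exact/measurable_EFinP. Qed.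
Let K := fine (Ainf_const mu v).
Let A := fine (A1_const mu v).
Let K1 : 1 <= K. Proof. exact: (Ainf_const_ge1 dmu dC). Qed.
Let Ac1 : 1 <= A. Proof. exact: (A1_const_ge1 dmu). Qed.

(** The substitute for the average of [v] on a cube to which the reverse Hoelder
    inequality on cells is applied. The numerator is an integral over a ball, in
    order that the Ainf constant, a supremum over balls, can be used; the
    denominator is the measure of the cube, in order that [qavgE] holds. *)
Definition qavg a k x : R :=
  fine (wmeas mu v (qball a k x)) / fine (mu (cube a k x)).

Let vq a k x : (0 < wmeas mu v (qball a k x) < +oo)%E.
Proof.
have r0 := @qball_radius_gt0 R n k.
exact: (weight_ball_integral dmu dC (ctr a k x) av r0).
Qed.

Let vqf a k x : wmeas mu v (qball a k x) \is a fin_num.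
Proof. by have /andP[? ?] := vq a k x; rewrite ge0_fin_numE// ltW. Qed.

Let mcf a k x : mu (cube a k x) \is a fin_num.
Proof. by have /andP[? ?] := mu_cube dmu a k x; rewrite ge0_fin_numE// ltW. Qed.

Let mc0 a k x : 0 < fine (mu (cube a k x)).
Proof. by apply: fine_gt0; exact: mu_cube. Qed.

Let vq0 a k x : 0 < fine (wmeas mu v (qball a k x)).
Proof. exact: fine_gt0. Qed.

Lemma qavg_ge0 a k x : 0 <= qavg a k x.
Proof. by rewrite divr_ge0// ltW. Qed.

Lemma qavgE a k x :
  ((qavg a k x)%:E * mu (cube a k x) = wmeas mu v (qball a k x))%E.
Proof. by rewrite -(fineK (mcf a k x)) -EFinM divfK ?fineK// gt_eqF. Qed.

Lemma qavg_eq a k x y : gidx a k x = gidx a k y -> qavg a k x = qavg a k y.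
Proof. by rewrite /qavg /qball /cube /ctr => ->. Qed.

Let wmeas_le (X Y : set Rn) : measurable X -> measurable Y -> X `<=` Y ->
  (wmeas mu v X <= wmeas mu v Y)%E.
Proof.
move=> mX mY XY; apply: ge0_subset_integral => //; first exact: measurable_funTS.
by move=> x _; rewrite lee_fin.
Qed.

Lemma qavg_child a k x : qavg a (k + 1) x <= E * qavg a k x.
Proof.
rewrite /qavg ler_pdivrMr//.
have h1 : fine (wmeas mu v (qball a (k + 1) x)) <= fine (wmeas mu v (qball a k x)).
  by rewrite fine_le//; apply: wmeas_le;
    [exact: measurable_qball|exact: measurable_qball|exact: qball_parent].
have h2 : fine (mu (cube a k x)) <= E * fine (mu (cube a (k + 1) x)).
  rewrite -lee_fin EFinM !fineK//.
  by apply: le_trans (mu_parent dmu dC a k x) (C2E _).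
apply: le_trans h1 _; set V := fine (wmeas _ _ _); set m := fine _ in h2 *.
have -> : E * (V / m) * fine (mu (cube a (k + 1) x)) =
  V * (E * fine (mu (cube a (k + 1) x)) / m) by ring.
apply: ler_peMr; first exact: ltW (vq0 _ _ _).
by rewrite ler_pdivlMr ?mc0// mul1r.
Qed.

Lemma avg_le_qavg a k x :
  (\int[mu]_(y in cube a k x) (v y)%:E <= (qavg a k x)%:E * mu (cube a k x))%E.
Proof.
rewrite qavgE; apply: wmeas_le;
  [exact: measurable_cube|exact: measurable_qball|exact: cube_qball].
Qed.

Let qball_sub a k x (i : nat) : qball a (k + i%:Z) x `<=` qball a k x.
Proof.
elim: i => [|i IH]; first by rewrite addr0.
rewrite -addn1 PoszD addrA; apply: subset_trans IH.
exact: qball_parent.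
Qed.

(** Below a given cube, the averages [qavg] are averages over balls of the
    restriction of [v] to the ball around that cube. *)
Lemma qavg_maximal a k x y (i : nat) : gidx a k y = gidx a k x ->
  ((qavg a (k + i%:Z) y)%:E <= E%:E * maximal mu (v \_ (qball a k x)) y)%E.
Proof.
move=> yx; have qE : qball a k x = qball a k y by rewrite /qball /ctr yx.
rewrite qE; set B := qball a k y; set B' := qball a (k + i%:Z) y.
have mB' : measurable B' by exact: measurable_qball.
have B'f : mu B' \is a fin_num.
  have /andP[? ?] := mu_eball dmu (ctr a (k + i%:Z) y) (@qball_radius_gt0 R n (k + i%:Z)).
  by rewrite ge0_fin_numE// ltW.
have B'0 : 0 < fine (mu B').
  by apply: fine_gt0; apply: (mu_eball dmu); exact: qball_radius_gt0.
have avgE : avg mu 1 B' (v \_ B) = ((mu B')^-1 * wmeas mu v B')%E.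
  rewrite avg1E//; congr (_ * _)%E; apply: eq_integral => z zB.
  rewrite patchE mem_set ?ger0_norm//.
  by rewrite inE in zB; exact: qball_sub zB.
have le_max : (avg mu 1 B' (v \_ B) <= maximal mu (v \_ B) y)%E.
  apply: ereal_sup_ubound; exists (ctr a (k + i%:Z) y), (2 ^+ n.+2 * (side (k + i%:Z) / 2)).
  split => //; first exact: qball_radius_gt0.
  by apply: cube_qball; exact: cube_self.
apply: le_trans (lee_wpmul2l (_ : 0 <= E%:E)%E le_max); last by rewrite lee_fin ltW.
rewrite avgE -(fineK B'f) -(fineK (vqf a (k + i%:Z) y)) inver gt_eqF// -!EFinM lee_fin.
rewrite /qavg -/B' ler_pdivrMr//.
have h : fine (mu B') <= E * fine (mu (cube a (k + i%:Z) y)).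
  rewrite -lee_fin EFinM !fineK//.
  by apply: le_trans (mu_qball dmu dC a (k + i%:Z) y) (C2E _).
set V := fine (wmeas _ _ _); set M' := fine (mu B') in B'0 h *.
set M := fine (mu (cube _ _ _)) in h *.
have V0 : 0 <= V by rewrite ltW// vq0.
have -> : E * (M'^-1 * V) * M = (E * M) / M' * V by ring.
by rewrite ler_peMl// ler_pdivlMr// mul1r.
Qed.

(** The value [tau] is [qavg] of the cube. The ball in [qavg] has a radius
    comparable to the side, so that [tau] is also a lower bound for multiples of
    [v], by the A1 property on a cube that contains the ball. *)
Lemma reverse_hoelder_cube Q (e := (2 * (E * K) * E ^+ 2)^-1) : dyadic Q ->
  exists tau : R, [/\ 0 <= tau, {ae mu, forall x, Q x -> tau <= E ^+ 2 * A * v x} &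
    (\int[mu]_(x in Q) (v x `^ (1 + e))%:E <= (8 * tau `^ (1 + e))%:E * mu Q)%E].
Proof.
move=> /ex_dyadic[a [k [x0 ->]]].
have filt := filtration_gfilt dmu a k.
have gen := @generating_gfilt R n a k.
exists (qavg a k x0); split; first exact: qavg_ge0.
  have r0 := @qball_radius_gt0 R n k.
  have [Q' [dQ' BQ QB]] := eball_dyadic dmu dC (ctr a k x0) r0.
  have [c [c0 cv H]] := A1_cube dmu av dQ'; rewrite -/A in H.
  apply: filterS cv => x cx xQ.
  have {}cx := cx (BQ _ (cube_qball xQ)).
  apply: (@le_trans _ _ (E ^+ 2 * A * c)); last first.
    by rewrite ler_wpM2l// mulr_ge0 ?sqr_ge0// (le_trans ler01).
  rewrite /qavg ler_pdivrMr ?mc0// -lee_fin EFinM !fineK//.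
  have h1 : (wmeas mu v (qball a k x0) <= wmeas mu v Q')%E.
    by apply: wmeas_le => //; [exact: measurable_qball|exact: measurable_dyadic].
  apply: le_trans h1 _; apply: le_trans H _.
  rewrite (_ : E ^+ 2 * A * c = (A * c) * (E * E)); last by ring.
  rewrite [in leRHS]EFinM -muleA.
  have AC0 : (0 <= (A * c)%:E)%E by rewrite lee_fin mulr_ge0 ?(ltW c0)// (le_trans ler01).
  have QE : (mu Q' <= (E * E)%:E * mu (cube a k x0))%E.
    apply: le_trans QB _; rewrite (EFinM E E) -muleA.
    have Ege0 : (0 <= E%:E)%E by rewrite lee_fin ltW.
    exact: (lee_wpmul2l Ege0 (le_trans (mu_qball dmu dC a k x0) (C2E (measure_ge0 mu _)))).
  exact: (lee_wpmul2l AC0 QE).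
pose t (j : nat) x := qavg a (k + j%:Z) x.
have c0E : cell (gfilt a k) 0 x0 = cube a k x0 by rewrite cell_gfilt addr0.
have vi : cell_integrable mu (gfilt a k) v.
  move=> j x; rewrite cell_gfilt.
  by apply: le_lt_trans (avg_le_qavg _ _ _) _; rewrite -(fineK (mcf _ _ _)) -EFinM ltry.
have tcell j : cellwise (gfilt a k) j (t j) by move=> x y xy; exact: qavg_eq.
have D1 := E1.
have L1 : 1 <= E * K by rewrite mulr_ege1.
have tD j x : cell (gfilt a k) 0 x0 x -> t j.+1 x <= E * t j x.
  by move=> _; rewrite /t -addn1 PoszD addrA; exact: qavg_child.
have vt j x : cell (gfilt a k) 0 x0 x -> cexp mu (gfilt a k) v j x <= t j x.
  move=> _; rewrite /cexp cell_gfilt ler_pdivrMr ?mc0// -lee_fin EFinM !fineK//.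
    exact: avg_le_qavg.
  have := vi j x; rewrite cell_gfilt => vij.
  by rewrite ge0_fin_numE// integral_ge0// => y _; rewrite lee_fin.
have subtree j x : cell (gfilt a k) 0 x0 x -> exists h : Rn -> \bar R,
  [/\ measurable_fun [set: Rn] h, forall y, (0 <= h y)%E,
      forall y i, cell (gfilt a k) j x y -> (j <= i)%N -> ((t i y)%:E <= h y)%E &
      (\int[mu]_(y in cell (gfilt a k) j x) h y <=
        (E * K * t j x)%:E * mu (cell (gfilt a k) j x))%E].
  move=> _; pose B := qball a (k + j%:Z) x.
  have mB : measurable B by exact: measurable_qball.
  have mM : measurable_fun setT (maximal mu (v \_ B)) by exact: measurable_maximal.
  exists (fun y => E%:E * maximal mu (v \_ B) y)%E; split.
  - exact: measurable_funeM.
  - by move=> y; rewrite mule_ge0 ?maximal_ge0// lee_fin ltW.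
  - move=> y i yx ji; rewrite /t (_ : k + i%:Z = (k + j%:Z) + (i - j)%N%:Z); last by lia.
    exact: qavg_maximal yx.
  rewrite cell_gfilt (EFinM (E * K)) -muleA qavgE ge0_integralZl//; first last.
  - by rewrite lee_fin ltW.
  - by move=> y _; exact: maximal_ge0.
  - exact: measurable_funTS.
  - exact: measurable_cube.
  rewrite (EFinM E K) -muleA lee_wpmul2l// ?lee_fin ?(ltW E0)//.
  have H := Ainf_ball dmu dC (ctr a (k + j%:Z) x) av (@qball_radius_gt0 R n (k + j%:Z)).
  apply: le_trans H; apply: ge0_subset_integral => //.
  - exact: measurable_cube.
  - exact: measurable_funTS.
  - by move=> y _; exact: maximal_ge0.
  - exact: cube_qball.
have := reverse_hoelder_cells filt mv v0 vi tcell (fun j x => qavg_ge0 _ _ _)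
  D1 L1 tD vt subtree gen.
by rewrite c0E /t addr0.
Qed.

End Weight.

(** On a cube, the average of [w `^ s] is bounded by a power of the average of
    [w], by the reverse Hoelder property, and this by a power of the essential
    infimum of [w], by the A1 property; the essential infimum commutes with the
    power. *)
Lemma A1_const_powR w (s : R) : 1 < s -> A1 mu w -> (RH_const mu s%:E w < +oo)%E ->
  [/\ (0 <= RH_const mu s%:E w)%E & (A1_const mu (fun x => (w x `^ s)%R) <=
  ((fine (A1_const mu w) * fine (RH_const mu s%:E w)) `^ s)%:E)%E].
Proof.
move=> s1 aw; have [[mw w0] _] := aw; have ww := aw.1.
have s0 : 0 < s := lt_trans ltr01 s1.
rewrite /RH_const gt_eqF ?lte_fin//; set H := ereal_sup _ => Hoo.
set a := fine (A1_const mu w); have a1 : 1 <= a := A1_const_ge1 dmu aw.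
have a0 : 0 <= a := le_trans ler01 a1.
have ws0 x : 0 <= w x := ltW (w0 x).
have ratio Q : dyadic Q -> (eratio (avg mu s%:E Q w) (avg mu 1 Q w) <= H)%E.
  by move=> dQ; apply: ereal_sup_ubound; exists Q.
have a1Q Q : dyadic Q -> (0 < avg mu 1 Q w < +oo)%E.
  move=> dQ; rewrite (avg1_weightE mu ww dQ).
  have /andP[m0 moo] := mu_dyadic dmu dQ.
  have mf : mu Q \is a fin_num by rewrite ge0_fin_numE// ltW.
  have [c [c0 cw Hc]] := A1_cube dmu aw dQ.
  have I0 := weight_integral_gt0 dmu ww dQ.
  have If : (\int[mu]_(x in Q) (w x)%:E)%E \is a fin_num.
    by rewrite ge0_fin_numE ?(ltW I0)//; apply: le_lt_trans Hc _; rewrite -(fineK mf) -EFinM ltry.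
  rewrite -(fineK mf) -(fineK If) inver gt_eqF ?fine_gt0 ?m0// -EFinM ltry andbT.
  rewrite lte_fin mulr_gt0 ?invr_gt0 ?fine_gt0 ?m0 ?moo//.
  by rewrite I0 /= -ge0_fin_numE// ltW.
have dQ0 : dyadic (cube (R := R) [ffun=> ord0] 0 (0 : Rn)) by exact: dyadic_cube_dyadic.
have H0 : (0 <= H)%E.
  apply: le_trans (ratio _ dQ0); have /andP[m0 moo] := a1Q _ dQ0.
  by rewrite /eratio lt_eqF// mule_ge0 ?poweR_ge0// inve_ge0 ltW.
have Hf : H \is a fin_num by rewrite ge0_fin_numE.
split => //; apply: le_A1_const => //.
  by split=> [|x]; [exact: measurable_powRr|exact: powR_gt0].
move=> Q dQ; have mQ := measurable_dyadic dQ.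
have /andP[m0 moo] := mu_dyadic dmu dQ.
have mf : mu Q \is a fin_num by rewrite ge0_fin_numE// ltW.
have fm0 : 0 < fine (mu Q) by rewrite fine_gt0// m0.
have [c [c0 cw Hc]] := A1_cube dmu aw dQ.
exists (c `^ s); split; first exact: powR_gt0.
  apply: filterS cw => x + Qx => /(_ Qx) cx.
  by rewrite ler_powR2// ltW.
have avg1 : (avg mu 1 Q w <= (a * c)%:E)%E.
  apply: le_avg1; [exact: mQ|by rewrite m0|apply: le_trans Hc].
  by rewrite le_eqVlt; apply/orP; left; apply/eqP/eq_integral => x _; rewrite ger0_norm.
have : (avg mu s%:E Q w <= (fine H)%:E * avg mu 1 Q w)%E.
  by rewrite eratio_le ?a1Q// fineK//; exact: ratio.
move=> /le_trans/(_ (lee_wpmul2l (_ : 0 <= (fine H)%:E)%E avg1)).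
rewrite lee_fin fine_ge0// => /(_ isT); rewrite -EFinM /avg.
set I := (\int[mu]_(x in Q) _)%E.
have I0 : (0 <= I)%E by apply: integral_ge0 => x _; rewrite lee_fin powR_ge0.
have b0 : 0 <= fine H * (a * c) := mulr_ge0 (fine_ge0 H0) (mulr_ge0 a0 (ltW c0)).
move=> /(gt0_ler_poweR (ltW s0)); rewrite !in_itv /= !leey !andbT lee_fin b0 poweR_ge0.
move=> /(_ isT isT); rewrite -poweRrM mulVf ?gt_eqF// poweRe1 ?poweR_EFin; last first.
  by rewrite mule_ge0// inve_ge0.
rewrite -(fineK mf) inver gt_eqF// lee_pdivrMl//.
have -> : (\int[mu]_(x in Q) (w x `^ s)%:E = I)%E.
  by apply: eq_integral => x _; rewrite ger0_norm.
move=> /le_trans; apply; rewrite -!EFinM lee_fin mulrC.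
rewrite -(powRM _ (mulr_ge0 a0 (fine_ge0 H0)) (ltW c0)).
by rewrite (_ : fine H * (a * c) = a * fine H * c)//; ring.
Qed.

End ReverseHoelderCube.

(** * Sparse forms *)

Section Averages.
Context {R : realType} {n : nat}.
Local Notation Rn := (Rn R n).
Variables (mu : {measure set Rn -> \bar R}).
Hypothesis dmu : doubling mu.
Implicit Types (f g : Rn -> R) (Q : set Rn).
Local Open Scope ereal_scope.

Let mdy := measurable_dyadic (R := R) (n := n).
Let mudy := mu_dyadic dmu.

Lemma avg_ge0 (p : R) Q f : 0 <= avg mu p%:E Q f.
Proof. exact: poweR_ge0. Qed.

Let int_ge0 (p : R) Q f : 0 <= \int[mu]_(x in Q) (`|f x| `^ p)%:E.
Proof. by apply: integral_ge0 => x _; rewrite lee_fin powR_ge0. Qed.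

Let avg_arg_ge0 (p : R) Q f : 0 <= (mu Q)^-1 * \int[mu]_(x in Q) (`|f x| `^ p)%:E.
Proof. by rewrite mule_ge0// inve_ge0. Qed.

Let mnorm (p : R) Q f : measurable_fun [set: Rn] f ->
  measurable_fun Q (fun x => (`|f x| `^ p)%:E).
Proof.
move=> mf; apply: measurable_funTS; apply/measurable_EFinP.
by apply: measurable_powRr; exact: measurableT_comp.
Qed.

Lemma avg_ae_le (p : R) Q f g : (0 < p)%R -> dyadic Q ->
  measurable_fun [set: Rn] f -> measurable_fun [set: Rn] g ->
  {ae mu, forall x, Q x -> (`|f x| <= `|g x|)%R} ->
  avg mu p%:E Q f <= avg mu p%:E Q g.
Proof.
move=> p0 dQ mf mg fg; apply: gt0_ler_poweR.
- by rewrite invr_ge0 ltW.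
- by rewrite in_itv /= leey andbT.
- by rewrite in_itv /= leey andbT.
rewrite lee_wpmul2l ?inve_ge0//; apply: ae_ge0_le_integral.
- exact: mdy.
- by move=> x _; rewrite lee_fin powR_ge0.
- exact: mnorm.
- by move=> x _; rewrite lee_fin powR_ge0.
- exact: mnorm.
apply: filterS fg => x H Qx; rewrite lee_fin; apply: ler_powR2 => //; first exact: ltW.
exact: H.
Qed.

Lemma avg_scale (p c : R) Q f : (0 < p)%R -> (0 <= c)%R -> dyadic Q ->
  measurable_fun [set: Rn] f ->
  avg mu p%:E Q (fun x => c * f x)%R = c%:E * avg mu p%:E Q f.
Proof.
move=> p0 c0 dQ mf; rewrite /avg.
have -> : \int[mu]_(x in Q) (`|c * f x| `^ p)%:E =
    (c `^ p)%:E * \int[mu]_(x in Q) (`|f x| `^ p)%:E.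
  rewrite -ge0_integralZl; last by rewrite lee_fin powR_ge0.
  - by apply: eq_integral => x _; rewrite normrM (ger0_norm c0) powRM.
  - exact: mdy.
  - exact: mnorm.
  - by move=> x _; rewrite lee_fin powR_ge0.
rewrite muleCA poweRM// ?lee_fin ?powR_ge0//.
by rewrite poweR_EFin -powRrM mulfV ?gt_eqF// powRr1.
Qed.

Lemma avg_hoelder (r a b : R) Q f g : (0 < r)%R -> (0 < a)%R -> (0 < b)%R ->
  (r^-1 = a^-1 + b^-1)%R -> dyadic Q ->
  measurable_fun [set: Rn] f -> measurable_fun [set: Rn] g ->
  avg mu r%:E Q (fun x => f x * g x)%R <= avg mu a%:E Q f * avg mu b%:E Q g.
Proof.
move=> r0 a0 b0 rab dQ mf mg.
have mQ := mdy dQ; have /andP[m0 moo] := mudy dQ.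
have mm : mu Q \is a fin_num by rewrite ge0_fin_numE// ltW.
have fm0 : (0 < fine (mu Q))%R by rewrite fine_gt0// m0.
have mi0 : 0 <= (mu Q)^-1 by rewrite inve_ge0.
have ar : (0 < a / r)%R by rewrite divr_gt0.
have br : (0 < b / r)%R by rewrite divr_gt0.
have arE : ((a / r)^-1 = r / a)%R by rewrite invf_div.
have brE : ((b / r)^-1 = r / b)%R by rewrite invf_div.
have abr : ((a / r)^-1 + (b / r)^-1 = 1)%R.
  by rewrite arE brE -mulrDr -rab divff// gt_eqF.
have mp (h : Rn -> R) : measurable_fun setT h ->
    measurable_fun setT (fun x => `|h x| `^ r)%R.
  by move=> mh; apply: measurable_powRr; exact: measurableT_comp.
have E (h : Rn -> R) (c : R) : \int[mu]_(x in Q) ((`|h x| `^ r) `^ (c / r))%:E =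
    \int[mu]_(x in Q) (`|h x| `^ c)%:E.
  by apply: eq_integral => x _; rewrite -powRrM mulrC divfK// gt_eqF.
have H : \int[mu]_(x in Q) (`|f x| `^ r * `|g x| `^ r)%:E <=
    (\int[mu]_(x in Q) (`|f x| `^ a)%:E) `^ (a / r)^-1 *
    (\int[mu]_(x in Q) (`|g x| `^ b)%:E) `^ (b / r)^-1.
  apply: le_trans (hoelder_ge0 mu mQ (mp _ mf) (mp _ mg) (fun=> powR_ge0 _ _)
    (fun=> powR_ge0 _ _) ar br abr) _.
  rewrite le_eqVlt; apply/orP; left; apply/eqP.
  exact: (congr2 (fun X Y => X `^ _ * Y `^ _) (E f a) (E g b)).
have -> : avg mu r%:E Q (fun x => f x * g x)%R =
    ((mu Q)^-1 * \int[mu]_(x in Q) (`|f x| `^ r * `|g x| `^ r)%:E) `^ r^-1.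
  rewrite /avg; congr ((_ * _) `^ _); apply: eq_integral => x _.
  by rewrite normrM powRM.
apply: (@le_trans _ _ (((mu Q)^-1 * ((\int[mu]_(x in Q) (`|f x| `^ a)%:E) `^ (a / r)^-1 *
    (\int[mu]_(x in Q) (`|g x| `^ b)%:E) `^ (b / r)^-1)) `^ r^-1)).
  apply: gt0_ler_poweR; first by rewrite invr_ge0 ltW.
  - rewrite in_itv /= leey andbT mule_ge0//; apply: integral_ge0 => x _.
    by rewrite lee_fin mulr_ge0// powR_ge0.
  - by rewrite in_itv /= leey andbT mule_ge0// mule_ge0// poweR_ge0.
  by rewrite lee_wpmul2l.
rewrite /avg (poweRM _ mi0 (mule_ge0 (poweR_ge0 _ _) (poweR_ge0 _ _))).
rewrite (poweRM _ (poweR_ge0 _ _) (poweR_ge0 _ _)) -!poweRrM arE brE.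
move: (int_ge0 a Q f) (int_ge0 b Q g) {H E}.
move: (\int[mu]_(x in Q) _) (\int[mu]_(x in Q) _) => If Ig If0 Ig0.
move: (mu Q) m0 moo mm fm0 mi0 => m m0 moo mm fm0 mi0.
rewrite (poweRM _ mi0 If0) (poweRM _ mi0 Ig0).
have -> : (r / a * r^-1 = a^-1)%R by rewrite mulrAC divff ?mul1r// gt_eqF.
have -> : (r / b * r^-1 = b^-1)%R by rewrite mulrAC divff ?mul1r// gt_eqF.
rewrite [in leRHS]muleACA -poweRD -?rab//.
rewrite -(fineK mm) inver gt_eqF// /poweRD_def.
by rewrite eqe invr_eq0 (gt_eqF fm0) implybT.
Qed.

End Averages.

(** Generations between [- N] and [N] become natural numbers below [2 * N]. *)
Lemma absz_shift (k : int) (N : nat) : (absz k < N)%N ->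
  (absz (k + N%:Z)%R < 2 * N)%N /\ (- N%:Z + (absz (k + N%:Z))%:Z)%R = k.
Proof. by move=> ?; split; lia. Qed.

Section SparseForm.
Context {R : realType} {n : nat}.
Local Notation Rn := (Rn R n).
Variables (mu : {measure set Rn -> \bar R}).
Hypothesis dmu : doubling mu.
Implicit Types (F G : Rn -> R) (Q : set Rn).

Lemma avg_cexp a k j x (p : R) F : (forall x, 0 <= F x) -> 0 < p ->
  cell_integrable mu (gfilt a k) (fun x => F x `^ p) ->
  avg mu p%:E (cube a (k + j%:Z) x) F =
  ((cexp mu (gfilt a k) (fun x => F x `^ p) j x) `^ p^-1)%:E.
Proof.
move=> F0 p0 Fi; rewrite /avg /cexp -poweR_EFin; congr (_ `^ _)%E.
have filt := filtration_gfilt dmu a k.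
rewrite -cell_gfilt.
have mf := fin_mu_cell filt j x; have m0 := fine_mu_cell_gt0 filt j x.
have -> : (\int[mu]_(y in cell (gfilt a k) j x) (`|F y| `^ p)%:E =
    \int[mu]_(y in cell (gfilt a k) j x) (F y `^ p)%:E)%E.
  by apply: eq_integral => y _; rewrite ger0_norm.
have If : (\int[mu]_(y in cell (gfilt a k) j x) (F y `^ p)%:E)%E \is a fin_num.
  by rewrite ge0_fin_numE ?Fi// integral_ge0// => y _; rewrite lee_fin powR_ge0.
by rewrite -(fineK mf) inver gt_eqF// -[in LHS](fineK If) -EFinM mulrC.
Qed.

(** Doob's inequality with exponent [p / p0], applied to the power [p0] of
    [F]. *)
Lemma maximal_powR a k N (p0 p : R) F : measurable_fun [set: Rn] F ->
  (forall x, 0 <= F x) -> 0 < p0 < p ->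
  ((\int[mu]_x ((rmax (cexp mu (gfilt a k) (fun x => F x `^ p0)) N x `^ p0^-1) `^ p)%:E)
     `^ p^-1 <=
   ((p / (p - p0)) `^ p0^-1)%:E * (\int[mu]_x (F x `^ p)%:E) `^ p^-1)%E.
Proof.
move=> mF F0 /andP[p00 p0p]; have p0' : 0 < p := lt_trans p00 p0p.
have filt := filtration_gfilt dmu a k.
have q1 : 1 < p / p0 by rewrite ltr_pdivlMr// mul1r.
have := doob_maximal filt N (measurable_powRr p0 mF) (fun=> powR_ge0 _ _) q1.
have -> : p / p0 / (p / p0 - 1) = p / (p - p0).
  by field; rewrite !gt_eqF ?subr_gt0.
set M := rmax _ N.
have eF : (\int[mu]_x ((F x `^ p0) `^ (p / p0))%:E = \int[mu]_x (F x `^ p)%:E)%E.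
  by apply: eq_integral => x _; rewrite -powRrM mulrC divfK ?gt_eqF.
have eM : (\int[mu]_x ((M x `^ p0^-1) `^ p)%:E = \int[mu]_x (M x `^ (p / p0))%:E)%E.
  by apply: eq_integral => x _; rewrite -powRrM mulrC.
move=> H; have i0 (g : Rn -> R) c : (0 <= \int[mu]_x (g x `^ c)%:E)%E.
  by apply: integral_ge0 => x _; rewrite lee_fin powR_ge0.
rewrite [X in (_ <= _ * X)%E]eF in H.
rewrite [X in (X `^ _)%E]eM.
have p0i : 0 <= p^-1 by rewrite invr_ge0 ltW.
have C0 : (0 <= ((p / (p - p0)) `^ (p / p0))%:E)%E by rewrite lee_fin powR_ge0.
have memi (x : \bar R) : (0 <= x)%E -> x \in `[0%E, +oo%E].
  by move=> x0; rewrite in_itv /= leey x0.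
have := gt0_ler_poweR p0i (memi _ (i0 _ _)) (memi _ (mule_ge0 C0 (i0 F p))) H.
move: (i0 F p); move: (integral _ _ _) => I I0.
rewrite (poweRM _ C0 I0) poweR_EFin -powRrM.
have pE : p / p0 * p^-1 = p0^-1 by rewrite mulrAC divff ?mul1r// gt_eqF.
by rewrite pE => h; exact: h.
Qed.

(** On the set [E Q] both averages over [Q] are bounded by the maximal
    functions, the sets [E Q] are disjoint and carry a fixed part of the measure
    of [Q]; so the form is bounded by the integral of the product of two maximal
    functions, to which the inequalities of Hoelder and Doob apply. *)
Lemma sparse_form_grid a (S : set (set Rn)) (E : set Rn -> set Rn)
    (eta p q p0 b : R) F G :
  trivIset (S `&` dyadic_grid a) E ->
  (forall Q, (S `&` dyadic_grid a) Q ->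
    [/\ measurable (E Q), E Q `<=` Q & (mu Q <= (eta^-1)%:E * mu (E Q))%E]) ->
  0 < eta -> 0 < p0 < p -> 0 < b < q -> p^-1 + q^-1 = 1 ->
  measurable_fun [set: Rn] F -> measurable_fun [set: Rn] G ->
  (forall x, 0 <= F x) -> (forall x, 0 <= G x) ->
  (\int[mu]_x (F x `^ p)%:E < +oo)%E -> (\int[mu]_x (G x `^ q)%:E < +oo)%E ->
  forall s : seq (set Rn), uniq s ->
  (\sum_(Q <- s | Q \in S `&` dyadic_grid a)
     (avg mu p0%:E Q F * avg mu b%:E Q G * mu Q) <=
   (eta^-1 * ((p / (p - p0)) `^ p0^-1 * (q / (q - b)) `^ b^-1))%:E *
     ((\int[mu]_x (F x `^ p)%:E) `^ p^-1 * (\int[mu]_x (G x `^ q)%:E) `^ q^-1))%E.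
Proof.
move=> tE HE eta0 p0p bq pq mF mG F0 G0 Foo Goo s us.
have /andP[p00 pp] := p0p; have /andP[b0 bb] := bq.
have p'0 : 0 < p := lt_trans p00 pp; have q'0 : 0 < q := lt_trans b0 bb.
rewrite -big_filter; set s' := [seq Q <- s | _].
have us' : uniq s' by exact: filter_uniq.
have sP Q : Q \in s' -> (S `&` dyadic_grid a) Q.
  by rewrite mem_filter => /andP[/set_mem].
(* finitely many cubes lie in finitely many generations *)
have [k0 [N HN]] : exists (k0 : int) (N : nat), forall Q, Q \in s' ->
    exists (j : nat) x, (j < N)%N /\ Q = cube a (k0 + j%:Z) x.
  have [N HN] : exists N : nat, forall Q, Q \in s' ->
      exists k x, (absz k < N)%N /\ Q = cube a k x.
    elim: (s') sP => [|Q s'' IH] sP'; first by exists 0%N.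
    have [|N HN] := IH; first by move=> Q' Qs; apply: sP'; rewrite inE Qs orbT.
    have [_ [k [m QE]]] := sP' Q (mem_head _ _).
    have [x xm] := dyadic_cube_nonempty (R := R) a k m.
    exists (maxn N (absz k).+1) => Q'; rewrite inE => /orP[/eqP ->|Qs].
      exists k, x; split; first by rewrite leq_max ltnSn orbT.
      by rewrite QE; exact: dyadic_cube_cube.
    have [k' [x' [kN ->]]] := HN _ Qs; exists k', x'; split => //.
    by rewrite leq_max kN.
  exists (- N%:Z), (2 * N)%N => Q /HN[k [x [kN ->]]].
  have [kN1 kN2] := absz_shift kN.
  by exists (absz (k + N%:Z)), x; rewrite kN2.
have filt := filtration_gfilt dmu a k0.
pose Fp x := F x `^ p0; pose Gb x := G x `^ b.
have mFp : measurable_fun setT Fp by exact: measurable_powRr.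
have mGb : measurable_fun setT Gb by exact: measurable_powRr.
have Fi : cell_integrable mu (gfilt a k0) Fp.
  apply: (cell_integrable_powR filt (p := p / p0) mFp (fun=> powR_ge0 _ _)).
    by rewrite ltr_pdivlMr// mul1r.
  suff -> : (\int[mu]_x (Fp x `^ (p / p0))%:E = \int[mu]_x (F x `^ p)%:E)%E by [].
  by apply: eq_integral => x _; rewrite /Fp -powRrM mulrC divfK ?gt_eqF.
have Gi : cell_integrable mu (gfilt a k0) Gb.
  apply: (cell_integrable_powR filt (p := q / b) mGb (fun=> powR_ge0 _ _)).
    by rewrite ltr_pdivlMr// mul1r.
  suff -> : (\int[mu]_x (Gb x `^ (q / b))%:E = \int[mu]_x (G x `^ q)%:E)%E by [].
  by apply: eq_integral => x _; rewrite /Gb -powRrM mulrC divfK ?gt_eqF.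
pose M1 := rmax (cexp mu (gfilt a k0) Fp) N.
pose M2 := rmax (cexp mu (gfilt a k0) Gb) N.
have mM1 : measurable_fun setT (fun x => M1 x `^ p0^-1).
  apply: measurable_powRr; apply: (measurable_rmax filt) => j.
  exact: cellwise_cexp.
have mM2 : measurable_fun setT (fun x => M2 x `^ b^-1).
  apply: measurable_powRr; apply: (measurable_rmax filt) => j.
  exact: cellwise_cexp.
pose H x := M1 x `^ p0^-1 * M2 x `^ b^-1.
have mH : measurable_fun setT H := measurable_funM mM1 mM2.
have H0 x : 0 <= H x by rewrite mulr_ge0 ?powR_ge0.
have mEH : measurable_fun setT (fun x => (H x)%:E) by exact/measurable_EFinP.
have ei0 : 0 <= eta^-1 by rewrite invr_ge0 ltW.
pose E' Q := if Q \in s' then E Q else set0.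
have mE' Q : measurable (E' Q).
  by rewrite /E'; case: ifPn => // /sP/HE[].
have tE' : trivIset [set` s'] E'.
  apply/trivIsetP => P Q Ps Qs PQ; rewrite /E'.
  have [-> ->] : P \in s' /\ Q \in s' by [].
  by move/trivIsetP : tE => /(_ P Q (sP _ Ps) (sP _ Qs) PQ).
apply: (@le_trans _ _ (\sum_(Q <- s') (eta^-1)%:E * \int[mu]_(x in E' Q) (H x)%:E)%E).
  rewrite big_seq [leRHS]big_seq; apply: lee_sum => Q Qs.
  have [mE EQ muE] := HE Q (sP Q Qs); rewrite /E' Qs.
  have [j [x [jN QE]]] := HN Q Qs.
  rewrite {1 2}QE (avg_cexp j x F0 p00 Fi) (avg_cexp j x G0 b0 Gi).
  set u := cexp _ _ _ _ _; set v := cexp _ _ _ _ _.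
  apply: (@le_trans _ _ ((u `^ p0^-1 * v `^ b^-1)%:E * ((eta^-1)%:E * mu (E Q)))%E).
    by rewrite -EFinM lee_wpmul2l// lee_fin mulr_ge0 ?powR_ge0.
  rewrite muleCA lee_wpmul2l// -integral_cst//; apply: ge0_le_integral => //.
  - by move=> y _; rewrite /= lee_fin mulr_ge0 ?powR_ge0.
  - exact: measurable_funTS.
  move=> y Ey; rewrite /= lee_fin /H.
  have yx : cell (gfilt a k0) j x y by rewrite cell_gfilt -QE; exact: EQ.
  have cu f : cexp mu (gfilt a k0) f j x <= rmax (cexp mu (gfilt a k0) f) N y.
    by rewrite -(@cellwise_cexp _ _ _ _ mu (gfilt a k0) f j y x yx); exact: le_rmax.
  have u0 : 0 <= u by apply: cexp_ge0 => z; exact: powR_ge0.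
  have v0 : 0 <= v by apply: cexp_ge0 => z; exact: powR_ge0.
  have ip0 : 0 <= p0^-1 by rewrite invr_ge0 ltW.
  have ib0 : 0 <= b^-1 by rewrite invr_ge0 ltW.
  exact: (ler_pM (powR_ge0 _ _) (powR_ge0 _ _) (ler_powR2 ip0 u0 (cu _))
    (ler_powR2 ib0 v0 (cu _))).
rewrite -ge0_sume_distrr; last by move=> Q _; apply: integral_ge0 => x _; rewrite lee_fin.
rewrite EFinM -muleA lee_wpmul2l//.
rewrite -(@ge0_integral_bigsetU _ _ _ mu _ E' (fun x => (H x)%:E) s' mE' us' tE').
- apply: (@le_trans _ _ (\int[mu]_x (H x)%:E)%E).
    apply: ge0_subset_integral => //; first exact: bigsetU_measurable.
    by move=> x _; rewrite lee_fin.
  apply: le_trans (hoelder_ge0 mu measurableT mM1 mM2 (fun=> powR_ge0 _ _)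
    (fun=> powR_ge0 _ _) p'0 q'0 pq) _.
  rewrite EFinM muleACA; apply: lee_pmul; rewrite ?poweR_ge0//.
  + exact: maximal_powR.
  + exact: maximal_powR.
- exact: measurable_funTS.
- by move=> x _; rewrite lee_fin.
Qed.

(** A sparse collection is treated grid by grid; this costs the factor [3 ^+ n]. *)
Lemma sparse_form_le (S : set (set Rn)) (eta p q p0 b : R) F G :
  sparse mu eta S ->
  0 < eta -> 0 < p0 < p -> 0 < b < q -> p^-1 + q^-1 = 1 ->
  measurable_fun [set: Rn] F -> measurable_fun [set: Rn] G ->
  (forall x, 0 <= F x) -> (forall x, 0 <= G x) ->
  (\int[mu]_x (F x `^ p)%:E < +oo)%E -> (\int[mu]_x (G x `^ q)%:E < +oo)%E ->
  (\esum_(Q in S) (avg mu p0%:E Q F * avg mu b%:E Q G * mu Q) <=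
   (3 ^+ n * eta^-1 * ((p / (p - p0)) `^ p0^-1 * (q / (q - b)) `^ b^-1))%:E *
     ((\int[mu]_x (F x `^ p)%:E) `^ p^-1 * (\int[mu]_x (G x `^ q)%:E) `^ q^-1))%E.
Proof.
move=> [Sd HS] eta0 p0p bq pq mF mG F0 G0 Foo Goo.
apply: ge_ereal_sup => _ [Y [finY YS] <-].
have /finite_seqP[s' Ys'] := finY.
pose s := undup s'; have us : uniq s by exact: undup_uniq.
have Ys : Y = [set` s] by rewrite Ys'; apply/seteqP; split => Q /=; rewrite mem_undup.
have sY Q : Q \in s -> S Q by move=> Qs; apply: YS; rewrite Ys.
rewrite Ys -fsbig_seq//.
pose t Q := (avg mu p0%:E Q F * avg mu b%:E Q G * mu Q)%E.
have t0 Q : (0 <= t Q)%E by rewrite !mule_ge0// poweR_ge0.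
apply: (@le_trans _ _ (\sum_(Q <- s) \sum_(a : 'I_3 ^ n | Q \in S `&` dyadic_grid a) t Q)%E).
  rewrite big_seq [leRHS]big_seq; apply: lee_sum => Q Qs.
  have [a _ Qa] := Sd Q (sY Q Qs).
  have Qin : Q \in S `&` dyadic_grid a by apply/mem_set; split => //; exact: sY.
  by rewrite (bigD1 a)//= leeDl// sume_ge0.
rewrite (exchange_big_dep xpredT)//=.
apply: (@le_trans _ _ (\sum_(a : 'I_3 ^ n)
  (eta^-1 * ((p / (p - p0)) `^ p0^-1 * (q / (q - b)) `^ b^-1))%:E *
     ((\int[mu]_x (F x `^ p)%:E) `^ p^-1 * (\int[mu]_x (G x `^ q)%:E) `^ q^-1))%E).
  apply: lee_sum => a _; have [E [tE HE]] := HS a.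
  exact: (sparse_form_grid tE HE).
set M := eta^-1 * _; set W := ((_ `^ _) * (_ `^ _))%E.
have Wf : W \is a fin_num.
  apply: fin_numM; apply: fin_num_poweR; rewrite ge0_fin_numE//;
    by apply: integral_ge0 => x _; rewrite lee_fin powR_ge0.
rewrite -(fineK Wf) -EFinM sumEFin sumr_const -[X in (X%:E <= _)%E]mulr_natl card_ffun !card_ord.
rewrite -[3 ^+ n * eta^-1 * _]mulrA -/M -EFinM lee_fin.
by rewrite natrX mulrA.
Qed.

End SparseForm.

(** * Sparse forms with weights *)

Lemma mule_transfer (R : realType) (x y z : \bar R) (t t' : R) : (0 <= z)%E ->
  (t%:E * x <= t'%:E * y)%E -> (x * (z * (8 * t)%:E) <= (8 * t')%:E * (y * z))%E.
Proof.
move=> z0 h; have z8 : (0 <= 8%:E * z)%E by rewrite mule_ge0.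
have -> : (x * (z * (8 * t)%:E) = (8%:E * z) * (t%:E * x))%E.
  by rewrite EFinM muleA [RHS]muleACA [LHS]muleC (muleC x).
have -> : ((8 * t')%:E * (y * z) = (8%:E * z) * (t'%:E * y))%E.
  by rewrite EFinM (muleC y) muleACA.
exact: lee_wpmul2l.
Qed.

(** Here [E] stands for a power of the doubling constant. *)
Definition form_const (R : realType) (n : nat) (E eta : R) : R :=
  8 * E ^+ 2 * (3 ^+ n / eta) * (expR 1 * (3 * E ^+ 3)).

Lemma form_const_arith (R : realType) (n : nat) (E eta V W Z Y k a : R) :
  0 <= eta -> 0 <= V -> 0 <= W -> 0 <= Z -> V <= E ^+ 2 * a ->
  Z <= expR 1 * (3 * E ^+ 3) * k * Y ->
  8 * V * (3 ^+ n / eta * (W * Z)) <= form_const n E eta * (W * Y) * k * a.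
Proof.
move=> eta0 V0 W0 Z0 h1 h2; rewrite /form_const.
have T0 : 0 <= 3 ^+ n / eta by rewrite divr_ge0// exprn_ge0.
move: (3 ^+ n / eta) T0 => t t0.
apply: (@le_trans _ _ (8 * (E ^+ 2 * a) * (t * (W * (expR 1 * (3 * E ^+ 3) * k * Y))))).
  apply: ler_pM; rewrite ?mulr_ge0//; first by rewrite ler_wpM2l.
  by rewrite ler_wpM2l// ler_wpM2l.
by move: (expR 1) => r; rewrite le_eqVlt; apply/orP; left; apply/eqP; ring.
Qed.

Section WeightedSparseForm.
Context {R : realType} {n : nat}.
Local Notation Rn := (Rn R n).
Variables (mu : {measure set Rn -> \bar R}) (C : R).
Hypothesis dmu : doubling mu.
Hypothesis dC : doubling_bound mu C.

Let E : R := C ^+ n.+4.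
Let C1 : 1 <= C. Proof. exact: (doubling_bound_ge1 dmu dC). Qed.
Let E1 : 1 <= E. Proof. exact: exprn_ege1. Qed.
Let E0 : 0 < E. Proof. exact: lt_le_trans E1. Qed.

(** In applications [s] is the dual exponent of [q0 / p] and [qq] that of [q0].
    The exponents [a] and [b] split [qq]: Hoelder's inequality bounds the average
    of exponent [qq] of [g] by the one of exponent [a] of [g w^(-1/p)] and the
    one of exponent [b] of [w^(1/p)], which is an average of
    [v `^ (1 + e)]. *)
Variables (w : Rn -> R) (p0 p s qq : R).
Hypothesis p01 : 1 <= p0.
Hypothesis p0p : p0 < p.
Hypothesis s1 : 1 <= s.
Hypothesis qq1 : 1 <= qq.
Let p' := p / (p - 1).
Hypothesis psE : (p * s)^-1 = qq^-1 - p'^-1.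
Let v := fun x => w x `^ s.
Hypothesis ww : weight w.
Hypothesis av : A1 mu v.
Let K := fine (Ainf_const mu v).
Let A := fine (A1_const mu v).
Let e : R := (2 * (E * K) * E ^+ 2)^-1.
Let u := (p * s)^-1.
Let a := (qq^-1 - u / (1 + e))^-1.
Let b := p * s * (1 + e).

Let K1 : 1 <= K. Proof. exact: (Ainf_const_ge1 dmu dC). Qed.
Let K0 : 0 < K. Proof. exact: lt_le_trans K1. Qed.
Let Ac1 : 1 <= A. Proof. exact: (A1_const_ge1 dmu). Qed.
Let A0 : 0 <= A. Proof. exact: le_trans Ac1. Qed.
Let e0 : 0 < e.
Proof. by rewrite invr_gt0; apply: mulr_gt0; [do 2 apply: mulr_gt0 => //|exact: exprn_gt0]. Qed.
Let p1 : 1 < p. Proof. exact: le_lt_trans p0p. Qed.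
Let pgt0 : 0 < p. Proof. exact: lt_trans p1. Qed.
Let pB0 : 0 < p - 1. Proof. by rewrite subr_gt0. Qed.
Let p'0 : 0 < p'. Proof. exact: divr_gt0. Qed.
Let s0 : 0 < s. Proof. exact: lt_le_trans s1. Qed.
Let ps1 : 1 <= p * s. Proof. by rewrite mulr_ege1// ltW. Qed.
Let ps0 : 0 < p * s. Proof. exact: mulr_gt0. Qed.
Let u0 : 0 < u. Proof. by rewrite invr_gt0. Qed.
Let e10 : 0 < 1 + e. Proof. exact: addr_gt0. Qed.
Let b0 : 0 < b. Proof. exact: mulr_gt0. Qed.
Let bu : b^-1 = u / (1 + e). Proof. by rewrite /b invfM. Qed.
Let ulu : u / (1 + e) < u.
Proof. by rewrite ltr_pdivrMr// ltr_pMr// ltrDl. Qed.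
Let ai0 : p'^-1 < a^-1.
Proof. by rewrite /a invrK; have := psE; rewrite -/u; have := ulu => *; lra. Qed.
Let a0 : 0 < a.
Proof. by rewrite -invr_gt0; apply: lt_trans ai0; rewrite invr_gt0. Qed.
Let ap' : a < p'. Proof. by rewrite -ltf_pV2. Qed.
Let qab : qq^-1 = a^-1 + b^-1. Proof. by rewrite bu /a invrK subrK. Qed.
Let p00 : 0 < p0. Proof. exact: lt_le_trans p01. Qed.
Let qq0 : 0 < qq. Proof. exact: lt_le_trans qq1. Qed.

Let mw : measurable_fun [set: Rn] w. Proof. by case: ww. Qed.
Let w0 x : 0 < w x. Proof. by case: ww. Qed.

Variables (f g : Rn -> R).
Hypothesis mf : measurable_fun [set: Rn] f.
Hypothesis mg : measurable_fun [set: Rn] g.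
Let F := fun x => `|f x| * w x `^ p^-1.
Let G := fun x => `|g x| * w x `^ (- p^-1).
Let mF : measurable_fun [set: Rn] F.
Proof. by apply: measurable_funM; [exact: measurableT_comp|exact: measurable_powRr]. Qed.
Let mG : measurable_fun [set: Rn] G.
Proof. by apply: measurable_funM; [exact: measurableT_comp|exact: measurable_powRr]. Qed.

(** The weight moves from [g] to [f]. By the reverse Hoelder inequality, the
    average of [v `^ (1 + e)] that is split off from [g] is bounded by a power of
    a number [tau]; as [tau] is bounded by a multiple of [v] on the cube, a power
    of [v] may take its place under the average of [f]. *)
Lemma weighted_term (Q : set Rn) : dyadic Q ->
  (avg mu p0%:E Q f * avg mu qq%:E Q g <=
   (8 * (E ^+ 2 * A) `^ u)%:E * (avg mu p0%:E Q F * avg mu a%:E Q G))%E.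
Proof.
move=> dQ; have mQ := measurable_dyadic dQ.
have /andP[m0 moo] := mu_dyadic dmu dQ.
have mQf : mu Q \is a fin_num by rewrite ge0_fin_numE// ltW.
have fm0 : 0 < fine (mu Q) by rewrite fine_gt0// m0.
have [tau [tau0 tauv tauI]] := reverse_hoelder_cube dmu dC av dQ.
rewrite -/E -/K -/e in tauI; rewrite -/E -/A in tauv.
have mwp : measurable_fun [set: Rn] (fun x => w x `^ p^-1) by exact: measurable_powRr.
have hg : (avg mu qq%:E Q g <= avg mu a%:E Q G * avg mu b%:E Q (fun x => (w x `^ p^-1)%R))%E.
  apply: le_trans (avg_hoelder dmu qq0 a0 b0 qab dQ mG mwp).
  apply: avg_ae_le => //; first exact: measurable_funM.
  apply: aeW => x _; rewrite /G -mulrA -powRD.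
    by rewrite addNr powRr0 mulr1 normr_id.
  by rewrite (gt_eqF (w0 x)) implybT.
have hb : (avg mu b%:E Q (fun x => (w x `^ p^-1)%R) <= (8 * tau `^ u)%:E)%E.
  have IE : (\int[mu]_(x in Q) (`|w x `^ p^-1| `^ b)%:E =
      \int[mu]_(x in Q) (v x `^ (1 + e))%:E)%E.
    have pb : p^-1 * b = s * (1 + e) by rewrite /b -mulrA mulKf// gt_eqF.
    apply: eq_integral => x _; apply: (congr1 EFin).
    rewrite ger0_norm; last exact: powR_ge0.
    rewrite /v -powRrM -powRrM pb; reflexivity.
  rewrite /avg IE.
  have H : ((mu Q)^-1 * \int[mu]_(x in Q) (v x `^ (1 + e))%:E <= (8 * tau `^ (1 + e))%:E)%E.
    by move: tauI; rewrite -(fineK mQf) inver gt_eqF// lee_pdivrMl// muleC.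
  have bi0 : 0 <= b^-1 by rewrite invr_ge0 ltW.
  have t80 : 0 <= 8 * tau `^ (1 + e) by rewrite mulr_ge0 ?powR_ge0.
  have I0 : (0 <= (mu Q)^-1 * \int[mu]_(x in Q) (v x `^ (1 + e))%:E)%E.
    by rewrite mule_ge0 ?inve_ge0// integral_ge0// => x _; rewrite lee_fin powR_ge0.
  have := gt0_ler_poweR bi0 _ _ H; rewrite !in_itv /= !leey !andbT I0 lee_fin t80.
  move=> /(_ isT isT)/le_trans; apply; rewrite ?poweR_EFin lee_fin powRM ?powR_ge0//.
  rewrite -powRrM bu mulrC mulrCA mulfV ?gt_eqF// mulr1 mulrC.
  rewrite ler_wpM2r ?powR_ge0// -[leRHS]powRr1// ler_powR ?ler1n// -bu.
  rewrite invf_le1// /b mulr_ege1//.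
  by rewrite lerDl ltW.
apply: (@le_trans _ _ (avg mu p0%:E Q f * (avg mu a%:E Q G * (8 * tau `^ u)%:E))%E).
  apply: lee_wpmul2l; first exact: avg_ge0.
  apply: le_trans hg _; apply: lee_wpmul2l => //; exact: avg_ge0.
have tu0 : 0 <= tau `^ u by exact: powR_ge0.
have Eu0 : 0 <= (E ^+ 2 * A) `^ u by exact: powR_ge0.
have hf : ((tau `^ u)%:E * avg mu p0%:E Q f <=
    ((E ^+ 2 * A) `^ u)%:E * avg mu p0%:E Q F)%E.
  rewrite -(avg_scale mu p00 tu0 dQ mf) -(avg_scale mu p00 Eu0 dQ mF).
  apply: avg_ae_le => //; [exact: measurable_funM|exact: measurable_funM|].
  apply: filterS tauv => x + Qx => /(_ Qx) tv.
  rewrite /F !normrM normr_id !(ger0_norm (powR_ge0 _ _)) mulrCA mulrC.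
  rewrite ler_wpM2l//.
  have -> : w x `^ p^-1 = v x `^ u.
    rewrite /v -powRrM /u; congr (_ `^ _).
    by rewrite invfM mulrCA mulfV ?mulr1// gt_eqF.
  have EA0 : 0 <= E ^+ 2 * A by rewrite mulr_ge0// sqr_ge0.
  rewrite -powRM ?powR_ge0//.
  by apply: ler_powR2 => //; exact: ltW.
exact: (mule_transfer (avg_ge0 mu a Q G) hf).
Qed.

Lemma esumZ_le (k : \bar R) (S : set (set Rn)) (h : set Rn -> \bar R) :
  (0 <= k)%E -> (forall Q, (0 <= h Q)%E) ->
  (\esum_(Q in S) (k * h Q) <= k * \esum_(Q in S) h Q)%E.
Proof.
move=> k0 h0; apply: ge_ereal_sup => _ [Y [finY YS] <-].
rewrite -ge0_mule_fsumr//; apply: lee_wpmul2l => //.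
by apply: ereal_sup_ubound; exists Y.
Qed.

Lemma weighted_sparse_form (eta : R) (S : set (set Rn)) : 0 < eta ->
  sparse mu eta S ->
  (LpN mu p w f < +oo)%E ->
  (LpN mu p' (fun x => (w x `^ (- (p - 1)^-1))%R) g < +oo)%E ->
  (\esum_(Q in S) (avg mu p0%:E Q f * avg mu qq%:E Q g * mu Q) <=
   (8 * (E ^+ 2 * A) `^ u * (3 ^+ n * eta^-1 *
     ((p / (p - p0)) `^ p0^-1 * (p' / (p' - a)) `^ a^-1)))%:E *
   (LpN mu p w f * LpN mu p' (fun x => (w x `^ (- (p - 1)^-1))%R) g))%E.
Proof.
move=> eta0 Ssp foo goo; have [Sd _] := Ssp.
have pp' : p^-1 + p'^-1 = 1 by rewrite /p'; field; rewrite !gt_eqF.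
have Fx x : 0 <= F x by rewrite mulr_ge0 ?powR_ge0.
have Gx x : 0 <= G x by rewrite mulr_ge0 ?powR_ge0.
have FE : (\int[mu]_x (F x `^ p)%:E = \int[mu]_x (`|f x| `^ p * w x)%:E)%E.
  apply: eq_integral => x _; rewrite /F powRM ?powR_ge0// -powRrM.
  by rewrite mulVf ?gt_eqF// powRr1// ltW.
have GE : (\int[mu]_x (G x `^ p')%:E =
    \int[mu]_x (`|g x| `^ p' * w x `^ (- (p - 1)^-1))%:E)%E.
  apply: eq_integral => x _; rewrite /G powRM ?powR_ge0// -powRrM.
  by congr (_ * _ `^ _)%:E; rewrite /p'; field; rewrite !gt_eqF.
have FN : ((\int[mu]_x (F x `^ p)%:E) `^ p^-1 = LpN mu p w f)%E by rewrite FE.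
have GN : ((\int[mu]_x (G x `^ p')%:E) `^ p'^-1 =
    LpN mu p' (fun x => (w x `^ (- (p - 1)^-1))%R) g)%E by rewrite GE.
have Foo : (\int[mu]_x (F x `^ p)%:E < +oo)%E.
  by apply: (lty_poweRy (r := p^-1)); [rewrite invr_eq0 gt_eqF|rewrite FN].
have Goo : (\int[mu]_x (G x `^ p')%:E < +oo)%E.
  by apply: (lty_poweRy (r := p'^-1)); [rewrite invr_eq0 gt_eqF|rewrite GN].
have p0p2 : 0 < p0 < p by rewrite p00.
have ap2 : 0 < a < p' by rewrite a0.
have SF := sparse_form_le dmu Ssp eta0 p0p2 ap2 pp' mF mG Fx Gx Foo Goo.
have k0 : 0 <= 8 * (E ^+ 2 * A) `^ u by rewrite mulr_ge0// powR_ge0.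
rewrite [in leRHS]EFinM -muleA.
apply: (@le_trans _ _ (\esum_(Q in S) ((8 * (E ^+ 2 * A) `^ u)%:E *
    (avg mu p0%:E Q F * avg mu a%:E Q G * mu Q)))%E).
  apply: le_esum => Q SQ; rewrite muleA; apply: lee_wpmul2r => //.
  exact: weighted_term (Sd Q SQ).
apply: le_trans (esumZ_le _ _ _) _; first by rewrite lee_fin.
  by move=> Q; rewrite !mule_ge0// avg_ge0.
apply: lee_wpmul2l; first by rewrite lee_fin.
apply: le_trans SF _; rewrite le_eqVlt; apply/orP; left; apply/eqP.
exact: (congr2 (fun X Y => (_%:E * (X * Y))%E) FN GN).
Qed.

(** The price for the exponent [a], which is larger than [qq]. Put
    [r' = (1 + e) / e], which is at most a multiple of [K]. Then
    [a^-1 = p'^-1 + u / r'] and the ratio on the left is at most [r'] times the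
    one on the right. As [r' `^ (u / r')] is bounded, only [r' `^ p'^-1], and
    hence [K `^ p'^-1], remains. *)
Lemma maximal_constant :
  (p' / (p' - a)) `^ a^-1 <=
  expR 1 * (3 * E ^+ 3) * K `^ p'^-1 * (p' / (p' - qq)) `^ qq^-1.
Proof.
set r' := (1 + e) / e.
have r'1 : 1 <= r' by rewrite /r' ler_pdivlMr// mul1r lerDr.
have r'0 : 0 < r' := lt_le_trans ltr01 r'1.
have qp' : qq < p' by rewrite -ltf_pV2// -subr_gt0 -psE invr_gt0.
have qqE : qq^-1 = p'^-1 + u by rewrite /u psE addrC subrK.
have aE : a^-1 = p'^-1 + u / r'.
  rewrite /a invrK qqE /r' -addrA; congr (_ + _).
  by field; rewrite !gt_eqF.
pose Y := p' / (p' - qq); have Y1 : 1 <= Y.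
  by rewrite /Y ler_pdivlMr ?subr_gt0// mul1r lerBlDr lerDl ltW.
have XE : p' / (p' - a) = 1 + r' / (p' * u).
  have aE' : a = (p'^-1 + u / r')^-1 by rewrite -aE invrK.
  have h : 0 < p'^-1 + u / r' by rewrite -aE invr_gt0.
  have ur : 0 < p' * u + r' by rewrite addr_gt0// mulr_gt0.
  have aE2 : a = p' * r' / (r' + p' * u).
    by rewrite aE'; field; rewrite !gt_eqF// addrC.
  have -> : p' - a = p' * (p' * u) / (r' + p' * u).
    by rewrite aE2; field; rewrite gt_eqF// addrC.
  by field; rewrite !gt_eqF// addrC.
have YE : Y = 1 + (p' * u)^-1.
  rewrite /Y (_ : qq = (p'^-1 + u)^-1); last by rewrite -qqE invrK.
  have h : 0 < 1 + u * p' by rewrite addr_gt0// mulr_gt0.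
  have -> : p' - (p'^-1 + u)^-1 = p' * (p' * u) / (1 + p' * u).
    by field; rewrite !gt_eqF// mulrC.
  by field; rewrite !gt_eqF// mulrC.
have XY : p' / (p' - a) <= r' * Y.
  by rewrite XE YE mulrDr mulr1 lerD2r.
have rE : r' <= (3 * E ^+ 3) * K.
  have -> : r' = 1 + 2 * (E * K) * E ^+ 2.
    by rewrite /r' mulrDl mul1r divff ?gt_eqF// addrC /e invrK.
  have EK1 : 1 <= E ^+ 3 * K by rewrite mulr_ege1// exprn_ege1.
  have -> : 2 * (E * K) * E ^+ 2 = 2 * (E ^+ 3 * K) by ring.
  rewrite -mulrA; move: (E ^+ 3 * K) EK1 => z z1.
  by rewrite (_ : 3 * z = z + 2 * z) ?lerD2r//; ring.
have ai1 : 0 <= a^-1 by rewrite invr_ge0 ltW.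
have pa0 : 0 <= p' - a by rewrite subr_ge0 ltW.
have X0 : 0 <= p' / (p' - a) := divr_ge0 (ltW p'0) pa0.
have Y0 : 0 <= Y := le_trans ler01 Y1.
apply: le_trans (ler_powR2 ai1 X0 XY) _.
rewrite (powRM _ (ltW r'0) Y0).
have hY : Y `^ a^-1 <= Y `^ qq^-1.
  by apply: ler_powR => //; rewrite qqE aE lerD2l ler_pdivrMr// ler_peMr// ltW.
apply: (ler_pM (powR_ge0 _ _) (powR_ge0 _ _) _ hY).
have iP0 : 0 <= p'^-1 by rewrite invr_ge0 ltW.
have iP1 : p'^-1 <= 1.
  by rewrite invf_le1// ltW// /p' ltr_pdivlMr// mul1r ltrBlDr ltrDl.
rewrite aE powRD; last by rewrite (gt_eqF r'0) implybT.
have hr : r' `^ (u / r') <= expR 1.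
  rewrite /powR (gt_eqF r'0) ler_expR.
  have ur1 : u <= 1 by rewrite /u invf_le1.
  have lnr : ln r' <= r'.
    have := @le_ln1Dx R (r' - 1); rewrite (_ : 1 + (r' - 1) = r'); last by ring.
    move=> h; apply: le_trans (h _) _; last by rewrite lerBlDr lerDl.
    by rewrite ltrBrDl subrr.
  have lnr0 : 0 <= ln r' by rewrite ln_ge0.
  rewrite mulrAC ler_pdivrMr// mul1r; apply: le_trans lnr.
  exact: ler_piMl.
have hK : r' `^ p'^-1 <= (3 * E ^+ 3) * K `^ p'^-1.
  have E3 : 1 <= 3 * E ^+ 3 by rewrite mulr_ege1 ?ler1n// exprn_ege1.
  have E30 : 0 <= 3 * E ^+ 3 := le_trans ler01 E3.
  apply: le_trans (ler_powR2 iP0 (ltW r'0) rE) _.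
  rewrite (powRM _ E30 (ltW K0)) ler_wpM2r ?powR_ge0//.
  by rewrite -[leRHS](powRr1 E30) ler_powR.
rewrite mulrC -[leRHS]mulrA; exact: (ler_pM (powR_ge0 _ _) (powR_ge0 _ _) hr hK).
Qed.

Lemma weighted_sparse_bound (eta : R) (S : set (set Rn)) : 0 < eta ->
  sparse mu eta S -> (LpN mu p w f < +oo)%E ->
  (LpN mu p' (fun x => (w x `^ (- (p - 1)^-1))%R) g < +oo)%E ->
  (\esum_(Q in S) (avg mu p0%:E Q f * avg mu qq%:E Q g * mu Q) <=
   (form_const n E eta *
    ((p / (p - p0)) `^ p0^-1 * (p' / (p' - qq)) `^ qq^-1) *
    K `^ p'^-1 * A `^ u)%:E *
   (LpN mu p w f * LpN mu p' (fun x => (w x `^ (- (p - 1)^-1))%R) g))%E.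
Proof.
move=> eta0 sS fN gN; apply: le_trans (weighted_sparse_form eta0 sS fN gN) _.
apply: lee_wpmul2r; first by rewrite mule_ge0// poweR_ge0.
rewrite lee_fin; apply: form_const_arith; rewrite ?powR_ge0 ?(ltW eta0)//.
- have E20 : 0 <= E ^+ 2 by exact: sqr_ge0.
  rewrite (powRM _ E20 A0) ler_wpM2r ?powR_ge0// -[leRHS](powRr1 E20).
  by rewrite ler_powR ?exprn_ege1// /u invf_le1.
- exact: maximal_constant.
Qed.

End WeightedSparseForm.

(** * Lebesgue norms of real functions *)

Section LqNorm.
Context d {T : measurableType d} {R : realType}.
Variable mu : {measure set T -> \bar R}.
Variable q : R.
Hypothesis q1 : 1 <= q.
Implicit Types (f g : T -> R).

(** The norm of the Lebesgue space, on real-valued functions and without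
    quotient; [rlq] is its real value, meaningful on [inLq]. *)
Definition lq f : \bar R := ((\int[mu]_x (`|f x| `^ q)%:E) `^ q^-1)%E.
Definition inLq f : Prop := measurable_fun [set: T] f /\ (lq f < +oo)%E.
Definition rlq f : R := fine (lq f).

Let q0 : 0 < q. Proof. exact: lt_le_trans q1. Qed.

Lemma lq_ge0 f : (0 <= lq f)%E. Proof. exact: poweR_ge0. Qed.

Lemma rlqK f : inLq f -> (rlq f)%:E = lq f.
Proof. by case=> _ foo; rewrite fineK// ge0_fin_numE// lq_ge0. Qed.

Lemma lqE f : lq f = ('N[mu]_q%:E[EFin \o f])%E.
Proof.
by rewrite unlock.
Qed.

Lemma measurable_powabs f : measurable_fun [set: T] f ->
  measurable_fun [set: T] (fun x => `|f x| `^ q).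
Proof. by move=> mf; apply: (measurable_powRr q); exact: measurableT_comp. Qed.

Lemma lq_lty f : (lq f < +oo)%E = (\int[mu]_x (`|f x| `^ q)%:E < +oo)%E.
Proof.
apply/idP/idP; last exact: poweR_lty.
by apply: lty_poweRy; rewrite invr_eq0 gt_eqF.
Qed.

Lemma lq_le f g : measurable_fun [set: T] f -> measurable_fun [set: T] g ->
  (forall x, `|f x| <= `|g x|) -> (lq f <= lq g)%E.
Proof.
move=> mf mg fg; have iq0 : 0 <= q^-1 by rewrite invr_ge0 ltW.
have I0 h : (0 <= \int[mu]_x (`|h x| `^ q)%:E)%E.
  by apply: integral_ge0 => x _; rewrite lee_fin powR_ge0.
apply: gt0_ler_poweR => //; rewrite ?in_itv/= ?I0 ?leey//.
apply: ge0_le_integral => //.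
- by apply/measurable_EFinP; exact: measurable_powabs.
- by apply/measurable_EFinP; exact: measurable_powabs.
- by move=> x _; rewrite lee_fin ler_powR2// ltW.
Qed.

Lemma inLq_le f g : measurable_fun [set: T] f -> inLq g ->
  (forall x, `|f x| <= `|g x|) -> inLq f /\ rlq f <= rlq g.
Proof.
move=> mf Xg fg; have [mg goo] := Xg; have h := lq_le mf mg fg.
have Xf : inLq f by split; [exact: mf|exact: le_lt_trans goo].
by split; [exact: Xf|rewrite -lee_fin (rlqK Xf) (rlqK Xg)].
Qed.

Lemma lq_scale (a : R) f : measurable_fun [set: T] f ->
  lq (fun x => a * f x) = (`|a|%:E * lq f)%E.
Proof.
move=> mf; rewrite /lq.
have -> : (\int[mu]_x (`|a * f x| `^ q)%:E =
    (`|a| `^ q)%:E * \int[mu]_x (`|f x| `^ q)%:E)%E.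
  rewrite -ge0_integralZl//.
    by apply: eq_integral => x _; rewrite normrM powRM.
  by apply/measurable_EFinP; exact: measurable_powabs.
have I0 : (0 <= \int[mu]_x (`|f x| `^ q)%:E)%E.
  by apply: integral_ge0 => x _; rewrite lee_fin powR_ge0.
have a0 : (0 <= (`|a| `^ q)%:E)%E by rewrite lee_fin powR_ge0.
by rewrite (poweRM _ a0 I0) poweR_EFin -powRrM mulfV ?gt_eqF// powRr1.
Qed.

Lemma inLq_comb (a : R) f g : inLq f -> inLq g ->
  inLq (fun x => a * f x + g x) /\
  rlq (fun x => a * f x + g x) <= `|a| * rlq f + rlq g.
Proof.
move=> Xf Xg; have [mf foo] := Xf; have [mg goo] := Xg.
have maf : measurable_fun [set: T] (fun x => a * f x) by exact: measurable_funM.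
have mafg : measurable_fun [set: T] (fun x => a * f x + g x).
  exact: measurable_funD.
have h : (lq (fun x => (a * f x + g x)%R) <= (`|a| * rlq f + rlq g)%:E)%E.
  rewrite EFinD EFinM !rlqK// -lq_scale// !lqE.
  exact: (minkowski_EFin mu maf mg q1).
have X : inLq (fun x => a * f x + g x).
  by split; [exact: mafg|exact: le_lt_trans h (ltry _)].
by split; [exact: X|rewrite -lee_fin (rlqK X)].
Qed.

Lemma inLqB f g : inLq f -> inLq g -> inLq (fun x => f x - g x).
Proof.
move=> Xf Xg; have [+ _] := inLq_comb (-1) Xg Xf.
by rewrite (_ : (fun x => -1 * g x + f x) = (fun x => f x - g x))//;
  apply/funext => x; rewrite mulN1r addrC.
Qed.

Lemma rlq_distC f g : rlq (fun x => f x - g x) = rlq (fun x => g x - f x).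
Proof.
apply: (congr1 (fun I => fine (I `^ q^-1)%E)); apply: eq_integral => x _.
by rewrite distrC.
Qed.

Lemma rlq_triangle f g h : inLq f -> inLq g -> inLq h ->
  rlq (fun x => f x - h x) <=
  rlq (fun x => f x - g x) + rlq (fun x => g x - h x).
Proof.
move=> Xf Xg Xh; have [_] := inLq_comb 1 (inLqB Xf Xg) (inLqB Xg Xh).
have -> : (fun x => 1 * (f x - g x) + (g x - h x)) = (fun x => f x - h x).
  by apply/funext => x; rewrite mul1r addrA subrK.
by rewrite normr1 mul1r.
Qed.

Lemma rlq_ae0 f : measurable_fun [set: T] f ->
  (\forall x \ae mu, f x = 0) -> inLq f /\ rlq f = 0.
Proof.
move=> mf f0; have I0 : (\int[mu]_x (`|f x| `^ q)%:E = 0)%E.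
  rewrite -[RHS](integral0 mu [set: T]); apply: ae_eq_integral => //.
    by apply/measurable_EFinP; exact: measurable_powabs.
  by apply: filterS f0 => x -> _; rewrite normr0 powR0// gt_eqF.
have h : lq f = 0%E by rewrite /lq I0 poweR0r// gt_eqF// invr_gt0.
by split; [split => //; rewrite h ltry|rewrite /rlq h].
Qed.

Lemma rlq_cvg0 (f_ : nat -> T -> R) g : (forall n, measurable_fun [set: T] (f_ n)) ->
  inLq g -> (forall n x, `|f_ n x| <= `|g x|) ->
  (forall x, f_ ^~ x @ \oo --> (0 : R)) ->
  rlq (f_ n) @[n --> \oo] --> (0 : R).
Proof.
move=> mf [mg goo] fg f0; have iq0 : 0 < q^-1 by rewrite invr_gt0.
pose h n x := (`|f_ n x| `^ q)%:E; pose G x := (`|g x| `^ q)%:E.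
have h0 n x : (0 <= h n x)%E by rewrite lee_fin powR_ge0.
have mh n : measurable_fun [set: T] (h n).
  by apply/measurable_EFinP; exact: measurable_powabs.
have iG : mu.-integrable [set: T] G.
  apply/integrableP; split; first by apply/measurable_EFinP; exact: measurable_powabs.
  under eq_integral do rewrite gee0_abs ?lee_fin ?powR_ge0//.
  by rewrite -lq_lty.
have hG n x : (h n x <= G x)%E by rewrite lee_fin ler_powR2// ltW.
have [_ _] : [/\ mu.-integrable [set: T] (cst 0%E : T -> \bar R),
  [sequence \int[mu]_(x in [set: T]) `|h n x - cst 0%E x|]_n @ \oo --> 0%E &
  [sequence \int[mu]_(x in [set: T]) h n x]_n @ \oo -->
    (\int[mu]_(x in [set: T]) cst 0%E x)]%E.
  apply: (@dominated_convergence _ _ _ mu _ _ h _ G) => //.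
  - apply: aeW => x _; apply/fine_cvgP; split; first exact: nearW.
    apply/cvgrPdist_lt => eps eps0.
    have e1 : 0 < eps `^ q^-1 by exact: powR_gt0.
    have /cvgrPdist_lt/(_ _ e1) := f0 x; apply: filterS => n.
    rewrite !sub0r !normrN /= => hn; rewrite ger0_norm ?powR_ge0//.
    have := @gt0_ltr_powR _ q q0 _ _ _ _ hn; rewrite !nnegrE normr_ge0 powR_ge0.
    by move=> /(_ isT isT); rewrite -powRrM mulVf ?gt_eqF// powRr1// ltW.
  - by apply: aeW => x n _; rewrite gee0_abs.
rewrite integral0 => /fine_cvgP[hfin] /cvgrPdist_lt hc.
apply/cvgrPdist_lt => eps eps0; have e1 : 0 < eps `^ q by exact: powR_gt0.
have := hc _ e1; apply: filter_app; apply: filterS hfin => n.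
rewrite !sub0r !normrN /rlq /lq /=.
have I0 : (0 <= \int[mu]_x h n x)%E by exact: integral_ge0.
rewrite -/(h n); move: I0; case: (\int[mu]_x _)%E => //= I.
rewrite lee_fin => I0 _; rewrite !ger0_norm ?powR_ge0// => hI.
have := @gt0_ltr_powR _ _ iq0 _ _ _ _ hI; rewrite !nnegrE I0 powR_ge0.
by move=> /(_ isT isT); rewrite -powRrM mulfV ?gt_eqF// powRr1// ltW.
Qed.

End LqNorm.

(** * The Riesz representation theorem *)

(** The series of the indicators of sets of finite measure that cover the space,
    with coefficients that make both the series and its integral finite. *)
Lemma ex_pos_integrable d (T : measurableType d) (R : realType)
    (mu : {sigma_finite_measure set T -> \bar R}) :
  exists kap : T -> R, [/\ measurable_fun [set: T] kap, forall x, 0 < kap x &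
    (\int[mu]_x (kap x)%:E < +oo)%E].
Proof.
have [F FT /all_and2[mF Foo]] := sigma_finiteT mu.
pose b k : R := 1 / (2 ^ k.+1)%:R.
pose c k : R := b k / (1 + fine (mu (F k))).
have b0 k : 0 < b k by rewrite divr_gt0// ltr0n expn_gt0.
have m0 k : 0 <= fine (mu (F k)) by exact: fine_ge0.
have m1 k : 0 < 1 + fine (mu (F k)) by rewrite ltr_wpDr.
have c0 k : 0 < c k by exact: divr_gt0.
have cb k : c k <= b k.
  by rewrite /c ler_pdivrMr// ler_peMr ?lerDl// ltW.
have cmb k : ((c k)%:E * mu (F k) <= (b k)%:E)%E.
  have mfin : mu (F k) \is a fin_num by rewrite ge0_fin_numE//; exact: Foo.
  rewrite -[X in (_ * X)%E](fineK mfin) -EFinM lee_fin /c mulrAC.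
  by rewrite ler_pdivrMr// ler_wpM2l ?lerDr// ltW.
pose h k x : \bar R := (c k * \1_(F k) x)%:E.
have h0 k x : (0 <= h k x)%E by rewrite lee_fin mulr_ge0 ?ler0n ?(ltW (c0 _)).
have mh k : measurable_fun [set: T] (h k).
  by apply/measurable_EFinP; apply: measurable_funM => //; exact: measurable_indic.
pose H x := (\sum_(k <oo) h k x)%E.
have sumb : (\sum_(k <oo) (b k)%:E <= 1)%E := epsilon_trick0 xpredT ler01.
have HE1 x : (H x <= 1)%E.
  apply: le_trans sumb; apply: lee_nneseries => k *; first exact: h0.
  rewrite /h lee_fin indicE; case: (_ \in _); rewrite ?mulr1 ?mulr0//; exact: ltW.
have Hp x : (0 < H x)%E.
  have [k _ Fk] : (\bigcup_k F k) x by rewrite -FT.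
  rewrite /H (@nneseriesD1 _ _ k)// /h lte_paddr//.
    by apply: nneseries_ge0 => i *; exact: h0.
  by rewrite lte_fin indicE mem_set// mulr1.
have Hf x : (fine (H x))%:E = H x.
  by rewrite fineK// ge0_fin_numE ?ltW// (le_lt_trans (HE1 x))// ltry.
have mH : measurable_fun [set: T] H by apply: ge0_emeasurable_sum.
exists (fun x => fine (H x)); split.
- exact: measurableT_comp.
- by move=> x; rewrite -lte_fin Hf.
rewrite (eq_integral H); last by move=> x _; rewrite Hf.
rewrite integral_nneseries//; apply: (@le_lt_trans _ _ 1%E); last exact: ltry.
apply: le_trans sumb; apply: lee_nneseries => k *; first exact: integral_ge0.
apply: le_trans (cmb k); rewrite /h.
under eq_integral => x _ do rewrite EFinM.
have mi : measurable_fun [set: T] (fun x => (\1_(F k) x)%:E : \bar R).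
  by apply/measurable_EFinP; exact: measurable_indic.
have ck : (0 <= (c k)%:E)%E by rewrite lee_fin ltW.
have i0 x : [set: T] x -> (0 <= (\1_(F k) x)%:E :> \bar R)%E by rewrite lee_fin.
by rewrite (ge0_integralZl mu measurableT mi i0 ck) integral_indic// setIT.
Qed.

Lemma measurable_le_set d (T : measurableType d) (R : realType) (f g : T -> R) :
  measurable_fun [set: T] f -> measurable_fun [set: T] g ->
  measurable [set x | f x <= g x].
Proof.
move=> mf mg; rewrite -[X in measurable X]setTI.
by apply: (measurable_lee measurableT (f := EFin \o f) (g := EFin \o g)); apply/measurable_EFinP.
Qed.

Import HBSimple HBNNSimple.

(** A bounded linear functional on the Lebesgue space of exponent [q] is the
    integration against a function in the dual space. A positive function
    [theta] in the space serves as reference: [A |-> Lam (theta * \1_A)] is a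
    finite signed measure, absolutely continuous with respect to [mu], and its
    Radon-Nikodym derivative divided by [theta] is the function wanted. *)
Section Riesz.
Context d {T : measurableType d} {R : realType}.
Variable mu : {sigma_finite_measure set T -> \bar R}.
Variables p q : R.
Hypothesis p1 : 1 < p.
Hypothesis q1 : 1 < q.
Hypothesis pq : p^-1 + q^-1 = 1.
Variables (Lam : (T -> R) -> R) (K : R).
Implicit Types (f g phi psi : T -> R).
Local Notation X := (inLq mu q).
Local Notation N := (rlq mu q).
Hypothesis Lam_comb : forall (a : R) phi psi, X phi -> X psi ->
  Lam (fun x => a * phi x + psi x) = a * Lam phi + Lam psi.
Hypothesis Lam_le : forall phi, X phi -> `|Lam phi| <= K * N phi.

Let q1' : 1 <= q. Proof. exact: ltW. Qed.
Let q0 : 0 < q. Proof. exact: lt_trans q1. Qed.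
Let p0 : 0 < p. Proof. exact: lt_trans p1. Qed.

Let X0 : X (cst 0).
Proof. by have [] := rlq_ae0 q1' (measurable_cst (0 : R)) (aeW mu (fun x => erefl)). Qed.

Let LamB phi psi : X phi -> X psi ->
  `|Lam phi - Lam psi| <= K * N (fun x => phi x - psi x).
Proof.
move=> Xp Xq; rewrite [Lam phi - _]addrC -mulN1r -Lam_comb//.
have -> : (fun x => -1 * psi x + phi x) = (fun x => phi x - psi x).
  by apply/funext => x; rewrite mulN1r addrC.
exact/Lam_le/inLqB.
Qed.

Let Lam_cvg (phi_ : nat -> T -> R) phi psi :
  (forall n, measurable_fun [set: T] (phi_ n)) -> measurable_fun [set: T] phi ->
  X psi -> (forall n x, `|phi_ n x| <= `|psi x|) -> (forall x, phi_ ^~ x @ \oo --> phi x) ->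
  X phi /\ Lam (phi_ n) @[n --> \oo] --> Lam phi.
Proof.
move=> mn mp Xq nq np.
have pq' x : `|phi x| <= `|psi x|.
  have h : `|phi_ n x| @[n --> \oo] --> `|phi x| by apply: cvg_norm; exact: np.
  rewrite -(cvg_lim _ h)//.
  by apply: limr_le; [apply/cvg_ex; eexists; exact: h|exact: nearW].
have [Xp _] := inLq_le q1' mp Xq pq'; split => //.
have X2 : X (fun x => 1 * psi x + psi x) by have [] := inLq_comb q1' 1 Xq Xq.
have h : N (fun x => phi_ n x - phi x) @[n --> \oo] --> (0 : R).
  apply: (rlq_cvg0 q1' _ X2) => [n|n x|x]; first exact: measurable_funB.
    rewrite mul1r -mulr2n normrMn mulr2n.
    by apply: le_trans (ler_normB _ _) _; exact: lerD.
  by have := cvgB (np x) (cvg_cst (phi x)); rewrite subrr; apply.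
have {}h : K * N (fun x => phi_ n x - phi x) @[n --> \oo] --> (0 : R).
  by rewrite -[X in _ --> X](mulr0 K); exact: cvgMr.
apply/cvgrPdist_le => e e0; have /cvgrPdist_le/(_ _ e0) := h.
apply: filterS => n; rewrite sub0r normrN => hn.
rewrite distrC; apply: le_trans (LamB _ Xp) (le_trans (ler_norm _) hn).
by have [] := inLq_le q1' (mn n) Xq (nq n).
Qed.

Section Density.
Variable theta : T -> R.
Hypothesis theta0 : forall x, 0 < theta x.
Hypothesis Xtheta : X theta.

Let onset (A : set T) x := theta x * \1_A x.

Let onset_le A x : `|onset A x| <= `|theta x|.
Proof.
rewrite /onset normrM ler_piMr// indicE; case: (_ \in _);
  by rewrite ?normr1 ?normr0.
Qed.

Let m_onset A : measurable A -> measurable_fun [set: T] (onset A).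
Proof. by move=> mA; apply: measurable_funM (Xtheta.1) (measurable_indic mA). Qed.

Let X_onset A : measurable A -> X (onset A).
Proof. by move=> mA; have [] := inLq_le q1' (m_onset mA) Xtheta (onset_le A). Qed.

Definition set_extension (A : set T) : \bar R := (Lam (onset A))%:E.

Let set_extension0 : set_extension set0 = 0%E.
Proof.
rewrite /set_extension (_ : onset set0 = cst 0); last first.
  by apply/funext => x; rewrite /onset indic0 mulr0.
have := Lam_le X0.
have [_ ->] := rlq_ae0 q1' X0.1 (aeW mu (fun x => erefl)).
by rewrite mulr0 normr_le0 => /eqP ->.
Qed.

Let set_extension_fin A : measurable A -> set_extension A \is a fin_num.
Proof. by []. Qed.

Let onsetU A B : A `&` B = set0 ->
  onset (A `|` B) = (fun x => 1 * onset A x + onset B x).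
Proof.
move=> AB; apply/funext => x; rewrite /onset mul1r -mulrDr; congr (_ * _).
rewrite !indicE in_setU; have [xA|] := boolP (x \in A); last by rewrite add0r.
rewrite (_ : (x \in B) = false) ?addr0//; apply/negbTE/negP => xB.
suff : set0 x by []. 
by rewrite -AB; split; apply: set_mem.
Qed.

Let set_extension_sigma_additive : semi_sigma_additive set_extension.
Proof.
move=> F mF tF mUF.
have mU n : measurable (\big[setU/set0]_(i < n) F i) by exact: bigsetU_measurable.
have E n : (\sum_(0 <= i < n) set_extension (F i))%E =
    set_extension (\big[setU/set0]_(i < n) F i).
  elim: n => [|n IH]; first by rewrite big_geq// big_ord0 set_extension0.
  rewrite big_nat_recr//= IH big_ord_recr/= /set_extension -EFinD; congr EFin.
  have dF : \big[setU/set0]_(i < n) F i `&` F n = set0.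
    by apply: (@trivIset_bigsetUI _ predT) => //; rewrite /predT /= trueE.
  rewrite (onsetU dF) Lam_comb; [by rewrite mul1r|exact: X_onset|exact: X_onset].
under eq_fun do rewrite E.
apply/fine_cvgP; split; first exact: nearW.
have cF x : (fun n => onset (\big[setU/set0]_(i < n) F i) x) @ \oo -->
    onset (\bigcup_n F n) x.
  have [[k _ Fk]|nF] := pselect ((\bigcup_n F n) x).
    apply: cvg_near_cst; exists k.+1 => // n /= kn.
    rewrite /onset !indicE !mem_set//; first by exists k.
    by rewrite -bigcup_mkord; exists k.
  apply: cvg_near_cst; apply: nearW => n.
  rewrite /onset !indicE (memNset nF) memNset//.
  by rewrite -bigcup_mkord => -[j _ Fj]; apply: nF; exists j.
by have [] := Lam_cvg (fun n => m_onset (mU n)) (m_onset mUF) Xtheta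
  (fun n => onset_le (\big[setU/set0]_(i < n) F i)) cF.
Qed.

HB.instance Definition _ := @isCharge.Build _ _ _ set_extension
  set_extension0 set_extension_fin set_extension_sigma_additive.

Let set_extension_dominated : set_extension `<< mu.
Proof.
move=> A A0 B mB BA; rewrite /set_extension; congr EFin.
have := Lam_le (X_onset mB).
have h : \forall x \ae mu, onset B x = 0.
  exists B; split => //; first exact: A0.
  move=> x /= hx; apply: contrapT => nB; apply: hx.
  by rewrite /onset indicE memNset// mulr0.
have [_ ->] := rlq_ae0 q1' (m_onset mB) h.
by rewrite mulr0 normr_le0 => /eqP.
Qed.

Let rho x := fine (Radon_Nikodym set_extension mu x).

Let rhoE x : (rho x)%:E = Radon_Nikodym set_extension mu x.
Proof. by rewrite fineK// Radon_Nikodym_fin_num. Qed.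

Let rho_int : mu.-integrable [set: T] (fun x => (rho x)%:E).
Proof.
by rewrite (funext rhoE); exact: Radon_Nikodym_integrable set_extension_dominated.
Qed.

Let m_rho : measurable_fun [set: T] rho.
Proof. by apply/measurable_EFinP; exact: measurable_int rho_int. Qed.

Let set_extensionE A : measurable A ->
  (Lam (onset A))%:E = (\int[mu]_x (rho x * \1_A x)%:E)%E.
Proof.
move=> mA; have := Radon_Nikodym_integral set_extension_dominated mA.
rewrite -[(Lam _)%:E]/(set_extension A) => /= ->; rewrite integral_mkcond; apply: eq_integral => x _.
rewrite patchE -rhoE indicE; case: (_ \in _); by rewrite ?mulr1 ?mulr0.
Qed.

Definition density x := rho x / theta x.
Local Notation h := density.

Let m_theta : measurable_fun [set: T] theta. Proof. by case: Xtheta. Qed.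

Lemma measurable_density : measurable_fun [set: T] h.
Proof.
apply: measurable_funM => //; have -> : (fun x => (theta x)^-1) = (fun x => theta x `^ (- 1)).
  by apply/funext => x; rewrite powR_inv1// ltW.
exact: measurable_powRr.
Qed.

(* The functions on which the functional is represented by [h]. The class is
   linear and closed under dominated convergence, so that it grows from the
   functions [theta * \1_A] to all functions bounded by multiples of [theta]
   and, once [h] is known to be in the dual space, to the whole space. *)
Let rep phi := [/\ X phi, mu.-integrable [set: T] (fun x => (h x * phi x)%:E) &
  (Lam phi)%:E = (\int[mu]_x (h x * phi x)%:E)%E].

Let rep_onset A : measurable A -> rep (onset A).
Proof.
move=> mA; have E : (fun x => (h x * onset A x)%:E) = (fun x => (rho x * \1_A x)%:E).
  by apply/funext => x; rewrite /density /onset mulrA divfK// gt_eqF.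
split; rewrite ?E; [exact: X_onset| |exact: set_extensionE].
apply: le_integrable rho_int => //.
  by apply/measurable_EFinP; apply: measurable_funM => //; exact: measurable_indic.
move=> x _; rewrite /= lee_fin normrM ler_piMr// indicE; case: (_ \in _);
  by rewrite ?normr1 ?normr0.
Qed.

Let rep_comb (a : R) phi psi : rep phi -> rep psi -> rep (fun x => a * phi x + psi x).
Proof.
move=> [Xp Ip Ep] [Xq Iq Eq]; have [X' _] := inLq_comb q1' a Xp Xq.
have Iap := integrableZl measurableT a Ip.
have E : (fun x => (h x * (a * phi x + psi x))%:E) =
    (fun x => (a%:E * (h x * phi x)%:E)%E) \+ (fun x => (h x * psi x)%:E).
  by apply/funext => x /=; rewrite -EFinM -EFinD mulrDr mulrCA.
split => //; rewrite E; first exact: integrableD.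
by rewrite Lam_comb// EFinD EFinM Ep Eq integralD// integralZl.
Qed.

Let rep_cvg (phi_ : nat -> T -> R) phi psi : (forall n, rep (phi_ n)) ->
  measurable_fun [set: T] phi -> X psi -> mu.-integrable [set: T] (fun x => (h x * psi x)%:E) ->
  (forall n x, `|phi_ n x| <= `|psi x|) -> (forall x, phi_ ^~ x @ \oo --> phi x) ->
  rep phi.
Proof.
move=> rn mp Xq Iq nq np; have mn n : measurable_fun [set: T] (phi_ n).
  by case: (rn n) => -[].
have [Xp Lc] := Lam_cvg mn mp Xq nq np.
have mh := measurable_density.
have [|||||I _ Ic] := @dominated_convergence _ _ _ mu _ measurableT
  (fun n x => (h x * phi_ n x)%:E) (fun x => (h x * phi x)%:E)
  (fun x => `|(h x * psi x)%:E|%E).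
- by move=> n; apply/measurable_EFinP; exact: measurable_funM.
- by apply/measurable_EFinP; exact: measurable_funM.
- by apply: aeW => x _; apply: cvg_EFin; [exact: nearW|apply: cvgMr; exact: np].
- exact: integrable_abse.
- by apply: aeW => x n _; rewrite !abse_EFin lee_fin !normrM ler_wpM2l.
split => //.
have LE : (fun n => (Lam (phi_ n))%:E) = (fun n => (\int[mu]_x (h x * phi_ n x)%:E)%E).
  by apply/funext => n; case: (rn n).
have LcE : (Lam (phi_ n))%:E @[n --> \oo] --> (Lam phi)%:E.
  by apply: cvg_EFin => //; exact: nearW.
by rewrite LE in LcE; exact: cvg_unique LcE Ic.
Qed.

Let rep_sfun (s : {nnsfun T >-> R}) : rep (fun x => theta x * s x).
Proof.
have -> : (fun x => theta x * s x) = (fun x =>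
    \sum_(y <- finmap.enum_fset (fset_set (range s))) y * onset (s @^-1` [set y]) x).
  apply/funext => x; rewrite [in LHS](fimfunE s x) fsbig_finite//= mulr_sumr.
  by apply: eq_bigr => y _; rewrite /onset mulrCA.
elim: (finmap.enum_fset _) => [|y l IH].
  have -> : (fun x => \sum_(y <- [::]) y * onset (s @^-1` [set y]) x) = onset set0.
    by apply/funext => x; rewrite big_nil /onset indic0 mulr0.
  exact: rep_onset.
have -> : (fun x => \sum_(z <- y :: l) z * onset (s @^-1` [set z]) x) =
   (fun x => y * onset (s @^-1` [set y]) x + \sum_(z <- l) z * onset (s @^-1` [set z]) x).
  by apply/funext => x; rewrite big_cons.
by apply: rep_comb IH; exact: rep_onset.
Qed.

Let rep_ge0 phi (c : R) : measurable_fun [set: T] phi -> (forall x, 0 <= phi x) ->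
  (forall x, phi x <= c * theta x) -> rep phi.
Proof.
move=> mp p_0 pc; pose f x := (phi x / theta x)%:E.
have mf : measurable_fun [set: T] f.
  apply/measurable_EFinP; apply: measurable_funM => //.
  have -> : (fun x => (theta x)^-1) = (fun x => theta x `^ (- 1)).
    by apply/funext => x; rewrite powR_inv1// ltW.
  exact: measurable_powRr.
have f0 x : [set: T] x -> (0 <= f x)%E by move=> _; rewrite lee_fin divr_ge0// ltW.
pose a := nnsfun_approx measurableT mf.
have ac x : (fun n => theta x * a n x) @ \oo --> phi x.
  have := cvg_nnsfun_approx measurableT mf f0 (x := x) I.
  move=> /fine_cvgP[_] /= h1.
  rewrite (_ : phi x = theta x * (phi x / theta x)); first exact: cvgMr.
  by rewrite mulrC divfK// gt_eqF.
have X1 : X (fun x => c * theta x + 0 * theta x).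
  have [] := inLq_comb q1' c Xtheta (inLqB q1' Xtheta Xtheta); rewrite (_ : (fun x => c * theta x + (theta x - theta x)) = (fun x => c * theta x + 0 * theta x))//.
  by apply/funext => x; rewrite subrr mul0r.
have I1 : mu.-integrable [set: T] (fun x => (h x * (c * theta x + 0 * theta x))%:E).
  rewrite (_ : (fun x => _) = (fun x => c%:E * (rho x)%:E)%E); last first.
    by apply/funext => x; rewrite -EFinM mul0r addr0 /density mulrCA divfK// gt_eqF.
  exact: integrableZl.
apply: (rep_cvg (fun n => rep_sfun (a n)) mp X1 I1) => // n x.
rewrite mul0r addr0; have ctx : 0 <= c * theta x := le_trans (p_0 x) (pc x).
have th0 := ltW (theta0 x).
rewrite (ger0_norm ctx) ger0_norm ?mulr_ge0//.
apply: le_trans (pc x); rewrite -(@divfK _ (theta x) _ (phi x)) ?gt_eqF//.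
rewrite mulrC ler_wpM2r// -lee_fin; apply: (@le_trans _ _ (f x)) => //.
by rewrite /a nnsfun_approxE; exact: le_approx.
Qed.

Let rep_bounded phi (c : R) : measurable_fun [set: T] phi -> 
  (forall x, `|phi x| <= c * theta x) -> rep phi.
Proof.
move=> mp pc.
have mP : measurable_fun [set: T] (fun x => Num.max (phi x) 0).
  exact: measurable_maxr.
have mN : measurable_fun [set: T] (fun x => Num.max (- phi x) 0).
  by apply: measurable_maxr => //; exact: measurableT_comp.
have -> : phi = (fun x => -1 * Num.max (- phi x) 0 + Num.max (phi x) 0).
  apply/funext => x; rewrite mulN1r; case: (leP 0 (phi x)) => h0.
    by rewrite (max_r (_ : - phi x <= 0)) ?oppr_le0// oppr0 add0r.
  by rewrite (max_l (_ : 0 <= - phi x)) ?oppr_ge0 ?ltW// opprK addr0.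
apply: rep_comb; apply: (@rep_ge0 _ c) => // x; rewrite ?le_max ?lexx ?orbT//.
  rewrite ge_max (le_trans _ (pc x)) ?(le_trans (normr_ge0 _) (pc x))//.
  by rewrite -normrN ler_norm.
by rewrite ge_max (le_trans (ler_norm _) (pc x)) (le_trans (normr_ge0 _) (pc x)).
Qed.

Let pq' : (p - 1) * q = p.
Proof.
have pn : p != 0 by rewrite gt_eqF.
have qn : q != 0 by rewrite gt_eqF.
have : p * q * (p^-1 + q^-1) = p * q by rewrite pq mulr1.
rewrite mulrDr mulrAC mulfV// mul1r mulfK// => e.
by rewrite mulrBl mul1r -e addrC addKr.
Qed.

(* The extremal function [sgn h |h|^(p-1)] for the duality is cut where it is
   not bounded by a multiple of [theta]. *)
Let B n := [set x | `|h x| `^ (p - 1) <= n%:R * theta x].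

Let mB n : measurable (B n).
Proof.
have mhp : measurable_fun [set: T] (fun x => `|h x| `^ (p - 1)).
  apply: measurable_powRr; exact: measurableT_comp measurable_density.
have mnt : measurable_fun [set: T] (fun x => n%:R * theta x).
  exact: measurable_funM.
exact: measurable_le_set.
Qed.

Let cutp n x := `|h x| `^ p * \1_(B n) x.
Let cutphi n x := Num.sg (h x) * `|h x| `^ (p - 1) * \1_(B n) x.

Let pB0 : 0 < p - 1. Proof. by rewrite subr_gt0. Qed.

Let norm_cutphi n x : `|cutphi n x| = `|h x| `^ (p - 1) * \1_(B n) x.
Proof.
rewrite /cutphi; move: (h x) => y; rewrite !normrM (ger0_norm (powR_ge0 _ _)) normr_sg.
rewrite [`|\1_(B n) x|]ger0_norm//; have [->|y0] := eqVneq y 0; last by rewrite mul1r.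
by rewrite normr0 powR0 ?gt_eqF// mulr0.
Qed.

Let density_cutphi n x : h x * cutphi n x = cutp n x.
Proof.
rewrite /cutphi /cutp; move: (h x) => y; rewrite !mulrA; congr (_ * _).
rewrite [y * _]mulrC -normrEsg -{1}(powRr1 (normr_ge0 y)) -powRD ?subrKC//.
by rewrite (gt_eqF p0).
Qed.

Let cutphi_powr n x : `|cutphi n x| `^ q = cutp n x.
Proof.
rewrite norm_cutphi powRM ?powR_ge0// -powRrM pq' /cutp; congr (_ * _).
by rewrite indicE; case: (_ \in _) => /=; [rewrite powR1|rewrite powR0// gt_eqF].
Qed.

Let m_cutphi n : measurable_fun [set: T] (cutphi n).
Proof.
have mh := measurable_density.
apply: measurable_funM; last exact: measurable_indic (mB n).
apply: measurable_funM; last by apply: measurable_powRr; exact: measurableT_comp.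
rewrite (_ : (fun x => _) =
    (fun x => if h x == 0 then 0 else if h x < 0 then -1 else 1)); last first.
  by apply/funext => x; move: (h x) => y; rewrite /Num.sg.
apply: measurable_fun_ifT => //; first exact: measurable_fun_eqr.
by apply: measurable_fun_ifT => //; exact: measurable_fun_ltr.
Qed.

Let m_cutp n : measurable_fun [set: T] (cutp n).
Proof.
apply: measurable_funM; last exact: measurable_indic (mB n).
by apply: measurable_powRr; exact: measurableT_comp measurable_density.
Qed.

Let rep_cutphi n : rep (cutphi n).
Proof.
apply: (@rep_bounded _ n%:R) => // x; rewrite norm_cutphi indicE.
have [/set_mem xB|_] := boolP (x \in B n); first by rewrite mulr1.
by rewrite mulr0 mulr_ge0// ltW.
Qed.

Let cutp_le n : (\int[mu]_x (cutp n x)%:E <= (K `^ p)%:E)%E.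
Proof.
have [Xn _ Ln] := rep_cutphi n.
have E : (Lam (cutphi n))%:E = (\int[mu]_x (cutp n x)%:E)%E.
  by rewrite Ln; apply: eq_integral => x _; rewrite density_cutphi.
have J0 : 0 <= Lam (cutphi n).
  by rewrite -lee_fin E; apply: integral_ge0 => x _; rewrite lee_fin mulr_ge0 ?powR_ge0.
have NE : N (cutphi n) = Lam (cutphi n) `^ q^-1.
  rewrite /rlq /lq (_ : (\int[mu]_x _)%E = (Lam (cutphi n))%:E)//.
  by rewrite E; apply: eq_integral => x _; rewrite cutphi_powr.
rewrite -E lee_fin; have := Lam_le Xn; rewrite NE ger0_norm//.
move: (Lam _) J0 => J; rewrite le_eqVlt => /predU1P[<- _|J0 JK]; first exact: powR_ge0.
have J1 : J `^ p^-1 <= K.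
  have Jq : 0 < J `^ q^-1 by exact: powR_gt0.
  rewrite -(ler_pM2r Jq) -powRD; last by rewrite (gt_eqF J0) implybT.
  by rewrite pq powRr1// ltW.
have := ler_powR2 (ltW p0) (powR_ge0 _ _) J1.
by rewrite -powRrM mulVf ?gt_eqF// powRr1// ltW.
Qed.

Let cutp_cvg x : cutp ^~ x @ \oo --> `|h x| `^ p.
Proof.
have [k hk] : exists k : nat, `|h x| `^ (p - 1) / theta x <= k%:R.
  by exists (Num.truncn (`|h x| `^ (p - 1) / theta x)).+1; apply/ltW/truncnS_gt.
apply: cvg_near_cst; exists k => // n /= kn.
rewrite /cutp indicE mem_set ?mulr1// /B /= -ler_pdivrMr//.
by apply: le_trans hk _; rewrite ler_nat.
Qed.

Lemma density_powr : (\int[mu]_x (`|h x| `^ p)%:E <= (K `^ p)%:E)%E.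
Proof.
have -> : (\int[mu]_x (`|h x| `^ p)%:E = \int[mu]_x limn (fun n => (cutp n x)%:E))%E.
  apply: eq_integral => x _; apply/esym/cvg_lim => //.
  by apply: cvg_EFin; [exact: nearW|exact: cutp_cvg].
have c0 n x : [set: T] x -> (0 <= (cutp n x)%:E)%E.
  by rewrite lee_fin mulr_ge0 ?powR_ge0.
have mc n : measurable_fun [set: T] (fun x => (cutp n x)%:E).
  exact/measurable_EFinP.
have cn x : [set: T] x -> {homo (fun n => (cutp n x)%:E) : n m / (n <= m)%N >-> (n <= m)%E}.
  move=> _ n m nm; rewrite lee_fin /cutp ler_wpM2l ?powR_ge0// !indicE.
  have [/set_mem xB|//] := boolP (x \in B n); rewrite mem_set//.
  by apply: le_trans xB _; rewrite ler_pM2r// ler_nat.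
have C : (fun n => \int[mu]_x (cutp n x)%:E)%E @ \oo -->
    (\int[mu]_x limn (fun n => (cutp n x)%:E))%E.
  exact: (@cvg_monotone_convergence _ _ _ mu _ measurableT
    (fun n x => (cutp n x)%:E) mc c0 cn).
rewrite -(cvg_lim _ C)//; apply: lime_le; first by apply/cvg_ex; eexists; exact: C.
by apply: nearW.
Qed.

Let density_integrable phi : X phi -> mu.-integrable [set: T] (fun x => (h x * phi x)%:E).
Proof.
move=> [mp poo]; have mh := measurable_density.
apply/integrableP; split; first by apply/measurable_EFinP; exact: measurable_funM.
have E : (\int[mu]_x `|(h x * phi x)%:E| = \int[mu]_x (`|h x| * `|phi x|)%:E)%E.
  by apply: eq_integral => x _; rewrite abse_EFin normrM.
have mah : measurable_fun [set: T] (fun x => `|h x|) by exact: measurableT_comp.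
have map : measurable_fun [set: T] (fun x => `|phi x|) by exact: measurableT_comp.
rewrite E; apply: le_lt_trans (hoelder_ge0 mu measurableT mah map
  (fun x => normr_ge0 _) (fun x => normr_ge0 _) p0 q0 pq) _.
apply: lte_mul_pinfty; first exact: poweR_ge0.
  rewrite ge0_fin_numE ?poweR_ge0//; apply: poweR_lty.
  by apply: le_lt_trans density_powr _; rewrite ltry.
exact: poo.
Qed.

Let rep_inLq phi : X phi -> rep phi.
Proof.
move=> Xp; have [mp _] := Xp.
pose S n := [set x | `|phi x| <= n%:R * theta x].
have mS n : measurable (S n).
  have mnt : measurable_fun [set: T] (fun x => n%:R * theta x).
    exact: measurable_funM.
  have map : measurable_fun [set: T] (fun x => `|phi x|) by exact: measurableT_comp.
  exact: measurable_le_set.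
pose c n x := phi x * \1_(S n) x.
have mc n : measurable_fun [set: T] (c n) by exact: measurable_funM mp (measurable_indic (mS n)).
have rc n : rep (c n).
  apply: (@rep_bounded _ n%:R) => // x; rewrite /c indicE.
  have [/set_mem xS|_] := boolP (x \in S n); first by rewrite mulr1.
  by rewrite mulr0 normr0 mulr_ge0// ltW.
apply: (rep_cvg rc mp Xp (density_integrable Xp)) => [n x|x].
  by rewrite /c normrM ler_piMr// indicE; case: (_ \in _); rewrite ?normr1 ?normr0.
have [k hk] : exists k : nat, `|phi x| / theta x <= k%:R.
  by exists (Num.truncn (`|phi x| / theta x)).+1; apply/ltW/truncnS_gt.
apply: cvg_near_cst; exists k => // n /= kn.
rewrite /c indicE mem_set ?mulr1// /S /= -ler_pdivrMr//.
by apply: le_trans hk _; rewrite ler_nat.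
Qed.

Lemma density_representation : exists g, [/\ measurable_fun [set: T] g,
  (\int[mu]_x (`|g x| `^ p)%:E <= (K `^ p)%:E)%E &
  forall phi, X phi -> mu.-integrable [set: T] (fun x => (g x * phi x)%:E) /\
    (Lam phi)%:E = (\int[mu]_x (g x * phi x)%:E)%E].
Proof.
exists h; split; [exact: measurable_density|exact: density_powr|].
by move=> phi /rep_inLq[].
Qed.

End Density.

Lemma riesz_lq : exists g, [/\ measurable_fun [set: T] g,
  (\int[mu]_x (`|g x| `^ p)%:E <= (K `^ p)%:E)%E &
  forall phi, X phi -> mu.-integrable [set: T] (fun x => (g x * phi x)%:E) /\
    (Lam phi)%:E = (\int[mu]_x (g x * phi x)%:E)%E].
Proof.
have [kap [mk k0 koo]] := ex_pos_integrable mu.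
have t0 x : 0 < kap x `^ q^-1 by exact: powR_gt0.
apply: (density_representation t0); split; first exact: measurable_powRr.
rewrite lq_lty//; apply: le_lt_trans koo; rewrite le_eqVlt; apply/orP; left; apply/eqP.
apply: eq_integral => x _; rewrite ger0_norm ?powR_ge0// -powRrM mulVf ?gt_eqF//.
by rewrite powRr1// ltW.
Qed.

End Riesz.

(** * Duality against a dense space of test functions *)

Lemma dist_arith (R : realFieldType) (K m l d e : R) : 0 <= K ->
  m <= l + d -> l <= e -> K * m + K * l <= K * d + K * 2 * e.
Proof.
move=> K0 h1 h2; rewrite -mulrDr -mulrA -mulrDr ler_wpM2l//; lra.
Qed.

Lemma comb_arith (R : realFieldType) (K a x y z f1 f2 e : R) : 0 <= K -> 0 <= a ->
  x <= y + z -> z <= a * f1 + f2 -> f1 <= e -> f2 <= e ->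
  K * x + (a * (K * f1) + K * f2) <= K * y + K * (2 * (a + 1)) * e.
Proof.
move=> K0 a0 h1 h2 h3 h4.
have -> : K * x + (a * (K * f1) + K * f2) = K * (x + (a * f1 + f2)) by ring.
rewrite -mulrA -mulrDr ler_wpM2l//.
have h5 : a * f1 <= a * e by rewrite ler_wpM2l.
have -> : 2 * (a + 1) * e = 2 * (a * e) + 2 * e by ring.
move: (a * f1) (a * e) h2 h5 => u v *; lra.
Qed.

Lemma dist_split (R : realFieldType) (g l m : R) : l - m = (g - m) - (g - l).
Proof. by ring. Qed.

Lemma comb_split (R : realFieldType) (a g f h l m : R) :
  g - (a * l + m) = (g - (a * f + h)) + (a * (f - l) + (h - m)).
Proof. by ring. Qed.

Section Duality.
Context d {T : measurableType d} {R : realType}.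
Variable mu : {sigma_finite_measure set T -> \bar R}.
Variables p q : R.
Hypothesis p1 : 1 < p.
Hypothesis q1 : 1 < q.
Hypothesis pq : p^-1 + q^-1 = 1.
Variable D : set (T -> R).
Hypothesis D0 : D (cst 0).
Hypothesis DX : forall g, D g -> inLq mu q g.
Hypothesis Dlin : forall (a : R) f g, D f -> D g -> D (fun x => a * f x + g x).
Hypothesis Ddense : forall f (e : R), inLq mu q f -> 0 < e ->
  exists2 g, D g & rlq mu q (fun x => f x - g x) < e.
Variables (u : T -> R) (K : R).
Hypothesis mU : measurable_fun [set: T] u.
Hypothesis K0 : 0 <= K.
Hypothesis uK : forall g, D g ->
  (`| \int[mu]_x (u x * g x)%:E | <= (K * rlq mu q g)%:E)%E.
Implicit Types (f g phi psi : T -> R) (L M : R).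

Let q1' : 1 <= q. Proof. exact: ltW. Qed.
Let q0 : 0 < q. Proof. exact: lt_trans q1. Qed.
Let p0 : 0 < p. Proof. exact: lt_trans p1. Qed.
Local Notation X := (inLq mu q).
Local Notation N := (rlq mu q).
Let pair g := fine (\int[mu]_x (u x * g x)%:E)%E.

Lemma pairing_integrable g : D g -> mu.-integrable [set: T] (fun x => (u x * g x)%:E).
Proof.
move=> Dg; have [mg _] := DX Dg.
have mug : measurable_fun [set: T] (fun x => (u x * g x)%:E).
  by apply/measurable_EFinP; exact: measurable_funM.
pose f x := (u x * g x)%:E.
have P0 : (0 <= \int[mu]_x f^\+ x)%E by exact: integral_ge0.
have N0 : (0 <= \int[mu]_x f^\- x)%E by exact: integral_ge0.
apply/integrableP; split => //.
have -> : (\int[mu]_x `|f x| = \int[mu]_x f^\+ x + \int[mu]_x f^\- x)%E.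
  rewrite -ge0_integralD//; first by rewrite -fune_abse.
    exact: measurable_funepos.
  exact: measurable_funeneg.
have := uK Dg; rewrite integralE -/f; move: P0 N0.
by case: (\int[mu]_x f^\+ x)%E; case: (\int[mu]_x f^\- x)%E => //= a b _ _ _; rewrite -EFinD ltry.
Qed.

Let pair_lin (a : R) f g : D f -> D g ->
  pair (fun x => a * f x + g x) = a * pair f + pair g.
Proof.
move=> Df Dg; have If := pairing_integrable Df; have Ig := pairing_integrable Dg.
have Iaf := integrableZl measurableT a If.
rewrite /pair (_ : (\int[mu]_x (u x * (a * f x + g x))%:E =
    a%:E * \int[mu]_x (u x * f x)%:E + \int[mu]_x (u x * g x)%:E)%E).
  rewrite fineD ?fineM//; try exact: integrable_fin_num.
  by rewrite fin_numM//; exact: integrable_fin_num.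
rewrite -integralZl// -integralD//; apply: eq_integral => x _.
by rewrite -EFinM -EFinD mulrDr mulrCA.
Qed.

Let pair_le g : D g -> `|pair g| <= K * N g.
Proof.
move=> Dg; have := uK Dg; rewrite -(@fineK _ (\int[mu]_x _)%E)//.
exact: integrable_fin_num (pairing_integrable Dg).
Qed.

Let DB f g : D f -> D g -> D (fun x => f x - g x).
Proof.
move=> Df Dg; have := Dlin (-1) Dg Df; congr D; apply/funext => x.
by rewrite mulN1r addrC.
Qed.

Let pairB f g : D f -> D g -> pair (fun x => f x - g x) = pair f - pair g.
Proof.
move=> Df Dg; rewrite -[RHS]addrC -mulN1r -pair_lin//; congr pair.
by apply/funext => x; rewrite mulN1r addrC.
Qed.

(** The pairing with [u] has Lipschitz constant [K] on test functions. The
    number [L] is a value at [phi] that respects this constant. Such a number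
    exists by the argument of Hahn and Banach for one more vector, and it is
    unique by density. *)
Definition extends phi L := forall g, D g -> `|pair g - L| <= K * N (fun x => g x - phi x).

Lemma extends_ex phi : X phi -> exists L, extends phi L.
Proof.
move=> Xp; pose S : set R :=
  [set r | exists2 g, D g & r = pair g - K * N (fun x => g x - phi x)].
have S0 : S !=set0 by exists (pair (cst 0) - K * N (fun x => cst 0 x - phi x)); exists (cst 0).
have ubS g : D g -> ubound S (pair g + K * N (fun x => g x - phi x)).
  move=> Dg _ [f Df ->]; rewrite lerBlDr -addrA -mulrDr -lerBlDl.
  apply: (le_trans (ler_norm _)); rewrite -pairB//.
  apply: (le_trans (pair_le (DB Df Dg))); apply: ler_wpM2l => //.
  rewrite addrC [N (fun x => g x - phi x)]rlq_distC.
  exact: rlq_triangle (DX Df) Xp (DX Dg).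
exists (sup S) => g Dg; rewrite ler_distl; apply/andP; split.
  by rewrite lerBlDr; apply: ge_sup S0 (ubS _ Dg).
rewrite -lerBlDr; apply: ub_le_sup; last by exists g.
by exists (pair g + K * N (fun x => g x - phi x)); exact: ubS.
Qed.

Let le_eps (x y c : R) : 0 <= c -> (forall e, 0 < e -> x <= y + c * e) -> x <= y.
Proof.
move=> c0 h; apply/ler_addgt0Pr => e e0.
have c1 : 0 < c + 1 by rewrite ltr_wpDl.
apply: le_trans (h (e / (c + 1)) _) _; first exact: divr_gt0.
by rewrite lerD2l mulrCA ler_piMr ?(ltW e0)// ler_pdivrMr// mul1r lerDl.
Qed.

Lemma extends_dist phi psi L M : X phi -> X psi ->
  extends phi L -> extends psi M -> `|L - M| <= K * N (fun x => phi x - psi x).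
Proof.
move=> Xp Xq eL eM; apply: (@le_eps _ _ (K * 2)); first exact: mulr_ge0.
move=> e e0; have [g Dg ge] := Ddense Xp e0; have Xg := DX Dg.
rewrite (dist_split (pair g)).
apply: le_trans (ler_normB _ _) _; apply: le_trans (lerD (eM _ Dg) (eL _ Dg)) _.
have := rlq_triangle q1' Xg Xp Xq; rewrite (rlq_distC mu q g phi) => h.
exact: dist_arith K0 h (ltW ge).
Qed.

Lemma extends_comb (a : R) phi psi L M : X phi -> X psi ->
  extends phi L -> extends psi M ->
  extends (fun x => a * phi x + psi x) (a * L + M).
Proof.
move=> Xp Xq eL eM g Dg; have Xg := DX Dg.
apply: (@le_eps _ _ (K * (2 * (`|a| + 1)))); first by rewrite !mulr_ge0// addr_ge0.
move=> e e0; have [f Df fe] := Ddense Xp e0; have [h Dh he] := Ddense Xq e0.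
have Xf := DX Df; have Xh := DX Dh; have Dfh := Dlin a Df Dh.
have [Xpq _] := inLq_comb q1' a Xp Xq.
have [Xfh _] := inLq_comb q1' a Xf Xh.
rewrite (comb_split a _ (pair f) (pair h)) -pair_lin// -pairB//.
apply: le_trans (ler_normD _ _) _.
apply: le_trans (lerD (pair_le (DB Dg Dfh)) (ler_normD _ _)) _.
rewrite normrM; have H1 := ler_wpM2l (normr_ge0 a) (eL _ Df).
apply: (le_trans (lerD (lexx _) (lerD H1 (eM _ Dh)))).
have T1 := rlq_triangle q1' Xg Xpq Xfh.
have [_ T2] := inLq_comb q1' a (inLqB q1' Xp Xf) (inLqB q1' Xq Xh).
have E : (fun x => a * phi x + psi x - (a * f x + h x)) =
         (fun x => a * (phi x - f x) + (psi x - h x)).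
  by apply/funext => x; ring.
rewrite E in T1; rewrite (rlq_distC mu q f phi) (rlq_distC mu q h psi).
exact: comb_arith K0 (normr_ge0 a) T1 T2 (ltW fe) (ltW he).
Qed.

Definition extension phi : R := xget 0 [set L | extends phi L].
Local Notation Lam := extension.

Lemma extensionP phi : X phi -> extends phi (Lam phi).
Proof.
by move=> /extends_ex[L eL]; rewrite /extension; case: xgetP => [y _ //|/(_ L)].
Qed.

Lemma extension_uniq phi L : X phi -> extends phi L -> Lam phi = L.
Proof.
move=> Xp eL; have := extends_dist Xp Xp (extensionP Xp) eL.
have [_ ->] := @rlq_ae0 _ _ _ mu q q1' (fun x => phi x - phi x)
  (measurable_funB Xp.1 Xp.1) (aeW mu (fun x => subrr (phi x))).
by rewrite mulr0 normr_le0 subr_eq0 => /eqP.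
Qed.

Lemma extension_comb (a : R) phi psi : X phi -> X psi ->
  Lam (fun x => a * phi x + psi x) = a * Lam phi + Lam psi.
Proof.
move=> Xp Xq; have [Xpq _] := inLq_comb q1' a Xp Xq.
apply: (extension_uniq Xpq).
by apply: extends_comb; [exact: Xp|exact: Xq|exact: extensionP|exact: extensionP].
Qed.

Lemma extension_test g : D g -> Lam g = pair g.
Proof.
move=> Dg; apply: extension_uniq; first exact: DX.
by move=> f Df; rewrite -pairB//; exact/pair_le/DB.
Qed.

Lemma extension_le phi : X phi -> `|Lam phi| <= K * N phi.
Proof.
move=> Xp; have := extensionP Xp D0; rewrite (rlq_distC mu q (cst 0) phi).
rewrite (_ : (fun x => phi x - cst 0 x) = phi); last first.
  by apply/funext => x; rewrite subr0.
rewrite (_ : pair (cst 0) = 0) ?sub0r ?normrN//.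
rewrite /pair (_ : (\int[mu]_x _)%E = 0%E)//.
by under eq_integral do rewrite mulr0; rewrite integral0.
Qed.

(** Density alone does not allow the conclusion, because approximation in norm
    gives no control of the pairing with [u], which is not known to be in the
    dual space. The function that represents the extended functional is in the
    dual space, and [Dsep] identifies it with [u]. *)
Hypothesis Dsep : forall v : T -> R, measurable_fun [set: T] v ->
  (forall g, D g -> mu.-integrable [set: T] (fun x => (v x * g x)%:E) /\
     (\int[mu]_x (v x * g x)%:E = 0)%E) -> \forall x \ae mu, v x = 0.

Lemma lq_duality : (\int[mu]_x (`|u x| `^ p)%:E <= (K `^ p)%:E)%E.
Proof.
have [h [mh hK hrep]] := riesz_lq p1 q1 pq extension_comb extension_le.
have mv : measurable_fun [set: T] (fun x => u x - h x) by exact: measurable_funB.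
have uh : \forall x \ae mu, u x - h x = 0.
  apply: Dsep => // g Dg; have [ih hE] := hrep _ (DX Dg).
  have iu := pairing_integrable Dg.
  have E : (fun x => ((u x - h x) * g x)%:E) =
      ((fun x => (u x * g x)%:E) \- (fun x => (h x * g x)%:E))%E.
    by apply/funext => x /=; rewrite -EFinB mulrBl.
  rewrite E; split; first exact: integrableB.
  rewrite integralB// -hE extension_test// fineK ?subee//; exact: integrable_fin_num.
apply: le_trans hK; rewrite le_eqVlt; apply/orP; left; apply/eqP.
apply: ae_eq_integral => //.
- by apply/measurable_EFinP; apply: measurable_powabs.
- by apply/measurable_EFinP; apply: measurable_powabs.
- by apply: filterS uh => x /eqP; rewrite subr_eq0 => /eqP ->.
Qed.

End Duality.

(** * Duality for weighted norms *)

Section WeightedDuality.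
Context {R : realType} {n : nat}.
Local Notation Rn := (Rn R n).
Variable mu : {measure set Rn -> \bar R}.
Hypothesis dmu : doubling mu.

Lemma doubling_sigma_finite : sigma_finite [set: Rn] mu.
Proof.
pose B (k : nat) : set Rn := eball 0 k.+1%:R.
have k0 k : 0 < k.+1%:R :> R by rewrite ltr0n.
exists B => [|k]; last first.
  split; first exact: measurable_eball.
  by have /andP[] := mu_eball dmu 0 (k0 k).
apply/esym; rewrite -subTset => x _.
pose r := Num.sqrt (\sum_(i < n) (x ord0 i - (0 : Rn) ord0 i) ^+ 2).
exists (Num.truncn r) => //.
by rewrite /B /eball /= truncnS_gt.
Qed.

(** A copy of [mu] that carries the structure of a sigma-finite measure, which
    the Radon-Nikodym theorem requires. *)
Definition doubling_copy : set Rn -> \bar R := mu.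
HB.instance Definition _ := isMeasure.Build _ _ _ doubling_copy
  (measure0 mu) (measure_ge0 mu) (@measure_semi_sigma_additive _ _ _ mu).
HB.instance Definition _ := Measure_isSigmaFinite.Build _ _ _ doubling_copy
  doubling_sigma_finite.

Variables (w : Rn -> R) (p : R).
Hypothesis p1 : 1 < p.
Hypothesis ww : weight w.
Let q := p / (p - 1).
Let sigma := fun x => w x `^ (- (p - 1)^-1).

Let p0 : 0 < p. Proof. exact: lt_trans p1. Qed.
Let pB0 : 0 < p - 1. Proof. by rewrite subr_gt0. Qed.
Let q1 : 1 < q. Proof. by rewrite /q ltr_pdivlMr// mul1r ltrBlDr ltrDl. Qed.
Let q0 : 0 < q. Proof. exact: lt_trans q1. Qed.
Let pq : p^-1 + q^-1 = 1.
Proof. by rewrite /q; field; rewrite !gt_eqF. Qed.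
Let mw : measurable_fun [set: Rn] w. Proof. by case: ww. Qed.
Let w0 x : 0 < w x. Proof. by case: ww. Qed.
Let mwpow (e : R) : measurable_fun [set: Rn] (fun x => w x `^ e).
Proof. exact: measurable_powRr. Qed.
Let wVK x : w x `^ p^-1 * w x `^ (- p^-1) = 1.
Proof. by rewrite -powRD ?subrr ?powRr0// (gt_eqF (w0 x)) implybT. Qed.

(* Multiplication by a power of [w] turns the dual weighted norm into an
   unweighted one and preserves density and separation. *)
Let dual (g : Rn -> R) x := g x * w x `^ (- p^-1).

Lemma lq_dual g : lq mu q (dual g) = LpN mu q sigma g.
Proof.
rewrite /lq /LpN; congr (_ `^ _)%E; apply: eq_integral => x _; apply: (congr1 EFin).
rewrite /dual normrM (ger0_norm (powR_ge0 _ _)) powRM ?powR_ge0// -powRrM.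
rewrite /sigma /q; congr (_ * _ `^ _).
by rewrite mulNr mulrA mulVf ?gt_eqF// mul1r.
Qed.

Let m_dual g : measurable_fun [set: Rn] g -> measurable_fun [set: Rn] (dual g).
Proof. by move=> mg; exact: measurable_funM. Qed.

Lemma weighted_duality (D : set (Rn -> R)) (u : Rn -> R) (K : R) :
  test_space mu D -> Ainf mu sigma -> measurable_fun [set: Rn] u -> 0 <= K ->
  (forall g, D g -> (`| \int[mu]_x (u x * g x)%:E | <= K%:E * LpN mu q sigma g)%E) ->
  (LpN mu p w u <= K%:E)%E.
Proof.
move=> tD si mU K0 uK; have qle := ltW q1.
pose smu : {sigma_finite_measure set Rn -> \bar R} := doubling_copy.
have lq_dualE g : lq smu q (dual g) = LpN mu q sigma g := lq_dual g.
pose D1 : set (Rn -> R) := [set dual g | g in D].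
have Dfin g : D g -> inLq mu q (dual g).
  move=> Dg; split; first by apply: m_dual; exact: (test_measurable tD).
  by rewrite lq_dual; exact: (test_Lp tD qle si Dg).
have U1 : measurable_fun [set: Rn] (fun x => u x * w x `^ p^-1) by exact: measurable_funM.
have dualE v g x : (v x * w x `^ p^-1) * dual g x = v x * g x.
  by rewrite /dual mulrACA wVK mulr1.
have dual_lin (a : R) f g : (fun x => a * dual f x + dual g x) = dual (fun x => a * f x + g x).
  by apply/funext => x; rewrite /dual mulrDl mulrA.
have D10 : D1 (cst 0).
  exists (cst 0); first exact: test_zero tD.
  by apply/funext => x; rewrite /dual mul0r.
have D1X G : D1 G -> inLq smu q G by move=> [g Dg <-]; exact: Dfin.
have D1lin (a : R) F G : D1 F -> D1 G -> D1 (fun x => a * F x + G x).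
  move=> [f Df <-] [g Dg <-]; rewrite dual_lin; exists (fun x => a * f x + g x) => //.
  exact: test_linear tD _ _ _ Df Dg.
have D1dense F (e : R) : inLq smu q F -> 0 < e ->
    exists2 G, D1 G & rlq smu q (fun x => F x - G x) < e.
  move=> [mF Foo] e0; pose f x := F x * w x `^ p^-1.
  have mf : measurable_fun [set: Rn] f by exact: measurable_funM.
  have FE : F = dual f.
    by apply/funext => x; rewrite /dual /f -mulrA wVK mulr1.
  have foo : (LpN mu q sigma f < +oo)%E by rewrite -lq_dual -FE.
  have [g Dg gfe] := test_dense tD qle si mf foo e0.
  exists (dual g); first by exists g.
  have E : (fun x => F x - dual g x) = dual (fun x => f x - g x).
    by rewrite FE; apply/funext => x; rewrite /dual mulrBl.
  have h := lq_dual (fun x => f x - g x); rewrite -h in gfe.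
  have mg := test_measurable tD Dg.
  have Xfg : inLq mu q (dual (fun x => f x - g x)).
    split; last exact: lt_le_trans gfe (leey _).
    by apply: m_dual; exact: measurable_funB.
  by rewrite E -lte_fin (rlqK Xfg).
have uK1 G : D1 G -> (`| \int[smu]_x ((u x * w x `^ p^-1) * G x)%:E | <=
    (K * rlq smu q G)%:E)%E.
  move=> [g Dg <-]; rewrite EFinM rlqK; last exact: Dfin.
  rewrite lq_dualE; have := uK _ Dg; congr (`| _ | <= _)%E.
  by apply: eq_integral => x _; rewrite dualE.
have D1sep (v : Rn -> R) : measurable_fun [set: Rn] v ->
    (forall G, D1 G -> smu.-integrable [set: Rn] (fun x => (v x * G x)%:E) /\
       (\int[smu]_x (v x * G x)%:E = 0)%E) -> \forall x \ae smu, v x = 0.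
  move=> mv vG; have mV : measurable_fun [set: Rn] (dual v) by exact: m_dual.
  have V0 : \forall x \ae mu, dual v x = 0.
    apply: (test_separating tD mV) => g Dg.
    have [|i1 i2] := vG (dual g); first by exists g.
    rewrite (_ : (fun x => (dual v x * g x)%:E) = (fun x => (v x * dual g x)%:E))//.
    by apply/funext => x; rewrite /dual mulrAC mulrA.
  apply: filterS V0 => x /eqP; rewrite /dual mulf_eq0 => /orP[/eqP//|].
  by rewrite gt_eqF// powR_gt0.
have := lq_duality p1 q1 pq D10 D1X D1lin D1dense U1 K0 uK1 D1sep.
have -> : (\int[smu]_x (`|u x * w x `^ p^-1| `^ p)%:E =
    \int[mu]_x (`|u x| `^ p * w x)%:E)%E.
  apply: eq_integral => x _; apply: (congr1 EFin).
  rewrite normrM (ger0_norm (powR_ge0 _ _)) powRM ?powR_ge0// -powRrM.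
  by rewrite mulVf ?gt_eqF// powRr1// ltW.
rewrite /LpN => h; have ip0 : 0 <= p^-1 by rewrite invr_ge0 ltW.
have I0 : (0 <= \int[mu]_x (`|u x| `^ p * w x)%:E)%E.
  by apply: integral_ge0 => x _; rewrite lee_fin mulr_ge0 ?powR_ge0// ltW.
have := gt0_ler_poweR ip0 _ _ h; rewrite !in_itv /= !leey !andbT I0 lee_fin powR_ge0.
by move=> /(_ isT isT) /le_trans; apply; rewrite -powRrM mulfV ?gt_eqF// powRr1.
Qed.

End WeightedDuality.

(** * The exponents *)

Section Exponents.
Context {R : realType}.
Implicit Types (p q x : R).

Lemma conjugate_gt1 x : 1 < x -> conjugate x%:E = (x / (x - 1))%:E.
Proof.
move=> x1; have x0 : 0 < x by exact: lt_trans x1.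
rewrite /hoelder_conjugate /= gt_eqF ?lte_fin//= .
by rewrite inver subr_eq0 gt_eqF// -EFinM.
Qed.

Lemma conjugate_ge1_fin x : 1 < x -> 1 < x / (x - 1).
Proof.
by move=> x1; rewrite ltr_pdivlMr ?subr_gt0// mul1r ltrBlDr ltrDl.
Qed.

Lemma div_EFin p q : 0 < q -> (p%:E / q%:E = (p / q)%:E)%E.
Proof. by move=> q0; rewrite inver gt_eqF// EFinM. Qed.

Lemma conjugate_anti p q : 1 < p -> p <= q -> q / (q - 1) <= p / (p - 1).
Proof.
move=> p1 pq; have q1 : 1 < q by exact: lt_le_trans pq.
have E x : 1 < x -> x / (x - 1) = 1 + (x - 1)^-1.
  by move=> x1; field; rewrite subr_eq0 gt_eqF.
by rewrite !E// lerD2l lef_pV2 ?posrE ?subr_gt0// lerD2r.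
Qed.

Lemma conjugate_ratio p q : 0 < p -> p < q ->
  conjugate (q%:E / p%:E)%E = (q / (q - p))%:E.
Proof.
move=> p0 pq; rewrite div_EFin// conjugate_gt1; last by rewrite ltr_pdivlMr// mul1r.
congr EFin; have qp : 0 < q - p by rewrite subr_gt0.
by field; rewrite !gt_eqF.
Qed.

(** The factor of [c_const] that does not appear on the left is a dual exponent,
    hence at least [1]. *)
Lemma c_const_ge (p0 p qq : R) (q0 : \bar R) : 1 <= p0 -> p0 < p -> 1 <= qq ->
  qq < p / (p - 1) -> conjugate q0 = qq%:E ->
  (((p / (p - p0)) `^ p0^-1 * (p / (p - 1) / (p / (p - 1) - qq)) `^ qq^-1)%:E <=
    c_const p0%:E p%:E q0)%E.
Proof.
move=> p01 p0p qq1 qp' qE; have p1 : 1 < p by exact: le_lt_trans p0p.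
have p00 : 0 < p0 by exact: lt_le_trans p01.
have qq0 : 0 < qq by exact: lt_le_trans qq1.
have ip0 : 0 <= p0^-1 by rewrite invr_ge0 ltW.
rewrite /c_const qE (conjugate_gt1 p1) (conjugate_ratio qq0 qp') (conjugate_ratio p00 p0p).
rewrite [fine _]/= [fine p0%:E]/= poweR_EFin mulrC EFinM.
apply: lee_wpmul2l; first by rewrite lee_fin powR_ge0.
rewrite -poweR_EFin; have W0 : (0 <= (p / (p - p0))%:E :> \bar R)%E.
  by rewrite lee_fin divr_ge0 ?subr_ge0 ?(ltW p0p)// ltW// (lt_trans ltr01).
set Z := conjugate _; have Z1 : (1 <= Z)%E.
  apply: hoelder_conj_ge1; have p'0 : 0 < p / (p - 1) := lt_trans qq0 qp'.
  move: p01; rewrite le_eqVlt => /predU1P[<-|p0gt1].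
    by rewrite hoelder_conjugate1 inver gt_eqF// mulyr gtr0_sg ?invr_gt0// mul1e leey.
  rewrite (conjugate_gt1 p0gt1) div_EFin// lee_fin ler_pdivlMr// mul1r.
  exact: conjugate_anti p0gt1 (ltW p0p).
have := gt0_ler_poweR ip0; apply; rewrite ?in_itv/= ?leey ?andbT//.
  by rewrite mule_ge0// (le_trans _ Z1).
by rewrite lee_pemull.
Qed.

End Exponents.

(** * From sparse forms to operator norms *)

Section SparseOperators.
Context {R : realType} {n : nat}.
Local Notation Rn := (Rn R n).
Variables (mu : {measure set Rn -> \bar R}) (C : R).
Hypothesis dmu : doubling mu.
Hypothesis dC : doubling_bound mu C.
Variables (D : set (Rn -> R)) (T : (Rn -> R) -> (Rn -> R)).
Variables (cT eta p0 p s qq : R) (q0 : \bar R) (w : Rn -> R).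
Hypothesis tD : test_space mu D.
Hypothesis cT0 : 0 < cT.
Hypothesis eta0 : 0 < eta.
Hypothesis p01 : 1 <= p0.
Hypothesis p0p : p0 < p.
Hypothesis s1 : 1 <= s.
Hypothesis qq1 : 1 <= qq.
Let p' := p / (p - 1).
Hypothesis psE : (p * s)^-1 = qq^-1 - p'^-1.
Hypothesis qE : conjugate q0 = qq%:E.
Hypothesis sT : sparse_dominated mu D T p0%:E q0 cT eta.
Hypothesis aw : A1 mu w.
Let v := fun x => w x `^ s.
Hypothesis av : A1 mu v.

Let E : R := C ^+ n.+4.
Let K := fine (Ainf_const mu v).
Let A := fine (A1_const mu v).
Let W := (p / (p - p0)) `^ p0^-1 * (p' / (p' - qq)) `^ qq^-1.
Let p1 : 1 < p. Proof. exact: le_lt_trans p0p. Qed.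
Let pgt0 : 0 < p. Proof. exact: lt_trans p1. Qed.
Let s0 : 0 < s. Proof. exact: lt_le_trans s1. Qed.
Let qq0 : 0 < qq. Proof. exact: lt_le_trans qq1. Qed.
Let p'1 : 1 < p'. Proof. exact: conjugate_ge1_fin. Qed.
Let p'0 : 0 < p'. Proof. exact: lt_trans p'1. Qed.
Let ps0 : 0 < p * s. Proof. exact: mulr_gt0. Qed.
Let qp' : qq < p'.
Proof. by rewrite -ltf_pV2// -subr_gt0 -psE invr_gt0. Qed.
Let E1 : 1 <= E. Proof. by apply: exprn_ege1; exact: (doubling_bound_ge1 dmu dC). Qed.
Let E0 : 0 <= E. Proof. exact: le_trans E1. Qed.
Let K1 : 1 <= K. Proof. exact: (Ainf_const_ge1 dmu dC). Qed.
Let A1' : 1 <= A. Proof. exact: (A1_const_ge1 dmu). Qed.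
Let K0 : 0 <= K. Proof. exact: le_trans K1. Qed.
Let A0 : 0 <= A. Proof. exact: le_trans A1'. Qed.
Let W0 : 0 <= W. Proof. by rewrite mulr_ge0 ?powR_ge0. Qed.
Let F0 : 0 <= form_const n E eta.
Proof.
rewrite /form_const; apply: mulr_ge0; last first.
  by apply: mulr_ge0; [exact: expR_ge0|exact: mulr_ge0 (exprn_ge0 _ E0)].
apply: mulr_ge0; first exact: mulr_ge0 (exprn_ge0 _ E0).
by apply: divr_ge0; [exact: exprn_ge0|exact: ltW].
Qed.

Lemma Ainf_const_fin : Ainf_const mu v = K%:E.
Proof.
rewrite fineK// ge0_fin_numE; first by have [] := A1_Ainf dmu dC av.
have := K1; rewrite /K; case: (Ainf_const mu v) => [r||] /=; last 2 first.
- by [].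
- by rewrite ler10.
by move=> r1; rewrite lee_fin (le_trans ler01).
Qed.

Lemma A1_const_fin : A1_const mu v = A%:E.
Proof.
have := A1'; rewrite /A; have [_] := av; case: (A1_const mu v) => [r||] //=.
by rewrite ler10.
Qed.

Let B := cT * (form_const n E eta * W * K `^ p'^-1 * A `^ (p * s)^-1).

Lemma op_norm_le : (op_norm mu D p w T <= B%:E)%E.
Proof.
have B0 : 0 <= B.
  apply: mulr_ge0; first exact: ltW.
  exact: mulr_ge0 (mulr_ge0 (mulr_ge0 F0 W0) (powR_ge0 _ _)) (powR_ge0 _ _).
have [[mT _ _] dom] := sT; have [ww _] := aw.
have wi := A1_Ainf dmu dC aw; have si := A1_dual_Ainf dmu dC p1 aw.
apply: ereal_inf_lbound; exists B => //; split => // f Df.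
have fN : (LpN mu p w f < +oo)%E := test_Lp tD (ltW p1) wi Df.
have f0 : (0 <= LpN mu p w f)%E by exact: poweR_ge0.
have fE : LpN mu p w f = (fine (LpN mu p w f))%:E by rewrite fineK// ge0_fin_numE.
rewrite fE -EFinM; apply: (weighted_duality dmu p1 ww tD si (mT _ Df)) => [|g Dg].
  by rewrite mulr_ge0// fine_ge0.
have gN := test_Lp tD (ltW p'1) si Dg.
have [S sS /le_trans] := dom f g Df Dg; apply; rewrite qE.
have := weighted_sparse_bound dmu dC p01 p0p s1 qq1 psE ww av
  (test_measurable tD Df) (test_measurable tD Dg) eta0 sS fN gN.
move=> h; have c0 : (0 <= cT%:E)%E by rewrite lee_fin ltW.
apply: le_trans (lee_wpmul2l c0 h) _.
by rewrite (EFinM B) -fE /B (EFinM cT) !muleA.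
Qed.

Let cp := c_const p0%:E p%:E q0.
Let cpW : (W%:E <= cp)%E. Proof. exact: c_const_ge. Qed.

Lemma op_norm_le_mixed : (op_norm mu D p w T <=
  (cT * form_const n E eta)%:E * cp * Ainf_const mu v `^ p'^-1 *
    A1_const mu v `^ (p * s)^-1)%E.
Proof.
apply: le_trans op_norm_le _; rewrite Ainf_const_fin A1_const_fin !poweR_EFin.
have -> : B = cT * form_const n E eta * W * K `^ p'^-1 * A `^ (p * s)^-1.
  by rewrite /B !mulrA.
have k0 : (0 <= (K `^ p'^-1)%:E)%E by rewrite lee_fin powR_ge0.
have a0 : (0 <= (A `^ (p * s)^-1)%:E)%E by rewrite lee_fin powR_ge0.
have c0 : (0 <= (cT * form_const n E eta)%:E)%E.
  by rewrite lee_fin; exact: mulr_ge0 (ltW cT0) F0.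
rewrite (EFinM _ (A `^ _)) (EFinM _ (K `^ _)) (EFinM _ W).
exact: lee_wpmul2r a0 _ _ (lee_wpmul2r k0 (lee_wpmul2l c0 cpW)).
Qed.

(** The Ainf constant is at most a multiple of the A1 constant, and by [psE] the
    two exponents add up to [qq^-1]. *)
Lemma op_norm_le_A1 : (op_norm mu D p w T <=
  (cT * form_const n E eta * E)%:E * (cp * A1_const mu v `^ qq^-1))%E.
Proof.
apply: le_trans op_norm_le _; rewrite A1_const_fin poweR_EFin.
have KA : K <= E * A.
  by have := Ainf_le_A1 dmu dC av; rewrite Ainf_const_fin lee_fin.
have ip0 : 0 <= p'^-1 by rewrite invr_ge0 ltW.
have ip1 : p'^-1 <= 1 by rewrite invf_le1// ltW.
have KE : K `^ p'^-1 * A `^ (p * s)^-1 <= E * A `^ qq^-1.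
  have -> : A `^ qq^-1 = A `^ p'^-1 * A `^ (p * s)^-1.
    by rewrite -powRD ?(gt_eqF (lt_le_trans ltr01 A1')) ?implybT// psE subrKC.
  rewrite mulrA; apply: ler_wpM2r; first exact: powR_ge0.
  apply: le_trans (ler_powR2 ip0 K0 KA) _.
  rewrite (powRM _ E0 A0) ler_wpM2r ?powR_ge0//.
  by rewrite -[leRHS](powRr1 E0) ler_powR.
apply: (@le_trans _ _ ((cT * form_const n E eta * E)%:E * (W%:E * (A `^ qq^-1)%:E))%E).
  rewrite -!EFinM lee_fin /B.
  have h : 0 <= cT * form_const n E eta * W := mulr_ge0 (mulr_ge0 (ltW cT0) F0) W0.
  have := ler_wpM2l h KE; congr (_ <= _); first by rewrite !mulrA.
  exact: mulrACA.
apply: lee_wpmul2l.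
  by rewrite lee_fin; exact: mulr_ge0 (mulr_ge0 (ltW cT0) F0) E0.
by apply: lee_wpmul2r => //; rewrite lee_fin powR_ge0.
Qed.

End SparseOperators.

(** * Weighted bounds under sparse domination *)

Lemma powR_A1 (R : realType) (n : nat) (mu : {measure set (Rn R n) -> \bar R})
    (w : Rn R n -> R) (s : R) : doubling mu -> 1 < s -> A1 mu w ->
  (RH_const mu s%:E w < +oo)%E -> A1 mu (fun x => w x `^ s).
Proof.
move=> dmu s1 aw rw; have [_ h] := A1_const_powR dmu s1 aw rw.
have [[mw w0] _] := aw; split; last exact: le_lt_trans h (ltry _).
by split=> [|x]; [exact: measurable_powRr|exact: powR_gt0].
Qed.

Theorem theorem1p3 (R : realType) (n : nat) (hn : (0 < n)%N)
    (nu cT eta : R) (hcT : 0 < cT) (heta : 0 < eta <= 1) :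
  exists c c' : R, [/\ 0 < c, 0 < c' &
  forall mu : {measure set (Rn R n) -> \bar R},
    doubling mu -> doubling_dim mu = nu ->
  forall D : set (Rn R n -> R), test_space mu D ->
  forall (p0 p : R) (q0 : \bar R), 1 <= p0 -> p0 < p -> (p%:E < q0)%E ->
  forall T : (Rn R n -> R) -> (Rn R n -> R),
    sparse_dominated mu D T p0%:E q0 cT eta ->
  forall w : Rn R n -> R,
  let s : \bar R := conjugate (q0 / p%:E)%E in
  let p' : R := fine (conjugate p%:E) in
  let q0' : R := fine (conjugate q0) in
  let ws : Rn R n -> R := fun x => w x `^ fine s in
  let cp : \bar R := c_const p0%:E p%:E q0 in
  A1 mu w -> RH mu s w ->
  [/\ (op_norm mu D p w T <=
         c%:E * cp * Ainf_const mu ws `^ p'^-1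
                   * A1_const mu ws `^ (p * fine s)^-1)%E,
      (op_norm mu D p w T <= c'%:E * (cp * A1_const mu ws `^ q0'^-1))%E &
      (cp * A1_const mu ws `^ q0'^-1 <=
         cp * (A1_const mu w * RH_const mu s w) `^ final_exponent p q0)%E]].

Proof.
pose C : R := 2 `^ nu + 1; pose E : R := C ^+ n.+4.
have [eta0 _] := andP heta.
have C0 : 0 < C by rewrite addr_gt0// powR_gt0.
have E0 : 0 < E by exact: exprn_gt0.
have F0 : 0 < form_const n E eta.
  rewrite /form_const; apply: mulr_gt0; last first.
    by apply: mulr_gt0; [exact: expR_gt0|apply: mulr_gt0 => //; exact: exprn_gt0].
  apply: mulr_gt0; first by apply: mulr_gt0 => //; exact: exprn_gt0.
  by apply: divr_gt0 => //; exact: exprn_gt0.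
have cF0 : 0 < cT * form_const n E eta by exact: mulr_gt0.
exists (cT * form_const n E eta), (cT * form_const n E eta * E).
split; [exact: cF0|exact: mulr_gt0|].
move=> mu dmu dnu D tD p0 p q0 p01 p0p pq0 T sT w s p' q0' ws cp aw rw.
have dC : doubling_bound mu C by rewrite /C -dnu; exact: doubling_bound_dim.
have p1 : 1 < p := le_lt_trans p01 p0p.
have pgt0 : 0 < p := lt_trans ltr01 p1.
have p'E : p' = p / (p - 1) by rewrite /p' conjugate_gt1.
case: q0 pq0 sT @s @q0' @cp @ws rw => [q| |//] pq sT /=.
- rewrite lte_fin in pq; rewrite (conjugate_ratio pgt0 pq).
  have q1 : 1 < q := lt_trans p1 pq.
  have qp0 : 0 < q - p by rewrite subr_gt0.
  have qgt0 : 0 < q := lt_trans pgt0 pq.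
  have qqE : conjugate q%:E = (q / (q - 1))%:E by exact: conjugate_gt1.
  rewrite qqE /=; set s := q / (q - p); set qq := q / (q - 1).
  have s1 : 1 < s by rewrite /s ltr_pdivlMr// mul1r ltrBlDr ltrDl.
  have qq1 : 1 < qq := conjugate_ge1_fin q1.
  rewrite /RH eqe (gt_eqF s1) => -[ww rw].
  have av := powR_A1 dmu s1 aw rw.
  have p10 : 0 < p - 1 by rewrite subr_gt0.
  have q10 : 0 < q - 1 by rewrite subr_gt0.
  have psE : (p * s)^-1 = qq^-1 - (p / (p - 1))^-1.
    by rewrite /s /qq; field; rewrite !gt_eqF.
  rewrite p'E; split.
  + exact: (op_norm_le_mixed dmu dC tD hcT eta0 p01 p0p (ltW s1) (ltW qq1) psE qqE sT aw av).
  + exact: (op_norm_le_A1 dmu dC tD hcT eta0 p01 p0p (ltW s1) (ltW qq1) psE qqE sT aw av).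
  + have [rh0 h] := A1_const_powR dmu s1 aw rw.
    apply: lee_wpmul2l; first by apply: mule_ge0; exact: poweR_ge0.
    have aE := A1_const_fin dmu av; have rE : RH_const mu s%:E w = (fine (RH_const mu s%:E w))%:E.
      by rewrite fineK// ge0_fin_numE.
    have wE : A1_const mu w = (fine (A1_const mu w))%:E.
      have := A1_const_ge1 dmu aw; have [_] := aw.
      by case: (A1_const mu w) => [r||] //=; rewrite ler10.
    rewrite rE wE -EFinM aE !poweR_EFin lee_fin; move: h; rewrite aE lee_fin => h.
    have iq0 : 0 <= qq^-1 by rewrite invr_ge0 ltW// (lt_trans ltr01).
    have A0 : 0 <= fine (A1_const mu (fun x => w x `^ s)).
      by apply: le_trans (A1_const_ge1 dmu av).
    apply: le_trans (ler_powR2 iq0 A0 h) _; rewrite -powRrM.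
    rewrite (_ : s / qq = (q - 1) / (q - p))//.
    by rewrite /s /qq; field; rewrite !gt_eqF.
- have sE : conjugate (+oo / p%:E)%E = 1%E.
    by rewrite inver gt_eqF// mulyr gtr0_sg ?invr_gt0// mul1e hoelder_conjugatey.
  rewrite sE /= => _.
  have wsE : (fun x => w x `^ 1) = w.
    by apply/funext => x; rewrite powRr1// ltW//; case: aw => -[].
  have av : A1 mu (fun x => w x `^ 1) by rewrite wsE.
  have p10 : 0 < p - 1 by rewrite subr_gt0.
  have psE : (p * 1)^-1 = 1^-1 - (p / (p - 1))^-1 by field; rewrite !gt_eqF.
  have qqE : conjugate +oo%E = 1%:E :> \bar R by exact: hoelder_conjugatey.
  rewrite p'E; split.
  + exact: (op_norm_le_mixed dmu dC tD hcT eta0 p01 p0p (lexx 1) (lexx 1) psE qqE sT aw av).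
  + exact: (op_norm_le_A1 dmu dC tD hcT eta0 p01 p0p (lexx 1) (lexx 1) psE qqE sT aw av).
  + by rewrite wsE /RH_const eqxx mule1 invr1.
Qed.
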